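(* Let the scale be $N=2$ and let $C_1,\dots,C_p$ be distinct cycles (for the map $z\mapsto z^2$ on $\mathbb{T}$). Then the wavelet representation $\mathfrak{R}_C=\mathfrak{R}_{C_1}\oplus\dots\oplus\mathfrak{R}_{C_p}=(H,U_C,\pi_C)$ has an orthogonal scaling vector, and it admits an orthogonal MRA super-wavelet: there exist a multiresolution analysis $(V_n)_{n\in\mathbb{Z}}$ for $\mathfrak{R}_C$ and a vector $\psi\in V_1\ominus V_0$ such that $\{T_C^k\psi:k\in\mathbb{Z}\}$ is an orthonormal basis of $V_1\ominus V_0$ and $\{U_C^mT_C^n\psi : m,n\in\mathbb{Z}\}$ is an orthonormal basis of $H$, where $T_C=\pi_C(z)$.
   Context: $\mathbb{T}$ is the unit circle; $\widehat f(\xi)=\int_{\mathbb{R}} f(x)e^{-i\xi x}\,dx$. A cycle of length $q$ (for $N=2$) is a set $\{z_1,\dots,z_q\}$ of distinct points of $\mathbb{T}$ with $z_1^2=z_2,\dots,z_{q-1}^2=z_q,\ z_q^2=z_1$. The classical operators on $L^2(\mathbb{R})$ are $U\xi(x)=\frac1{\sqrt2}\xi(x/2)$ and, for $f\in L^\infty(\mathbb{T})$, $\pi(f)$, which on the Fourier transform side is multiplication by the $2\pi$-periodic function $x\mapsto f(e^{-ix})$; thus $T=\pi(z)$ ($z$ = identity function on $\mathbb{T}$) is $T\xi(x)=\xi(x-1)$. For a cycle $D=\{z_1,\dots,z_q\}$, the wavelet representation $\mathfrak{R}_D$ consists of the Hilbert space $L^2(\mathbb{R})^q$, the unitary $U_D(\xi_1,\dots,\xi_q)=(U\xi_2,U\xi_3,\dots,U\xi_q,U\xi_1)$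 and the representation $\pi_D(f)(\xi_1,\dots,\xi_q)=(\pi(f(z_1z))\xi_1,\dots,\pi(f(z_qz))\xi_q)$ of $L^\infty(\mathbb{T})$; in particular $\pi_D(z)(\xi_1,\dots,\xi_q)=(z_1T\xi_1,\dots,z_qT\xi_q)$. Direct sums are taken componentwise. A multiresolution analysis (MRA) for such a triple $(H,U,\pi)$, with $T=\pi(z)$, is a sequence $(V_n)_{n\in\mathbb{Z}}$ of closed subspaces of $H$ with $V_n\subset V_{n+1}$; $\overline{\bigcup_n V_n}=H$; $\bigcap_n V_n=\{0\}$; $U(V_n)=V_{n-1}$; and some $\varphi\in V_0$ such that $\{T^k\varphi:k\in\mathbb{Z}\}$ is an orthonormal basis of $V_0$; such a $\varphi$ is called an orthogonal scaling vector. *)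

(* Defs.v *)
From HB Require Import structures.
From mathcomp Require Import all_boot all_order all_algebra.
From mathcomp Require Import all_classical all_reals all_analysis.
From mathcomp Require Import complex sesquilinear ring.

Set Implicit Arguments.
Unset Strict Implicit.
Unset Printing Implicit Defensive.

Import Order.TTheory GRing.Theory Num.Theory.
Import numFieldNormedType.Exports.

Local Open Scope classical_set_scope.
Local Open Scope ring_scope.
Local Open Scope complex_scope.
Local Open Scope quotient_scope.

Local Notation Re := (@complex.Re _).
Local Notation Im := (@complex.Im _).

Section SquareIntegrable.
Variable R : realType.
Local Notation C := R[i].

Local Notation mu := (@lebesgue_measure R).

(* Square-integrability of a complex function, through its real and imaginary
   parts, since the library's Lp spaces are real. *)
Definition sqint : {pred R -> C} :=
  [pred f : R -> C | (Re \o f \in Lfun mu 2%:E) && (Im \o f \in Lfun mu 2%:E)].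

Let one_le2 : (1 <= 2%:E :> \bar R)%E.
Proof. by rewrite lee_fin ler1n. Qed.

Lemma ReZD (a x y : C) :
  Re (a *: x + y) = Re a * Re x - Im a * Im x + Re y.
Proof. by case: a x y => [a b] [c d] [e g]. Qed.

Lemma ImZD (a x y : C) :
  Im (a *: x + y) = Re a * Im x + Im a * Re x + Im y.
Proof. by case: a x y => [a b] [c d] [e g]. Qed.

Fact sqint_submod_closed : submod_closed sqint.
Proof.
have cl := Lfun_submod_closed mu one_le2.
split.
  rewrite inE; apply/andP; split.
    by rewrite (_ : Re \o _ = 0) ?rpred0 //; case: cl.
  by rewrite (_ : Im \o _ = 0) ?rpred0 //; case: cl.
move=> a f g /andP[f1 f2] /andP[g1 g2].
rewrite inE; apply/andP; split.
  rewrite (_ : Re \o _ = Re a *: (Re \o f) + (- Im a *: (Im \o f) + (Re \o g))).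
    by apply: (cl.2) => //; apply: (cl.2).
  apply/funext => x /=; rewrite [LHS]ReZD.
  by rewrite -[RHS]/(Re a * Re (f x) + (- Im a * Im (f x) + Re (g x))) mulNr addrA.
rewrite (_ : Im \o _ = Re a *: (Im \o f) + (Im a *: (Re \o f) + (Im \o g))).
  by apply: (cl.2) => //; apply: (cl.2).
apply/funext => x /=; rewrite [LHS]ImZD.
by rewrite -[RHS]/(Re a * Im (f x) + (Im a * Re (f x) + Im (g x))) addrA.
Qed.

HB.instance Definition _ :=
  GRing.isSubmodClosed.Build C (R -> C) sqint sqint_submod_closed.

Record sqintfun := SqIntFun { sqint_val :> R -> C ; _ : sqint_val \in sqint }.
HB.instance Definition _ := [isSub for sqint_val].
HB.instance Definition _ := [Choice of sqintfun by <:].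
HB.instance Definition _ := [SubChoice_isSubLmodule of sqintfun by <:].

Definition ae0 : {pred sqintfun} :=
  [pred f : sqintfun | `[< {ae mu, forall x, f x = 0} >]].

Fact ae0_submod_closed : submod_closed ae0.
Proof.
split; first by rewrite inE; exact: aeW.
move=> a f g; rewrite !inE => f0 g0.
apply: (@filterS2 _ _ (ae_filter_ringOfSetsType mu) _ _ _ _ f0 g0) => x {}f0 {}g0.
by rewrite -[LHS]/(a * f x + g x) f0 g0 mulr0 addr0.
Qed.

HB.instance Definition _ :=
  GRing.isSubmodClosed.Build C sqintfun ae0 ae0_submod_closed.

(* The complex Hilbert space L^2(R): square-integrable functions modulo equality
   almost everywhere. An element coerces to one of its representatives. *)
Definition L2 : Type := @Quotient.quot sqintfun ae0.
HB.instance Definition _ := GRing.Zmodule.on L2.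
HB.instance Definition _ := EqQuotient.on L2.

Definition L2_fun (f : L2) : R -> C := (repr f : sqintfun).
Coercion L2_fun : L2 >-> Funclass.

Lemma pi_eqP (f g : sqintfun) : reflect (\pi_L2 f = \pi_L2 g) (f - g \in ae0).
Proof. by rewrite Quotient.idealrBE; exact: eqP. Qed.

Lemma repr_pi (f : sqintfun) : repr (\pi_L2 f) - f \in ae0.
Proof. by apply/pi_eqP; rewrite reprK. Qed.

Definition L2_scale (a : C) (f : L2) : L2 := \pi_L2 (a *: (repr f : sqintfun)).

Lemma pi_scale a (f : sqintfun) : L2_scale a (\pi_L2 f) = \pi_L2 (a *: f).
Proof. by apply/pi_eqP; rewrite -scalerBr rpredZ// repr_pi. Qed.

Lemma pi_addE (f g : sqintfun) : \pi_L2 f + \pi_L2 g = \pi_L2 (f + g).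
Proof. exact/esym/Quotient.pi_add. Qed.

Program Definition L2_lmodMixin :=
  @GRing.Zmodule_isLmodule.Build C L2 L2_scale _ _ _ _.
Next Obligation.
by move=> a b v; rewrite -[v]reprK (pi_scale b) (pi_scale a) pi_scale scalerA.
Qed.
Next Obligation. by move=> v; rewrite -[v]reprK pi_scale scale1r. Qed.
Next Obligation.
move=> a u v; rewrite -[u]reprK -[v]reprK.
by rewrite pi_addE !pi_scale pi_addE scalerDr.
Qed.
Next Obligation.
by move=> v a b; rewrite -[v]reprK !pi_scale pi_addE scalerDl.
Qed.
HB.instance Definition _ := L2_lmodMixin.

Definition cintegral (D : set R) (f : R -> C) : C :=
  (\int[mu]_(x in D) Re (f x)) +i* (\int[mu]_(x in D) Im (f x)).

(* Linear in the first argument. *)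
Definition L2_dot (f g : L2) : C := cintegral setT (fun x => f x * conjc (g x)).

Let rdot (u v : R -> R) : R := \int[mu]_x (u x * v x).

Let rdotC u v : rdot u v = rdot v u.
Proof. by apply: eq_Rintegral => x _; rewrite mulrC. Qed.

Let Lmul (u v : R -> R) : u \in Lfun mu 2%:E -> v \in Lfun mu 2%:E ->
  mu.-integrable setT (EFin \o (fun x => u x * v x)).
Proof. by move=> u2 v2; apply/Lfun1_integrable; exact: Lfun2_mul_Lfun1. Qed.

Let rdot3 a b (u v w t : R -> R) : u \in Lfun mu 2%:E -> v \in Lfun mu 2%:E ->
    w \in Lfun mu 2%:E -> t \in Lfun mu 2%:E ->
  rdot (fun x => a * u x + b * v x + w x) t =
  a * rdot u t + b * rdot v t + rdot w t.
Proof.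
move=> u2 v2 w2 t2.
have iZ c (z : R -> R) : z \in Lfun mu 2%:E ->
    mu.-integrable setT (EFin \o (fun x => c * (z x * t x))).
  by move=> z2; have := integrableZl measurableT c (Lmul z2 t2); apply: eq_integrable.
rewrite /rdot -!RintegralZl//; [|exact: Lmul..].
rewrite -RintegralD//; [|exact: iZ..].
rewrite -RintegralD//; last 2 first.
- have := integrableD measurableT (iZ a _ u2) (iZ b _ v2).
  by apply: eq_integrable.
- exact: Lmul.
by apply: eq_Rintegral => x _; rewrite !mulrDl !mulrA.
Qed.

Let sdot (f g : sqintfun) : C := cintegral setT (fun x => f x * conjc (g x)).

Let f2 (f : sqintfun) : Re \o f \in Lfun mu 2%:E /\ Im \o f \in Lfun mu 2%:E.
Proof. by case: f => f /= /andP. Qed.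

Let sdotE f g : sdot f g =
  (rdot (Re \o f) (Re \o g) + rdot (Im \o f) (Im \o g)) +i*
  (rdot (Im \o f) (Re \o g) - rdot (Re \o f) (Im \o g)).
Proof.
have [[rf jf] [rg jg]] := (f2 f, f2 g).
rewrite /sdot /cintegral /rdot -RintegralD//; [|exact: Lmul..].
rewrite -RintegralB//; [|exact: Lmul..].
by congr Complex; apply: eq_Rintegral => x _ /=;
  case: (f x) (g x) => [a b] [c d] /=; rewrite ?mulrN ?opprK// addrC.
Qed.

Let sdotP a f g h : sdot (a *: f + g) h = a * sdot f h + sdot g h.
Proof.
have [[rf jf] [[rg jg] [rh jh]]] := (f2 f, (f2 g, f2 h)).
rewrite !sdotE.
have -> : Re \o (a *: f + g) =
    (fun x => Re a * (Re \o f) x + (- Im a) * (Im \o f) x + (Re \o g) x).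
  by apply/funext => x; rewrite mulNr; exact: ReZD.
have -> : Im \o (a *: f + g) =
    (fun x => Re a * (Im \o f) x + Im a * (Re \o f) x + (Im \o g) x).
  by apply/funext => x; exact: ImZD.
rewrite !rdot3//; case: a => [a b]; apply/eqP; rewrite eq_complex /=.
by apply/andP; split; apply/eqP; ring.
Qed.

Let sdotC f g : sdot f g = conjc (sdot g f).
Proof.
rewrite !sdotE /= (rdotC (Re \o f)) (rdotC (Im \o f) (Im \o g)).
by rewrite opprB (rdotC (Im \o f)) (rdotC (Re \o f)).
Qed.

Let sdot0 f g : f \in ae0 -> sdot f g = 0.
Proof.
rewrite inE => f0.
have [[rf jf] [rg jg]] := (f2 f, f2 g).
have r0 (u v : R -> R) : u \in Lfun mu 2%:E -> v \in Lfun mu 2%:E ->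
    {ae mu, forall x, u x = 0} -> rdot u v = 0.
  move=> u2 v2 u0; rewrite /rdot /Rintegral (_ : integral _ _ _ = 0%E)//.
  rewrite -(integral0 mu setT); apply: ae_eq_integral => //.
    by have /integrableP[] := Lmul u2 v2.
  apply: (@filterS _ _ (ae_filter_ringOfSetsType mu) _ _ _ u0) => x ux _.
  by rewrite ux mul0r.
have R0 : {ae mu, forall x, (Re \o f) x = 0}.
  by apply: (@filterS _ _ (ae_filter_ringOfSetsType mu) _ _ _ f0) => x /= ->.
have I0 : {ae mu, forall x, (Im \o f) x = 0}.
  by apply: (@filterS _ _ (ae_filter_ringOfSetsType mu) _ _ _ f0) => x /= ->.
by rewrite sdotE !r0// addr0 subr0.
Qed.

Let sdot_ael f f' g : f - f' \in ae0 -> sdot f g = sdot f' g.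
Proof.
by move=> /(sdot0 g); rewrite -scaleN1r addrC sdotP mulN1r addrC => /eqP;
  rewrite subr_eq0 => /eqP.
Qed.

Fact L2_dot_linearl a f g h : L2_dot (a *: f + g) h = a * L2_dot f h + L2_dot g h.
Proof.
rewrite -[LHS]/(sdot (repr (a *: f + g)) (repr h)).
rewrite (@sdot_ael _ (a *: (repr f : sqintfun) + repr g)); first exact: sdotP.
apply/pi_eqP; rewrite reprK -pi_addE; congr (_ + _).
by rewrite reprK.
Qed.

Fact L2_dot_conj f g : L2_dot f g = conjc (L2_dot g f).
Proof. exact: sdotC. Qed.

Fact L2_dot_bilinear :
  bilinear_for ( *%R : GRing.Scale.law C C) (conjc \; *%R) L2_dot.
Proof.
split=> [h a f g|h a f g] /=; first exact: L2_dot_linearl.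
rewrite L2_dot_conj L2_dot_linearl [L2_dot h f]L2_dot_conj [L2_dot h g]L2_dot_conj.
by rewrite rmorphD rmorphM.
Qed.


Let rdot_ge0 u : 0 <= rdot u u.
Proof. by apply: Rintegral_ge0 => x _; rewrite -expr2 sqr_ge0. Qed.

Let rdot_eq0 u : u \in Lfun mu 2%:E -> rdot u u = 0 ->
  {ae mu, forall x, u x = 0}.
Proof.
move=> u2 u0; have iu := Lmul u2 u2; have /integrableP[muu _] := iu.
have : (\int[mu]_x `|(EFin \o (fun x => u x * u x)%R) x| = 0)%E.
  rewrite -[RHS](_ : (rdot u u)%:E = 0%E); last by rewrite u0.
  rewrite /rdot /Rintegral fineK; last exact: integrable_fin_num.
  by apply: eq_integral => x _ /=; rewrite ger0_norm// -expr2 sqr_ge0.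
move/(ae_eq_integral_abs mu measurableT muu).
apply: (@filterS _ _ (ae_filter_ringOfSetsType mu)) => x /(_ I) /= -[] /eqP.
by rewrite mulf_eq0 orbb => /eqP.
Qed.

Fact L2_dot_gt0 f : f != 0 -> 0 < L2_dot f f.
Proof.
move=> f_neq0; rewrite -[L2_dot f f]/(sdot (repr f) (repr f)) sdotE.
set u := Re \o _; set v := Im \o _.
have [u2 v2] : u \in Lfun mu 2%:E /\ v \in Lfun mu 2%:E by exact: f2.
rewrite (rdotC v u) subrr ltcE /= eqxx /= lt_neqAle addr_ge0// andbT eq_sym.
apply: contra f_neq0; rewrite paddr_eq0// => /andP[/eqP u0 /eqP v0].
suff : \pi_L2 (repr f) = \pi_L2 (repr (0 : L2)) by rewrite !reprK => ->.
apply/pi_eqP.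
have z0 : (repr (0 : L2) : sqintfun) \in ae0.
  rewrite -[repr _]subr0; apply/pi_eqP; rewrite reprK.
  by apply: (addrI (\pi_L2 0)); rewrite pi_addE !addr0.
rewrite rpredB// inE.
apply: (@filterS2 _ _ (ae_filter_ringOfSetsType mu) _ _ _ _
  (rdot_eq0 u2 u0) (rdot_eq0 v2 v0)) => x.
by rewrite /u /v /=; case: (repr f x) => a b /= -> ->.
Qed.

HB.instance Definition _ :=
  bilinear_isBilinear.Build C L2 L2 C *%R (conjc \; *%R) L2_dot L2_dot_bilinear.
HB.instance Definition _ :=
  isHermitianSesquilinear.Build C L2 false conjc L2_dot
    (fun f g => etrans (L2_dot_conj f g) (esym (mul1r _))).
HB.instance Definition _ := isDotProduct.Build C L2 L2_dot L2_dot_gt0.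
End SquareIntegrable.

Section DirectSum.
Variables (K : nzRingType) (I : finType) (H : I -> lmodType K).

(* The type alias carries the componentwise module structure; the library has
   it only for non-dependent functions. *)
Definition dsum : Type := forall i, H i.

HB.instance Definition _ := gen_eqMixin dsum.
HB.instance Definition _ := gen_choiceMixin dsum.

Let add (x y : dsum) : dsum := fun i => x i + y i.
Let opp (x : dsum) : dsum := fun i => - x i.
Let zero : dsum := fun i => 0.
Let scale (a : K) (x : dsum) : dsum := fun i => a *: x i.

Let ext (x y : dsum) : (forall i, x i = y i) -> x = y.
Proof. exact: functional_extensionality_dep. Qed.

Program Definition dsum_zmodMixin :=
  @GRing.isZmodule.Build dsum zero opp add _ _ _ _.
Next Obligation. by move=> x y z; apply: ext => i; exact: addrA. Qed.
Next Obligation. by move=> x y; apply: ext => i; exact: addrC. Qed.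
Next Obligation. by move=> x; apply: ext => i; exact: add0r. Qed.
Next Obligation. by move=> x; apply: ext => i; exact: addNr. Qed.
HB.instance Definition _ := dsum_zmodMixin.

Program Definition dsum_lmodMixin :=
  @GRing.Zmodule_isLmodule.Build K dsum scale _ _ _ _.
Next Obligation. by move=> a b x; apply: ext => i; exact: scalerA. Qed.
Next Obligation. by move=> x; apply: ext => i; exact: scale1r. Qed.
Next Obligation. by move=> a x y; apply: ext => i; exact: scalerDr. Qed.
Next Obligation. by move=> x a b; apply: ext => i; exact: scalerDl. Qed.
HB.instance Definition _ := dsum_lmodMixin.
End DirectSum.

Section DirectSumDot.
Variables (R : realType) (I : finType) (H : I -> lmodType R[i]).
Variable d : forall i, {dot (H i) for @conjc R}.
Local Notation C := R[i].

Definition dsum_dot (x y : dsum H) : C := \sum_i d i (x i) (y i).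

Fact dsum_dot_conj x y : dsum_dot x y = (-1) ^+ false * conjc (dsum_dot y x).
Proof.
rewrite mul1r /dsum_dot rmorph_sum; apply: eq_bigr => i _ /=.
by rewrite hermC expr0 mul1r.
Qed.

Fact dsum_dot_bilinear :
  bilinear_for ( *%R : GRing.Scale.law C C) (conjc \; *%R) dsum_dot.
Proof.
have lin y a : {morph dsum_dot ^~ y : u v / a *: u + v >-> a * u + v}.
  move=> u v; rewrite /dsum_dot mulr_sumr -big_split /=; apply: eq_bigr => i _.
  by rewrite -[(a *: u + v) i]/(a *: u i + v i) linearPl.
split=> [y a u v|y a u v] /=; first exact: lin.
by rewrite !(dsum_dot_conj y) !mul1r lin rmorphD rmorphM.
Qed.

Fact dsum_dot_gt0 x : x != 0 -> 0 < dsum_dot x x.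
Proof.
move=> x_neq0.
have [i xi] : exists i, x i != 0.
  apply: contrapT => h; move/eqP: x_neq0; apply.
  apply: functional_extensionality_dep => i.
  by apply: contrapT => xi; apply: h; exists i; apply/eqP.
by rewrite /dsum_dot (bigD1 i)//= ltr_wpDr ?neq0_dnorm_gt0// sumr_ge0.
Qed.

HB.instance Definition _ :=
  bilinear_isBilinear.Build C (dsum H) (dsum H) C *%R (conjc \; *%R) dsum_dot
    dsum_dot_bilinear.
HB.instance Definition _ :=
  isHermitianSesquilinear.Build C (dsum H) false conjc dsum_dot dsum_dot_conj.
HB.instance Definition _ :=
  isDotProduct.Build C (dsum H) dsum_dot dsum_dot_gt0.
End DirectSumDot.

Section HilbertSpace.
Variables (R : realType) (H : lmodType R[i]) (d : {dot H for @conjc R}).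

Definition hnorm (x : H) : R := Num.sqrt (Re (d x x)).

Definition hclosure (A : set H) : set H :=
  [set x | forall e : R, 0 < e -> exists2 y, A y & hnorm (x - y) < e].

Definition closed_subspace (V : set H) : Prop :=
  [/\ V 0, forall (a : R[i]) x y, V x -> V y -> V (a *: x + y)
    & hclosure V `<=` V].

Definition span_family (I : Type) (b : I -> H) : set H :=
  [set x | exists (s : seq I) (c : I -> R[i]), x = \sum_(i <- s) c i *: b i].

(* Orthonormality of the family b, together with the density of its linear span
   in the closed subspace V; the second condition contains b i \in V. *)
Definition orthonormal_basis (I : eqType) (V : set H) (b : I -> H) : Prop :=
  (forall i j, d (b i) (b j) = (i == j)%:R) /\ hclosure (span_family b) = V.

(* The orthogonal complement of W in V, for W contained in V. *)
Definition orthocomplement (V W : set H) : set H :=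
  [set x | V x /\ forall y, W y -> d x y = 0].
End HilbertSpace.

(* Integer powers of a bijection A of H. *)
Definition iterz (H : zmodType) (A : H -> H) (k : int) : H -> H :=
  match k with
  | Posz n => iter n A
  | Negz n => iter n.+1 ('pinv_(fun=> 0) setT A)
  end.

Section Fourier.
Variable R : realType.
Local Notation C := R[i].
Local Notation mu := (@lebesgue_measure R).

(* The class in L2 of a square-integrable function g; the default value 0 is
   taken only when g is not square-integrable. *)
Definition L2_class (g : R -> C) : L2 R :=
  xget 0 [set f : L2 R | {ae mu, forall x, f x = g x}].

Definition expi (t : R) : C := cos t +i* sin t.

Definition truncated_fourier (f : R -> C) (n : nat) (xi : R) : C :=
  cintegral `[- n%:R, n%:R] (fun x => f x * expi (- (xi * x))).

(* The Fourier-Plancherel transform: the limit in L2, as n tends to infinity,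
   of xi |-> \int_(-n)^n f(x) e^(-i xi x) dx. *)
Definition fourier (f : L2 R) : L2 R :=
  xget 0 [set g : L2 R |
    (fun n => \int[mu]_xi (Normc.normc (truncated_fourier f n xi - g xi) ^+ 2)%:E)%E
      @ \oo --> 0%E].

Definition dilation (f : L2 R) : L2 R :=
  L2_class (fun x => ((Num.sqrt 2)^-1)%:C * f (x / 2)).

(* The operator pi(h) of L2: the Fourier transform of pi(h) f is
   x |-> h(e^(-ix)) (fourier f)(x). It depends only on the restriction of h to
   the unit circle, and is meant for h measurable and essentially bounded
   there. *)
Definition multiplier (h : C -> C) (f : L2 R) : L2 R :=
  xget 0 [set g : L2 R |
    {ae mu, forall x, fourier g x = h (expi (- x)) * fourier f x}].
End Fourier.

(* A triple (H, U, pi). *)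
Record wavelet_rep (R : realType) := WaveletRep {
  wspace : lmodType R[i];
  wdot : {dot wspace for @conjc R};
  wU : wspace -> wspace;
  wpi : (R[i] -> R[i]) -> wspace -> wspace
}.

(* pi(z), z the identity function of the unit circle. *)
Definition wT (R : realType) (W : wavelet_rep R) : wspace W -> wspace W :=
  wpi id.

Definition direct_sum (R : realType) (I : finType) (W : I -> wavelet_rep R) :
    wavelet_rep R :=
  @WaveletRep R (dsum (fun i => wspace (W i)))
    (dsum_dot (fun i => wdot (W i)))
    (fun x i => wU (x i))
    (fun f x i => wpi f (x i)).

(* For j : 'I_n, ordS j is j + 1 modulo n. *)
Record sqcycle (R : realType) := Cycle {
  clength : nat;
  cpoint : 'I_clength -> R[i];
  clength_gt0 : (0 < clength)%N;
  cpoint_circle : forall j, `|cpoint j| = 1;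
  cpoint_inj : injective cpoint;
  cpoint_sq : forall j, cpoint j ^+ 2 = cpoint (ordS j)
}.

Definition cycle_points (R : realType) (D : sqcycle R) : set R[i] :=
  range (@cpoint R D).

Definition cycle_rep (R : realType) (D : sqcycle R) : wavelet_rep R :=
  @WaveletRep R (dsum (fun _ : 'I_(clength D) => L2 R))
    (dsum_dot (fun _ => @L2_dot R))
    (fun x j => dilation (x (ordS j)))
    (fun f x j => multiplier (fun w => f (cpoint j * w)) (x j)).

Section MRA.
Variables (R : realType) (W : wavelet_rep R).
Local Notation H := (wspace W).
Local Notation d := (wdot W).

Definition mra_with (V : int -> set H) (phi : H) : Prop :=
  [/\ forall n, closed_subspace d (V n),
      forall n, V n `<=` V (n + 1),
      hclosure d (\bigcup_n V n) = setT /\ \bigcap_n V n = [set 0],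
      forall n, @wU R W @` V n = V (n - 1)
    & V 0 phi /\ orthonormal_basis d (V 0) (fun k : int => iterz (@wT R W) k phi)].

Definition mra (V : int -> set H) : Prop := exists phi, mra_with V phi.

Definition orthogonal_scaling_vector (phi : H) : Prop :=
  exists V, mra_with V phi.

Definition orthogonal_mra_super_wavelet (V : int -> set H) (psi : H) : Prop :=
  [/\ mra V,
      orthocomplement d (V 1) (V 0) psi,
      orthonormal_basis d (orthocomplement d (V 1) (V 0))
        (fun k : int => iterz (@wT R W) k psi)
    & orthonormal_basis d setT
        (fun mn : int * int =>
           iterz (@wU R W) mn.1 (iterz (@wT R W) mn.2 psi))].
End MRA.

(* Main.v *)
From HB Require Import structures.
Require Import Defs.
From mathcomp Require Import all_boot all_order all_algebra.
From mathcomp Require Import all_classical all_reals all_analysis.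
From mathcomp Require Import complex sesquilinear.
From mathcomp Require Import measurable_realfun.
From mathcomp Require Import ring lra.

Set Implicit Arguments.
Unset Strict Implicit.
Unset Printing Implicit Defensive.

Import Order.TTheory GRing.Theory Num.Theory.
Import numFieldNormedType.Exports.

Local Open Scope classical_set_scope.
Local Open Scope ring_scope.
Local Open Scope complex_scope.
Local Open Scope quotient_scope.

Local Notation Re := (@complex.Re _).
Local Notation Im := (@complex.Im _).

(* On the Fourier side, [U] sends the family [f_a] indexed by the points [z_a] of all the cycles
   to [sqrt 2 f_(sigma a) (2 xi)], where [z_(sigma a) = z_a^2], and [T] multiplies [f_a] by
   [z_a e^(-i xi)].  Let [E_a] be the Voronoi cell of all [xi] in ]-pi, pi[ for which [z_a] is, among
   the cycle points, strictly the nearest one to [z_a e^(-i xi)].  The arcs [z_a e^(-i E_a)] tile the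
   circle up to a null set, so the vector with transform [1_(E_a)] is a scaling vector of the
   space [V_0] of families with [f_a] supported in [E_a].  Squaring doubles small angles, hence
   [E_(sigma a) / 2] is contained in [E_a] and [U V_0] in [V_0].  With [tau] the inverse of
   [sigma], the arcs over [2 E_(tau a)] cover the circle twice, so those over
   [F_a = 2 E_(tau a) \ E_a] tile it once more, and [1_(F_a)] is the transform of the wavelet.
   That the powers of [z_a e^(-i xi)] are total on such a tile follows by approximating the
   indicators of small arcs by trigonometric polynomials. *)

(** * Complex numbers and complex-valued integrals *)

Section ComplexNumbers.
Variable R : realType.
Local Notation C := R[i].

(** [L2_class], [fourier] and [multiplier] are chosen by [xget] and fall back on 0, so their
    defining properties must be shown satisfiable before anything is computed. Plancherel comes from
    Parseval on bounded intervals, and surjectivity of the transform, which gives [multiplier] its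
    meaning, from the adjoint. Parseval and the bases of the analysis rest on one totality
    statement, for finitely many open sets mapped injectively into the circle. Orthonormality of the
    vectors $T^k\varphi$ says that the arcs carry exactly the Lebesgue measure of the circle; its
    mass $2\pi$ matches the Plancherel factor $2\pi$, which is why plain indicators serve without
    normalization. Two further properties of the nearest-point cells matter: they are bounded,
    whence the trivial intersection of the $V_n$, and they all contain a neighbourhood of 0, because
    distinct cycles share no point, whence the dense union. Ties between nearest points form null
    sets, so open and closed cells can be exchanged at will. *)

Definition nsq (z : C) : R := Re z ^+ 2 + Im z ^+ 2.

Lemma cReD (a b : C) : Re (a + b) = Re a + Re b.
Proof. by case: a b => [a1 a2] [b1 b2]. Qed.
Lemma cImD (a b : C) : Im (a + b) = Im a + Im b.
Proof. by case: a b => [a1 a2] [b1 b2]. Qed.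
Lemma cReN (a : C) : Re (- a) = - Re a.
Proof. by case: a. Qed.
Lemma cImN (a : C) : Im (- a) = - Im a.
Proof. by case: a. Qed.
Lemma cReM (a b : C) : Re (a * b) = Re a * Re b - Im a * Im b.
Proof. by case: a b => [a1 a2] [b1 b2]. Qed.
Lemma cImM (a b : C) : Im (a * b) = Re a * Im b + Im a * Re b.
Proof. by case: a b => [a1 a2] [b1 b2]. Qed.
Lemma cReJ (a : C) : Re (conjc a) = Re a.
Proof. by case: a. Qed.
Lemma cImJ (a : C) : Im (conjc a) = - Im a.
Proof. by case: a. Qed.
Definition ReImE := (cReD, cImD, cReN, cImN, cReM, cImM, cReJ, cImJ).

Lemma Re_sum (I : Type) (s : seq I) (P : pred I) (F : I -> C) :
  Re (\sum_(i <- s | P i) F i) = \sum_(i <- s | P i) Re (F i).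
Proof. by elim/big_rec2 : _ => //= i y x _ <-; rewrite cReD. Qed.

Lemma Im_sum (I : Type) (s : seq I) (P : pred I) (F : I -> C) :
  Im (\sum_(i <- s | P i) F i) = \sum_(i <- s | P i) Im (F i).
Proof. by elim/big_rec2 : _ => //= i y x _ <-; rewrite cImD. Qed.

Lemma ceqP (a b : C) : Re a = Re b -> Im a = Im b -> a = b.
Proof. by case: a b => [a1 a2] [b1 b2] /= -> ->. Qed.

Lemma rCM (a b : R) : (a * b)%:C = a%:C * b%:C :> C.
Proof. by rewrite rmorphM. Qed.
Lemma rCB (a b : R) : (a - b)%:C = a%:C - b%:C :> C.
Proof. by rewrite rmorphB. Qed.

Lemma cJM (a b : C) : conjc (a * b) = conjc a * conjc b.
Proof. by rewrite rmorphM. Qed.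
Lemma cJR (r : R) : conjc (r%:C : C) = r%:C.
Proof. by rewrite conjc_real. Qed.
Lemma cJ0 : conjc (0 : C) = 0.
Proof. by rewrite rmorph0. Qed.

Lemma nsq_ge0 z : 0 <= nsq z.
Proof. by rewrite addr_ge0// sqr_ge0. Qed.

Lemma nsqM a b : nsq (a * b) = nsq a * nsq b.
Proof. by rewrite /nsq !ReImE; ring. Qed.

Lemma nsqJ a : nsq (conjc a) = nsq a.
Proof. by rewrite /nsq !ReImE; ring. Qed.

Lemma nsqN a : nsq (- a) = nsq a.
Proof. by rewrite /nsq !ReImE; ring. Qed.

Lemma nsq0 : nsq 0 = 0.
Proof. by rewrite /nsq /=; ring. Qed.

Lemma nsqR (r : R) : nsq (r%:C) = r ^+ 2.
Proof. by rewrite /nsq /=; ring. Qed.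

Lemma nsq1 : nsq 1 = 1.
Proof. by rewrite /nsq /=; ring. Qed.

Lemma nsq_eq0 z : nsq z = 0 -> z = 0.
Proof.
move/eqP; rewrite /nsq paddr_eq0 ?sqr_ge0// !sqrf_eq0 => /andP[/eqP a /eqP b].
exact: ceqP.
Qed.

Lemma nsqE z : z * conjc z = (nsq z)%:C.
Proof. by apply: ceqP; rewrite /nsq !ReImE /=; ring. Qed.

Lemma nsqX z n : nsq (z ^+ n) = nsq z ^+ n.
Proof. by elim: n => [|n IH]; rewrite ?expr0 ?nsq1// !exprS nsqM IH. Qed.

Lemma normc_nsq (z : C) : Normc.normc z ^+ 2 = nsq z.
Proof. by case: z => a b /=; rewrite sqr_sqrtr// addr_ge0// sqr_ge0. Qed.

Lemma norm_nsq (z : C) : `|z| = 1 -> nsq z = 1.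
Proof. by rewrite normc_def => -[] h; rewrite /nsq -[LHS]sqr_sqrtr ?h ?expr1n// nsq_ge0. Qed.

Lemma nsqD_le a b : nsq (a + b) <= 2 * nsq a + 2 * nsq b.
Proof.
rewrite /nsq !ReImE -subr_ge0.
have -> : 2 * (Re a ^+ 2 + Im a ^+ 2) + 2 * (Re b ^+ 2 + Im b ^+ 2) -
   ((Re a + Re b) ^+ 2 + (Im a + Im b) ^+ 2) =
   (Re a - Re b) ^+ 2 + (Im a - Im b) ^+ 2 by ring.
by rewrite addr_ge0// sqr_ge0.
Qed.

Lemma nsq1_conj z : nsq z = 1 -> conjc z = z^-1.
Proof.
move=> h; have z0 : z != 0 by apply/eqP => z0; move: h; rewrite z0 nsq0 => /esym/eqP; rewrite oner_eq0.
by apply: (mulfI z0); rewrite nsqE h divff.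
Qed.

Lemma nsqV z : nsq z = 1 -> nsq z^-1 = 1.
Proof. by move=> h; rewrite -nsq1_conj// nsqJ. Qed.

Lemma nsq1_neq0 z : nsq z = 1 -> z != 0.
Proof. by move=> h; apply/eqP => z0; move: h; rewrite z0 nsq0 => /esym/eqP; rewrite oner_eq0. Qed.

Lemma nsq1_exprz z (k : int) : nsq z = 1 -> nsq (z ^ k) = 1.
Proof.
move=> h; case: k => n; first by rewrite -[z ^ _]/(z ^+ n) nsqX h expr1n.
by rewrite -[z ^ _]/((z ^+ n.+1)^-1) nsqV// nsqX h expr1n.
Qed.

Lemma nsq1_Re z : nsq z = 1 -> -1 <= Re z <= 1.
Proof.
move=> h; have h2 : Re z ^+ 2 <= 1 by rewrite -h /nsq lerDl sqr_ge0.
by apply/andP; split; nra.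
Qed.

Lemma expiD (s t : R) : expi (s + t) = expi s * expi t.
Proof. by apply: ceqP; rewrite !ReImE /= (cosD, sinD); ring. Qed.

Lemma expi0 : expi 0 = 1 :> C.
Proof. by rewrite /expi cos0 sin0. Qed.

Lemma expiN (t : R) : expi (- t) = conjc (expi t).
Proof. by rewrite /expi cosN sinN. Qed.

Lemma nsq_expi (t : R) : nsq (expi t) = 1.
Proof. exact: cos2Dsin2. Qed.

Lemma expi_exprz (t : R) (k : int) : expi t ^ k = expi (k%:~R * t).
Proof.
have E n : expi t ^+ n = expi (n%:R * t).
  elim: n => [|n IH]; first by rewrite expr0 mul0r expi0.
  by rewrite exprS IH -natr1 mulrDl mul1r addrC expiD.
case: k => n; first exact: E.
rewrite -[LHS]/((expi t ^+ n.+1)^-1) E -nsq1_conj ?nsq_expi// -expiN.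
by rewrite NegzE mulrNz mulNr.
Qed.

End ComplexNumbers.

Section ComplexMeasurable.
Context d (T : measurableType d) (R : realType).
Local Notation C := R[i].

Definition cutoff (D : set T) (f : T -> C) (x : T) : C := if x \in D then f x else 0.

Definition cmeas (f : T -> C) : Prop :=
  measurable_fun setT (fun x => Re (f x)) /\ measurable_fun setT (fun x => Im (f x)).

Lemma eq_cmeas f g : (forall x, f x = g x) -> cmeas f -> cmeas g.
Proof. by move=> /funext ->. Qed.

Lemma cmeas_cst (c : C) : cmeas (fun=> c).
Proof. by split; exact: measurable_cst. Qed.

Lemma cmeasD f g : cmeas f -> cmeas g -> cmeas (fun x => f x + g x).
Proof.
move=> [rf jf] [rg jg]; split.
  by under eq_fun do rewrite cReD; exact: measurable_funD.
by under eq_fun do rewrite cImD; exact: measurable_funD.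
Qed.

Lemma cmeasN f : cmeas f -> cmeas (fun x => - f x).
Proof.
move=> [rf jf]; split.
  by under eq_fun do rewrite cReN; exact: measurableT_comp.
by under eq_fun do rewrite cImN; exact: measurableT_comp.
Qed.

Lemma cmeasB f g : cmeas f -> cmeas g -> cmeas (fun x => f x - g x).
Proof. by move=> mf mg; apply: cmeasD => //; exact: cmeasN. Qed.

Lemma cmeasM f g : cmeas f -> cmeas g -> cmeas (fun x => f x * g x).
Proof.
move=> [rf jf] [rg jg]; split.
  under eq_fun do rewrite cReM.
  by apply: measurable_funB; exact: measurable_funM.
under eq_fun do rewrite cImM.
by apply: measurable_funD; exact: measurable_funM.
Qed.

Lemma cmeasJ f : cmeas f -> cmeas (fun x => conjc (f x)).
Proof.
move=> [rf jf]; split; first by under eq_fun do rewrite cReJ.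
by under eq_fun do rewrite cImJ; exact: measurableT_comp.
Qed.

Lemma cmeas_real (f : T -> R) : measurable_fun setT f -> cmeas (fun x => (f x)%:C).
Proof. by move=> mf; split => //=; exact: measurable_cst. Qed.

Lemma cmeasX f n : cmeas f -> cmeas (fun x => f x ^+ n).
Proof.
move=> mf; elim: n => [|n IH]; first exact: cmeas_cst.
by apply: (eq_cmeas (fun x => esym (exprS (f x) n))); exact: cmeasM.
Qed.

(** A negative power of a unimodular function is the conjugate of a positive power, which keeps
    inverses out of the measurability argument. *)
Lemma cmeas_exprz f (k : int) : cmeas f -> (forall x, nsq (f x) = 1) ->
  cmeas (fun x => f x ^ k).
Proof.
move=> mf f1; case: k => n; first exact: cmeasX.
apply: (@eq_cmeas (fun x => conjc (f x ^+ n.+1))).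
  by move=> x; rewrite nsq1_conj// nsqX f1 expr1n.
by apply: cmeasJ; exact: cmeasX.
Qed.

Lemma cmeas_sum (I : Type) (s : seq I) (P : pred I) (F : I -> T -> C) :
  (forall i, P i -> cmeas (F i)) -> cmeas (fun x => \sum_(i <- s | P i) F i x).
Proof.
move=> mF; elim: s => [|i s IH].
  by apply: (@eq_cmeas (fun=> 0) _ (fun x => esym (big_nil _ _ _ _))); exact: cmeas_cst.
apply: (@eq_cmeas (fun x => if P i then F i x + \sum_(i <- s | P i) F i x
    else \sum_(i <- s | P i) F i x)) => [x|]; first by rewrite [RHS]big_cons.
by case Pi: (P i) => //; apply: cmeasD => //; exact: mF.
Qed.

Lemma measurable_nsq f : cmeas f -> measurable_fun setT (fun x => nsq (f x)).
Proof. by move=> [rf jf]; apply: measurable_funD; exact: measurable_funX. Qed.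

Lemma cmeas_restrict (D : set T) f : measurable D -> cmeas f -> cmeas (cutoff D f).
Proof.
move=> mD [rf jf]; split.
  rewrite (_ : (fun x => _) = (fun x => Re (f x)) \_ D).
    by apply: (iffLR (measurable_restrictT _ mD)); exact: measurable_funTS.
  by apply/funext => x; rewrite /cutoff /patch; case: ifP.
rewrite (_ : (fun x => _) = (fun x => Im (f x)) \_ D).
  by apply: (iffLR (measurable_restrictT _ mD)); exact: measurable_funTS.
by apply/funext => x; rewrite /cutoff /patch; case: ifP.
Qed.

End ComplexMeasurable.

Lemma cmeas_comp d1 d2 (T1 : measurableType d1) (T2 : measurableType d2) (R : realType)
    (f : T2 -> R[i]) (g : T1 -> T2) :
  measurable_fun setT g -> cmeas f -> cmeas (fun x => f (g x)).
Proof.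
move=> mg [rf jf]; split.
  exact: (measurableT_comp rf mg).
exact: (measurableT_comp jf mg).
Qed.

Lemma cmeas_expi (R : realType) (a : R) : cmeas (fun x : R => expi (a * x)).
Proof.
have ma : measurable_fun setT (fun x : R => a * x) by exact: measurable_funM.
split.
  exact: (measurableT_comp (continuous_measurable_fun (@continuous_cos R)) ma).
exact: (measurableT_comp (continuous_measurable_fun (@continuous_sin R)) ma).
Qed.

Section ComplexIntegral.
Variable R : realType.
Local Notation C := R[i].
Local Notation mu := (@lebesgue_measure R).
Implicit Types f g : R -> C.

Definition cintg f : Prop :=
  mu.-integrable setT (fun x => (Re (f x))%:E) /\
  mu.-integrable setT (fun x => (Im (f x))%:E).

Definition cint f : C := cintegral setT f.

Lemma eq_cint f g : (forall x, f x = g x) -> cint f = cint g.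
Proof. by move=> /funext ->. Qed.

Lemma eq_cintg f g : (forall x, f x = g x) -> cintg f -> cintg g.
Proof. by move=> /funext ->. Qed.

Lemma cintg_cmeas f : cintg f -> cmeas f.
Proof.
by move=> [/measurable_int/measurable_EFinP rf /measurable_int/measurable_EFinP jf].
Qed.

Lemma cintegral_restrict (D : set R) f : cintegral D f = cint (cutoff D f).
Proof.
rewrite /cint /cintegral; congr Complex; rewrite [LHS]Rintegral_mkcond;
  by apply: eq_Rintegral => x _; rewrite /cutoff /patch; case: ifP.
Qed.

Lemma cintgD f g : cintg f -> cintg g -> cintg (fun x => f x + g x).
Proof.
move=> [rf jf] [rg jg]; split.
  under eq_fun do rewrite cReD EFinD.
  exact: integrableD.
under eq_fun do rewrite cImD EFinD.
exact: integrableD.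
Qed.

Lemma cintgZ c f : cintg f -> cintg (fun x => c * f x).
Proof.
move=> [rf jf]; split.
  under eq_fun do rewrite cReM EFinB !EFinM.
  by apply: integrableB => //; exact: integrableZl.
under eq_fun do rewrite cImM EFinD !EFinM.
by apply: integrableD => //; exact: integrableZl.
Qed.

Lemma cintgN f : cintg f -> cintg (fun x => - f x).
Proof. by move=> cf; apply: (eq_cintg (fun x => mulN1r (f x))); exact: cintgZ. Qed.

Lemma cintgB f g : cintg f -> cintg g -> cintg (fun x => f x - g x).
Proof. by move=> cf cg; apply: cintgD => //; exact: cintgN. Qed.

Lemma cintg0 : cintg (fun=> 0).
Proof. by split; exact: integrable0. Qed.

Lemma cintg_sum (I : Type) (s : seq I) (P : pred I) (F : I -> R -> C) :
  (forall i, P i -> cintg (F i)) -> cintg (fun x => \sum_(i <- s | P i) F i x).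
Proof.
move=> mF; elim: s => [|i s IH].
  by apply: (@eq_cintg (fun=> 0) _ (fun x => esym (big_nil _ _ _ _))); exact: cintg0.
apply: (@eq_cintg (fun x => if P i then F i x + \sum_(i <- s | P i) F i x
    else \sum_(i <- s | P i) F i x)) => [x|]; first by rewrite [RHS]big_cons.
by case Pi: (P i) => //; apply: cintgD => //; exact: mF.
Qed.

Lemma cintD f g : cintg f -> cintg g ->
  cint (fun x => f x + g x) = cint f + cint g.
Proof.
move=> [rf jf] [rg jg]; apply: ceqP; rewrite ?cReD ?cImD /=.
  by rewrite -RintegralD//; apply: eq_Rintegral => x _; rewrite cReD.
by rewrite -RintegralD//; apply: eq_Rintegral => x _; rewrite cImD.
Qed.

Lemma cintZ c f : cintg f -> cint (fun x => c * f x) = c * cint f.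
Proof.
move=> [rf jf]; have rf' r := integrableZl measurableT r rf.
have jf' r := integrableZl measurableT r jf.
apply: ceqP; rewrite !ReImE /=.
  rewrite -!RintegralZl// -RintegralB//; [|exact: rf'|exact: jf'].
  by apply: eq_Rintegral => x _; rewrite cReM.
rewrite -!RintegralZl// -RintegralD//; [|exact: jf'|exact: rf'].
by apply: eq_Rintegral => x _; rewrite cImM.
Qed.

Lemma cintN f : cintg f -> cint (fun x => - f x) = - cint f.
Proof.
by move=> cf; rewrite -mulN1r -cintZ//; apply: eq_cint => x; rewrite mulN1r.
Qed.

Lemma cintB f g : cintg f -> cintg g ->
  cint (fun x => f x - g x) = cint f - cint g.
Proof. by move=> cf cg; rewrite cintD ?cintN//; exact: cintgN. Qed.

Lemma cint0 : cint (fun=> 0) = 0.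
Proof. by apply: ceqP => /=; rewrite Rintegral_cst// mul0r. Qed.

Lemma cint_sum (I : Type) (s : seq I) (P : pred I) (F : I -> R -> C) :
  (forall i, P i -> cintg (F i)) ->
  cint (fun x => \sum_(i <- s | P i) F i x) = \sum_(i <- s | P i) cint (F i).
Proof.
move=> mF; elim: s => [|i s IH].
  by rewrite big_nil -[RHS]cint0; apply: eq_cint => x; rewrite big_nil.
rewrite big_cons; case: ifP => Pi.
  rewrite -IH -cintD//; [|exact: mF|exact: cintg_sum].
  by apply: eq_cint => x; rewrite big_cons Pi.
by rewrite -IH; apply: eq_cint => x; rewrite big_cons Pi.
Qed.

Lemma ae_eq_Rintegral (f g : R -> R) :
  measurable_fun setT f -> measurable_fun setT g ->
  {ae mu, forall x, f x = g x} -> \int[mu]_x f x = \int[mu]_x g x.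
Proof.
move=> mf mg fg; rewrite /Rintegral; congr fine; apply: ae_eq_integral => //.
- exact/measurable_EFinP.
- exact/measurable_EFinP.
- by apply: (@filterS _ _ (ae_filter_ringOfSetsType mu) _ _ _ fg) => x -> .
Qed.

Lemma ae_eq_cint f g : cmeas f -> cmeas g ->
  {ae mu, forall x, f x = g x} -> cint f = cint g.
Proof.
move=> [rf jf] [rg jg] fg; rewrite /cint /cintegral; congr Complex;
  apply: ae_eq_Rintegral => //;
  by apply: (@filterS _ _ (ae_filter_ringOfSetsType mu) _ _ _ fg) => x -> .
Qed.

Lemma cintg_dom f (h : R -> R) : cmeas f -> mu.-integrable setT (EFin \o h) ->
  (forall x, nsq (f x) <= h x ^+ 2) -> (forall x, 0 <= h x) -> cintg f.
Proof.
move=> [rf jf] ih fh h0; split.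
  apply: (le_integrable measurableT _ _ ih); first exact/measurable_EFinP.
  move=> x _ /=; rewrite lee_fin (ger0_norm (h0 x)) -ler_sqr ?nnegrE// real_normK ?num_real//.
  by rewrite (le_trans _ (fh x))// lerDl sqr_ge0.
apply: (le_integrable measurableT _ _ ih); first exact/measurable_EFinP.
move=> x _ /=; rewrite lee_fin (ger0_norm (h0 x)) -ler_sqr ?nnegrE// real_normK ?num_real//.
by rewrite (le_trans _ (fh x))// lerDr sqr_ge0.
Qed.

Lemma cintg_bounded f g (M : R) : cintg f -> cmeas g ->
  (forall x, nsq (g x) <= M) -> cintg (fun x => f x * g x).
Proof.
move=> cf mg gM; have [rf jf] := cf.
(* [Num.max 1 M] dominates $|g|$, since $|g|^2 \le M \le \max(1,M) \le \max(1,M)^2$, while $|f| \le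
   |\mathrm{Re} f| + |\mathrm{Im} f|$. *)
have M1 : 0 <= Num.max 1 M by rewrite le_max ler01.
have i1 : mu.-integrable setT (EFin \o
    (fun x => (Num.max 1 M) * (`|Re (f x)| + `|Im (f x)|))).
  have := integrableZl measurableT (Num.max 1 M) (integrableD measurableT (integrable_abse rf) (integrable_abse jf)).
  by apply: eq_integrable.
apply: (cintg_dom _ i1) => //=.
- exact: cmeasM (cintg_cmeas cf) mg.
- move=> x; rewrite nsqM exprMn mulrC ler_pM ?nsq_ge0//.
    rewrite (le_trans (gM x))// (@le_trans _ _ (Num.max 1 M))//; first by rewrite le_max lexx orbT.
    by rewrite ler_eXnr// le_max lexx.
  rewrite /nsq -(real_normK (num_real (Re (f x)))) -(real_normK (num_real (Im (f x)))).
  by have := normr_ge0 (Re (f x)); have := normr_ge0 (Im (f x)); nra.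
- by move=> x; rewrite mulr_ge0// addr_ge0.
Qed.

(** The squared L2 norm with values in [\bar R], so that it can be estimated before
    square-integrability is known. *)
Definition n2 f : \bar R := (\int[mu]_x (nsq (f x))%:E)%E.

Lemma n2_ge0 f : (0 <= n2 f)%E.
Proof. by apply: integral_ge0 => x _; rewrite lee_fin nsq_ge0. Qed.

Lemma LfunP (f : R -> R) : f \in Lfun mu 2%:E <->
  measurable_fun setT f /\ (\int[mu]_x (f x ^+ 2)%:E < +oo)%E.
Proof.
have E : (\int[mu]_x `| (EFin \o f) x | `^ 2 = \int[mu]_x (f x ^+ 2)%:E)%E.
  by apply: eq_integral => x _ /=; rewrite powR_mulrn// -normrX ger0_norm ?sqr_ge0.
split.
  move=> h; have /Lfun2_integrable_sqr/integrableP[_ h2] := h.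
  move: h; rewrite inE => /andP[]; rewrite inE /= => mf _; split => //.
  under eq_integral do rewrite -[X in X%:E]ger0_norm ?sqr_ge0//.
  exact: h2.
move=> [mf h]; rewrite inE; apply/andP; split; rewrite inE//=.
rewrite /finite_norm unlock E.
by apply: poweR_lty.
Qed.

Lemma sqintP f : f \in @sqint R <-> cmeas f /\ (n2 f < +oo)%E.
Proof.
have E : cmeas f -> (n2 f = \int[mu]_x (Re (f x) ^+ 2)%:E + \int[mu]_x (Im (f x) ^+ 2)%:E)%E.
  move=> [rf jf]; rewrite -ge0_integralD//.
  - by move=> x _; rewrite lee_fin sqr_ge0.
  - by apply/measurable_EFinP; exact: measurable_funX.
  - by move=> x _; rewrite lee_fin sqr_ge0.
  - by apply/measurable_EFinP; exact: measurable_funX.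
rewrite inE; split.
  move=> /andP[/LfunP[rf rf2] /LfunP[jf jf2]]; split => //.
  by rewrite E// lte_add_pinfty.
move=> [mf]; rewrite E// => lt.
have p0 (h : R -> R) : (0 <= \int[mu]_x (h x ^+ 2)%:E)%E.
  by apply: integral_ge0 => x _; rewrite lee_fin sqr_ge0.
have [rf jf] := mf.
apply/andP; split; apply/LfunP; split.
- exact: rf.
- by apply: le_lt_trans lt; rewrite leeDl.
- exact: jf.
- by apply: le_lt_trans lt; rewrite leeDr.
Qed.

Lemma n2_mono f g : cmeas f -> cmeas g -> (forall x, nsq (f x) <= nsq (g x)) -> (n2 f <= n2 g)%E.
Proof.
move=> mf mg h; apply: ge0_le_integral => //.
- by move=> x _; rewrite lee_fin nsq_ge0.
- by apply/measurable_EFinP; exact: measurable_nsq.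
- by apply/measurable_EFinP; exact: measurable_nsq.
- by move=> x _; rewrite lee_fin.
Qed.

Lemma n2M_const f c : cmeas f -> n2 (fun x => c * f x) = ((nsq c)%:E * n2 f)%E.
Proof.
move=> mf; rewrite /n2 -ge0_integralZl//.
- by apply: eq_integral => x _; rewrite nsqM EFinM.
- by apply/measurable_EFinP; exact: measurable_nsq.
- by move=> x _; rewrite lee_fin nsq_ge0.
- by rewrite lee_fin nsq_ge0.
Qed.

Lemma sqint_bounded f g M : f \in @sqint R -> cmeas g ->
  (forall x, nsq (g x) <= M) -> (fun x => g x * f x) \in @sqint R.
Proof.
move=> /sqintP[mf lf] mg gM; apply/sqintP; split; first exact: cmeasM.
have M0 : 0 <= M by apply: le_trans (gM 0); exact: nsq_ge0.
apply: (@le_lt_trans _ _ (n2 (fun x => (Num.sqrt M)%:C * f x))).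
  apply: n2_mono; [exact: cmeasM|by apply: cmeasM => //; exact: cmeas_cst|].
  by move=> x; rewrite !nsqM ler_wpM2r ?nsq_ge0// nsqR sqr_sqrtr.
by rewrite n2M_const// lte_mul_pinfty// lee_fin nsq_ge0.
Qed.

Lemma sqint_restrict (D : set R) f : measurable D -> f \in @sqint R -> cutoff D f \in @sqint R.
Proof.
move=> mD sf; have mI : cmeas (fun x => (\1_D x)%:C : C) by exact: cmeas_real.
rewrite (_ : cutoff D f = fun x => (\1_D x)%:C * f x); last first.
  by apply/funext => x; rewrite /cutoff indicE; case: ifP => _; rewrite ?mul1r ?mul0r.
apply: (@sqint_bounded _ _ 1) => // x; rewrite nsqR indicE.
by case: (_ \in _) => /=; rewrite ?expr1n ?expr0n.
Qed.

Lemma sqintM f g : f \in @sqint R -> g \in @sqint R -> cintg (fun x => f x * g x).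
Proof.
rewrite !inE => /andP[rf jf] /andP[rg jg].
have L (u v : R -> R) : u \in Lfun mu 2%:E -> v \in Lfun mu 2%:E ->
  mu.-integrable setT (EFin \o (fun x => u x * v x)).
  by move=> u2 v2; apply/Lfun1_integrable; exact: Lfun2_mul_Lfun1.
split.
  under eq_fun do rewrite cReM EFinB.
  by apply: integrableB => //; [exact: L rf rg|exact: L jf jg].
under eq_fun do rewrite cImM EFinD.
by apply: integrableD => //; [exact: L rf jg|exact: L jf rg].
Qed.

Lemma sqintJ f : f \in @sqint R -> (fun x => conjc (f x)) \in @sqint R.
Proof.
move=> /sqintP[mf lf]; apply/sqintP; split; first exact: cmeasJ.
by apply: le_lt_trans lf; apply: n2_mono => //; [exact: cmeasJ|move=> x; rewrite nsqJ].
Qed.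

Lemma sqint_indic (D : set R) : measurable D -> (mu D < +oo)%E ->
  (fun x => (\1_D x)%:C) \in @sqint R.
Proof.
move=> mD lD; apply/sqintP; split; first exact: cmeas_real.
rewrite /n2 (_ : (fun x => _) = (fun x => (\1_D x)%:E)); last first.
  by apply/funext => x; rewrite nsqR indicE; case: (_ \in _); rewrite /= ?expr1n ?expr0n.
by rewrite integral_indic// setIT.
Qed.

Lemma sqint_cintg (D : set R) f : measurable D -> (mu D < +oo)%E ->
  f \in @sqint R -> cintg (cutoff D f).
Proof.
move=> mD lD sf; have := sqintM sf (sqint_indic mD lD).
by congr cintg; apply/funext => x; rewrite /cutoff indicE; case: ifP => _; rewrite ?mulr1 ?mulr0.
Qed.

Lemma cintg_cutoff (D : set R) f (M : R) : measurable D -> (mu D < +oo)%E ->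
  cmeas f -> (forall x, nsq (f x) <= M) -> cintg (cutoff D f).
Proof.
move=> mD lD mf fM.
have iD : cintg (fun x => (\1_D x)%:C : C).
  split; last exact: integrable0.
  apply/integrableP; split; first by apply/measurable_EFinP; exact: measurable_indic.
  have -> : (\int[mu]_x `|(Re ((\1_D x)%:C : C))%:E| = \int[mu]_x (\1_D x)%:E)%E.
    by apply: eq_integral => x _; rewrite /= ger0_norm.
  by rewrite integral_indic ?setIT.
apply: (eq_cintg _ (cintg_bounded iD mf fM)) => x.
by rewrite /cutoff indicE; case: ifP => _; rewrite ?mul1r ?mul0r.
Qed.

End ComplexIntegral.

(** * Hilbert spaces *)

Lemma cvg0_comb (R : realType) (a b : R) (f g : nat -> R) :
  f n @[n --> \oo] --> (0 : R) -> g n @[n --> \oo] --> (0 : R) ->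
  a * f n + b * g n @[n --> \oo] --> (0 : R).
Proof.
move=> f0 g0; have := cvgD (cvgMl_tmp (a := a) f0) (cvgMl_tmp (a := b) g0); rewrite !mulr0 addr0; exact.
Qed.

Lemma cvg0_mulr (R : realType) (a : R) (f : nat -> R) :
  f n @[n --> \oo] --> (0 : R) -> f n * a @[n --> \oo] --> (0 : R).
Proof. by move=> f0; have := cvgMr_tmp (b := a) f0; rewrite mul0r; exact. Qed.

Lemma squeeze0 (R : realType) (f g : nat -> R) : (forall n, 0 <= f n <= g n) ->
  g n @[n --> \oo] --> (0 : R) -> f n @[n --> \oo] --> (0 : R).
Proof.
move=> fg g0; apply: (@squeeze_cvgr _ _ _ _ (fun=> 0) g) => //; last exact: cvg_cst.
exact: nearW.
Qed.

Lemma cvg_sumR (R : realType) (I : Type) (s : seq I) (f : I -> nat -> R) (l : I -> R) :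
  (forall i, f i n @[n --> \oo] --> l i) ->
  \sum_(i <- s) f i n @[n --> \oo] --> \sum_(i <- s) l i.
Proof.
move=> fl; elim: s => [|i s IH].
  rewrite (_ : (fun n => _) = (fun=> 0)) ?big_nil; first exact: cvg_cst.
  by apply/funext => n; rewrite big_nil.
rewrite (_ : (fun n => _) = (fun n => f i n + \sum_(j <- s) f j n)) ?big_cons.
  exact: cvgD.
by apply/funext => n; rewrite big_cons.
Qed.

Section Hilbert.
Variables (R : realType) (H : lmodType R[i]) (d : {dot H for @conjc R}).
Local Notation C := R[i].
Implicit Types x y z : H.

Lemma dotC x y : d x y = conjc (d y x).
Proof. by rewrite hermC expr0 mul1r. Qed.
Lemma dotDl x y z : d (x + y) z = d x z + d y z.
Proof. exact: linearDl. Qed.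
Lemma dotZl (a : C) x z : d (a *: x) z = a * d x z.
Proof. exact: linearZl_LR. Qed.
Lemma dot0l z : d 0 z = 0.
Proof. exact: linear0l. Qed.
Lemma dotNl x z : d (- x) z = - d x z.
Proof. exact: linearNl. Qed.
Lemma dotBl x y z : d (x - y) z = d x z - d y z.
Proof. exact: linearBl. Qed.
Lemma dotDr x y z : d z (x + y) = d z x + d z y.
Proof. exact: linearDr. Qed.
Lemma dotZr (a : C) x z : d z (a *: x) = conjc a * d z x.
Proof. by rewrite dotC dotZl rmorphM /= -(dotC z x). Qed.
Lemma dot0r z : d z 0 = 0.
Proof. exact: linear0r. Qed.
Lemma dotNr x z : d z (- x) = - d z x.
Proof. exact: linearNr. Qed.
Lemma dotBr x y z : d z (x - y) = d z x - d z y.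
Proof. exact: linearBr. Qed.
Lemma dot_suml (I : Type) (s : seq I) (P : pred I) (F : I -> H) z :
  d (\sum_(i <- s | P i) F i) z = \sum_(i <- s | P i) d (F i) z.
Proof. by elim/big_rec2 : _ => [|i y x _ <-]; rewrite ?dot0l// dotDl. Qed.

Definition sqn x : R := Re (d x x).

Lemma sqnE x : d x x = (sqn x)%:C.
Proof.
apply: ceqP => //=; have := dotC x x; case: (d x x) => a b [] /= /eqP.
by rewrite -subr_eq0 opprK -mulr2n mulrn_eq0 => /eqP.
Qed.

Lemma sqn_ge0 x : 0 <= sqn x.
Proof. by have := dnorm_ge0 d x; rewrite lecE => /andP[]. Qed.

Lemma sqn_eq0 x : sqn x = 0 -> x = 0.
Proof. by move=> x0; apply/eqP; rewrite -(dnorm_eq0 d) sqnE x0. Qed.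

Lemma sqn0 : sqn 0 = 0.
Proof. by rewrite /sqn dot0l. Qed.

Lemma sqnZ (a : C) x : sqn (a *: x) = nsq a * sqn x.
Proof. by rewrite {1}/sqn dotZl dotZr mulrA nsqE sqnE cReM /= mul0r subr0. Qed.

Lemma sqnN x : sqn (- x) = sqn x.
Proof. by rewrite /sqn dotNl dotNr opprK. Qed.

Lemma sqnBC x y : sqn (x - y) = sqn (y - x).
Proof. by rewrite -sqnN opprB. Qed.

Lemma sqnD x y : sqn (x + y) = sqn x + sqn y + 2 * Re (d x y).
Proof.
rewrite /sqn dotDl !dotDr !cReD (dotC y x) cReJ; ring.
Qed.

Lemma sqnB x y : sqn (x - y) = sqn x + sqn y - 2 * Re (d x y).
Proof. by rewrite sqnD sqnN dotNr cReN mulrN. Qed.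

Lemma sqnD_le x y : sqn (x + y) <= 2 * sqn x + 2 * sqn y.
Proof. by have := sqn_ge0 (x - y); rewrite sqnB sqnD; lra. Qed.

Lemma CauchySchwarz x y : nsq (d x y) <= sqn x * sqn y.
Proof.
have [y0|y0] := eqVneq (sqn y) 0.
  by rewrite (sqn_eq0 y0) dot0r nsq0 mulr_ge0// sqn_ge0.
have yp : 0 < sqn y by rewrite lt_def y0 sqn_ge0.
have := sqn_ge0 (x - (((sqn y)^-1)%:C * d x y) *: y).
rewrite sqnB sqnZ dotZr /nsq !ReImE /= => h.
rewrite -subr_ge0 -(pmulr_rge0 _ (_ : 0 < (sqn y)^-1)) ?invr_gt0//.
by apply: le_trans h _; rewrite le_eqVlt; apply/orP; left; apply/eqP; rewrite /nsq; field.
Qed.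

Lemma CauchySchwarz_Re x y : `|Re (d x y)| <= Num.sqrt (sqn x) * Num.sqrt (sqn y).
Proof.
rewrite -sqrtrM ?sqn_ge0// -sqrtr_sqr ler_wsqrtr// (le_trans _ (CauchySchwarz x y))//.
by rewrite lerDl sqr_ge0.
Qed.

Definition hlim (u : nat -> H) (l : H) : Prop := sqn (u n - l) @[n --> \oo] --> (0 : R).

Definition hcauchy (u : nat -> H) : Prop :=
  forall e : R, 0 < e -> exists k, forall m n, (k <= m <= n)%N -> sqn (u n - u m) < e.

Definition hcomplete : Prop := forall u, hcauchy u -> exists l, hlim u l.

Lemma hlim_unique u l l' : hlim u l -> hlim u l' -> l = l'.
Proof.
move=> ul ul'; apply/eqP; rewrite -subr_eq0; apply/eqP/sqn_eq0.
have : (sqn (l - l'))%R @[_ --> \oo] --> (0 : R).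
  apply: (squeeze0 _ (cvg0_comb 2 2 ul ul')).
    move=> n; rewrite sqn_ge0/= [in leRHS]sqnBC.
    by rewrite (_ : l - l' = (l - u n) + (u n - l')) ?sqnD_le// addrA subrK.
by move/(cvg_unique (@Rhausdorff R) (@cvg_cst _ _ _ _ _)).
Qed.

Lemma hlimP (a : C) u l u' l' : hlim u l -> hlim u' l' ->
  hlim (fun n => a *: u n + u' n) (a *: l + l').
Proof.
move=> ul ul'; apply: (squeeze0 _ (cvg0_comb (2 * nsq a) 2 ul ul')) => n.
rewrite sqn_ge0/= -mulrA -sqnZ scalerBr opprD addrACA; exact: sqnD_le.
Qed.

Lemma hlim_dot u l y : hlim u l -> nsq (d (u n) y - d l y) @[n --> \oo] --> (0 : R).
Proof.
move=> ul; apply: (squeeze0 _ (cvg0_mulr (sqn y) ul)) => n.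
by rewrite nsq_ge0/= -dotBl CauchySchwarz.
Qed.

Lemma hlim_dot_cst u l y (c : C) : hlim u l -> (\forall n \near \oo, d (u n) y = c) -> d l y = c.
Proof.
move=> /(@hlim_dot _ _ y) h uc; apply/eqP; rewrite eq_sym -subr_eq0; apply/eqP/nsq_eq0.
have : (nsq (c - d l y))%R @[_ --> \oo] --> (0 : R).
  apply: cvg_trans h; apply: near_eq_cvg.
  by apply: filterS uc => n ->.
by move/(cvg_unique (@Rhausdorff R) (@cvg_cst _ _ _ _ _)).
Qed.

Lemma hlim_sqn u l : hlim u l -> sqn (u n) @[n --> \oo] --> sqn l.
Proof.
move=> ul.
have E n : sqn (u n) = sqn l + (sqn (u n - l) + 2 * Re (d (u n - l) l)).
  by rewrite -{1}(subrK l (u n)) [LHS]sqnD; ring.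
have r0 : Re (d (u n - l) l) @[n --> \oo] --> (0 : R).
  apply/cvgr0Pnorm_lt => e e0.
  have c0 : Num.sqrt (sqn (u n - l)) @[n --> \oo] --> (0 : R).
    rewrite -[X in _ --> X]sqrtr0.
    exact: (@cvg_comp _ _ _ (fun n => sqn (u n - l)) Num.sqrt _ _ _ ul (@sqrt_continuous R 0)).
  move/cvgr0Pnorm_lt : (cvg0_mulr (Num.sqrt (sqn l)) c0) => /(_ e e0); apply: filterS => n.
  by apply: le_lt_trans; rewrite (le_trans (CauchySchwarz_Re _ _))// ler_norm.
rewrite (_ : (fun n => sqn (u n)) =
    (fun n => sqn l + (1 * sqn (u n - l) + 2 * Re (d (u n - l) l)))); last first.
  by apply/funext => n; rewrite E mul1r.
rewrite -[X in _ --> X]addr0; apply: cvgD; first exact: cvg_cst.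
exact: cvg0_comb.
Qed.

Lemma hlim_closure (A : set H) u l : (forall n, A (u n)) -> hlim u l -> hclosure d A l.
Proof.
move=> Au ul e e0.
have e2 : 0 < e ^+ 2 by rewrite exprn_gt0.
move/cvgr0Pnorm_lt : ul => /(_ _ e2) [k _ hk].
exists (u k) => //.
have := hk k (leqnn k); rewrite ger0_norm ?sqn_ge0// sqnBC => h.
by rewrite /hnorm -(ger0_norm (ltW e0)) -sqrtr_sqr ltr_sqrt.
Qed.

Lemma hclosureP (A : set H) l : hclosure d A l <->
  forall e : R, 0 < e -> exists2 y, A y & sqn (l - y) < e.
Proof.
split=> h e e0.
  have se : 0 < Num.sqrt e by rewrite sqrtr_gt0.
  by have [y Ay ly] := h _ se; exists y => //; rewrite -ltr_sqrt.
have e2 : 0 < e ^+ 2 by rewrite exprn_gt0.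
have [y Ay ly] := h _ e2; exists y => //.
by rewrite /hnorm -(ger0_norm (ltW e0)) -sqrtr_sqr ltr_sqrt.
Qed.

Lemma ortho_hclosure (A : set H) x l :
  (forall y, A y -> d x y = 0) -> hclosure d A l -> d x l = 0.
Proof.
move=> xA /hclosureP Al; apply: nsq_eq0; apply/eqP; rewrite eq_le nsq_ge0 andbT.
apply/ler_addgt0Pl => e e0; rewrite addr0.
have e1 : 0 < e / (sqn x + 1) by rewrite divr_gt0// ltr_wpDl// sqn_ge0.
have [y Ay ly] := Al _ e1.
have -> : d x l = d x (l - y) by rewrite dotBr (xA y Ay) subr0.
rewrite (le_trans (CauchySchwarz _ _))//.
apply: (@le_trans _ _ ((sqn x + 1) * (e / (sqn x + 1)))).
  by rewrite ler_pM ?sqn_ge0 ?lerDl ?(ltW ly).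
by rewrite mulrC divfK// gt_eqF// ltr_wpDl// sqn_ge0.
Qed.

Lemma closed_subspace_sum V (I : Type) (s : seq I) (c : I -> C) (b : I -> H) :
  closed_subspace d V -> (forall i, V (b i)) -> V (\sum_(i <- s) c i *: b i).
Proof.
move=> [V0 VP _] Vb; elim: s => [|i s IH]; first by rewrite big_nil.
by rewrite big_cons; exact: VP.
Qed.

(** * Orthonormal families and Parseval's identity *)

Section Basis.
Variables (I : countType) (b : I -> H).
Hypothesis ob : forall i j, d (b i) (b j) = (i == j)%:R.

(** The family enumerated along [nat]. Numbers that encode no index receive the vector 0, so the
    sequence is orthogonal with terms of norm 1 or 0; identities about it are stated so as to hold
    for the zero terms too. *)
Definition seq_basis (n : nat) : H := if pickle_inv n is Some i then b i else 0.
Local Notation e := seq_basis.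
Definition partial_expansion x n : H := \sum_(m < n) d x (e m) *: e m.
Local Notation S := partial_expansion.

Lemma seq_basis_orth m n : m != n -> d (e m) (e n) = 0.
Proof.
rewrite /e => mn.
case Em : (pickle_inv m) => [i|]; last by rewrite dot0l.
case En : (pickle_inv n) => [j|]; last by rewrite dot0r.
rewrite ob; case: eqP => // ij; move: mn.
have := @pickle_invK I m; have := @pickle_invK I n.
by rewrite Em En /= => <- <-; rewrite ij eqxx.
Qed.

Lemma dot_seq_basis_self x n : nsq (d x (e n)) * sqn (e n) = nsq (d x (e n)).
Proof.
rewrite /e; case: (pickle_inv n) => [i|]; last by rewrite dot0r nsq0 mul0r.
by rewrite /sqn ob eqxx mulr1.
Qed.

Lemma dot_partial x n k : (n <= k)%N -> d (S x n) (e k) = 0.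
Proof.
move=> nk; rewrite /S dot_suml big1// => m _.
by rewrite dotZl seq_basis_orth ?mulr0// neq_ltn (leq_trans (ltn_ord m) nk).
Qed.

Lemma dot_remainder x n k : (k < n)%N -> d (x - S x n) (e k) = 0.
Proof.
elim: n => // n IH; rewrite ltnS leq_eqVlt => /predU1P[->|kn].
  rewrite /S big_ord_recr /= -/(S x n) opprD addrA dotBl dotBl dot_partial// subr0 dotZl.
  by rewrite -[X in X - _]mulr1 -mulrBr /e; case: (pickle_inv n) => [i|];
    rewrite ?ob ?eqxx ?subrr ?mulr0// dot0r mul0r.
rewrite /S big_ord_recr /= -/(S x n) opprD addrA dotBl IH// dotZl.
by rewrite seq_basis_orth ?mulr0 ?subr0// neq_ltn kn orbT.
Qed.

(** Pythagoras, as the remainder is orthogonal to the partial expansion. Nonnegativity of the left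
    side is Bessel's inequality. *)
Lemma sqn_remainder x n : sqn (x - S x n) = sqn x - \sum_(m < n) nsq (d x (e m)).
Proof.
elim: n => [|n IH]; first by rewrite /S !big_ord0 !subr0.
have E : S x n.+1 = S x n + d x (e n) *: e n by rewrite /S big_ord_recr.
rewrite big_ord_recr /= E !opprD !addrA -IH [LHS]sqnB.
rewrite sqnZ dot_seq_basis_self dotZr dotBl dot_partial// subr0.
have -> : Re (conjc (d x (e n)) * d x (e n)) = nsq (d x (e n)) by rewrite mulrC nsqE.
by rewrite /nsq; ring.
Qed.

Lemma sqn_partial_diff x m n : (m <= n)%N ->
  sqn (S x n - S x m) = \sum_(k < n) nsq (d x (e k)) - \sum_(k < m) nsq (d x (e k)).
Proof.
elim: n => [|n IH]; first by rewrite leqn0 => /eqP ->; rewrite !subrr sqn0.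
rewrite leq_eqVlt => /predU1P[->|]; first by rewrite !subrr sqn0.
rewrite ltnS => mn; rewrite big_ord_recr /= -addrA [nsq _ + _]addrC addrA -IH//.
have E : S x n.+1 = S x n + d x (e n) *: e n by rewrite /S big_ord_recr.
rewrite E addrAC [LHS]sqnD sqnZ dot_seq_basis_self dotZr.
by rewrite dotBl !dot_partial// subr0 mulr0 /= mulr0 addr0.
Qed.

Hypothesis cH : hcomplete.

(** By Bessel the sums of squared coefficients increase and stay below [sqn x]; their increments are
    the squared distances between partial expansions, which therefore form a Cauchy sequence. *)
Lemma partial_expansion_cvg x : exists l, hlim (S x) l.
Proof.
apply: cH => eps eps0.
pose B n := \sum_(k < n) nsq (d x (e k)).
have ndB : nondecreasing_seq B.
  apply/nondecreasing_seqP => n; rewrite /B big_ord_recr /= lerDl; exact: nsq_ge0.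
have cB : cvgn B.
  apply: nondecreasing_is_cvgn => //; exists (sqn x) => _ [n _ <-].
  by have := sqn_ge0 (x - S x n); rewrite sqn_remainder subr_ge0.
have /cvgrPdist_lt/(_ _ eps0)[k _ hk] := cB.
exists k => m n /andP[km mn]; rewrite sqn_partial_diff//.
have Bn := nondecreasing_cvgn_le ndB cB n.
have := hk m km; rewrite ger0_norm; last by rewrite subr_ge0 nondecreasing_cvgn_le.
by apply: le_lt_trans; rewrite lerD2r.
Qed.

Variable V : set H.
Hypothesis cV : closed_subspace d V.
Hypothesis Vb : forall i, V (b i).
Hypothesis total : forall x, V x -> (forall i, d x (b i) = 0) -> x = 0.

Lemma seq_basis_in n : V (e n).
Proof. by have [V0 _ _] := cV; rewrite /e; case: (pickle_inv n). Qed.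

(** The limit of the partial expansions lies in the closed subspace [V] and has the same
    coefficients as [x]; totality identifies the two. *)
Lemma expansion_hlim x : V x -> hlim (S x) x.
Proof.
move=> Vx; have [l hl] := partial_expansion_cvg x.
suff E : l = x by move: hl; rewrite E.
have [V0 VP Vc] := cV.
have Vl : V l.
  apply: Vc; apply: hlim_closure hl => n.
  exact: (closed_subspace_sum _ _ cV (fun m : 'I_n => seq_basis_in m)).
apply/esym/eqP; rewrite -subr_eq0; apply/eqP/total.
  by rewrite addrC -scaleN1r; exact: VP.
move=> i; rewrite dotBl; apply/eqP; rewrite subr_eq0 eq_sym; apply/eqP.
apply: hlim_dot_cst hl _.
exists (pickle i).+1 => // n /= hn; have := dot_remainder x hn.
rewrite /e pickleK_inv dotBl => /eqP; rewrite subr_eq0 => /eqP.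
by move=> <-.
Qed.

Lemma parseval x : V x -> \sum_(m < n) nsq (d x (e m)) @[n --> \oo] --> sqn x.
Proof.
move=> Vx; have h := expansion_hlim Vx.
have E n : \sum_(m < n) nsq (d x (e m)) = sqn x - sqn (S x n - x).
  by rewrite sqnBC sqn_remainder opprB addrC subrK.
rewrite (_ : (fun n => _) = (fun n => sqn x - sqn (S x n - x))); last exact/funext.
by rewrite -[X in _ --> X]subr0; apply: cvgB => //; exact: cvg_cst.
Qed.

(** Reduces the density of the span to a uniqueness statement: in a complete space it is enough that
    0 is the only vector of [V] orthogonal to the family. The scaling, wavelet and super-wavelet
    bases all come from here. *)
Lemma complete_orthonormal_basis : orthonormal_basis d V b.
Proof.
split=> //; apply/seteqP; split => x; last first.
  move=> Vx; apply: hlim_closure (expansion_hlim Vx) => n.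
  suff [s E] : exists s : seq I, S x n = \sum_(i <- s) d x (b i) *: b i.
    by exists s, (fun i => d x (b i)).
  rewrite /S; elim: n => [|n [s E]]; first by exists [::]; rewrite big_ord0 big_nil.
  rewrite big_ord_recr /= E /e.
  case: (pickle_inv n) => [i|]; last by exists s; rewrite scaler0 addr0.
  by exists (i :: s); rewrite big_cons addrC.
have [V0 VP Vc] := cV => h; apply: Vc; move: x h.
move=> x h eps eps0; have [y [s [c ->]] xy] := h eps eps0.
by eexists; last exact: xy; exact: closed_subspace_sum.
Qed.

End Basis.
End Hilbert.

Lemma hlim_hcauchy (R : realType) (H : lmodType R[i]) (d : {dot H for @conjc R})
    (u : nat -> H) l : hlim d u l -> hcauchy d u.
Proof.
move=> /cvgr0Pnorm_lt ul e e0.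
have e4 : 0 < e / 4 by rewrite divr_gt0.
have [k _ hk] := ul _ e4; exists k => m n /andP[km mn].
rewrite (_ : u n - u m = (u n - l) + (l - u m)); last by rewrite addrA subrK.
apply: le_lt_trans (sqnD_le _ _ _) _; rewrite (sqnBC _ l).
have h1 := hk _ km; have h2 := hk _ (leq_trans km mn).
rewrite ger0_norm ?sqn_ge0// in h1; rewrite ger0_norm ?sqn_ge0// in h2.
lra.
Qed.

Lemma hlim_dot_eq (R : realType) (H H' : lmodType R[i]) (d : {dot H for @conjc R})
    (d' : {dot H' for @conjc R}) (u : nat -> H) l (v : nat -> H') m y z :
  hlim d u l -> hlim d' v m -> (forall n, d (u n) y = d' (v n) z) -> d l y = d' m z.
Proof.
move=> ul vm uv; apply/eqP; rewrite -subr_eq0; apply/eqP/nsq_eq0.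
have h := cvg0_comb 2 2 (hlim_dot y ul) (hlim_dot z vm).
have : (nsq (d l y - d' m z))%R @[_ --> \oo] --> (0 : R).
  apply: (squeeze0 _ h) => n; rewrite nsq_ge0/=.
  have -> : d l y - d' m z = - (d (u n) y - d l y) + (d' (v n) z - d' m z).
    by rewrite (uv n); ring.
  by apply: le_trans (nsqD_le _ _) _; rewrite nsqN.
by move/(cvg_unique (@Rhausdorff R) (@cvg_cst _ _ _ _ _)).
Qed.

(** Polarization: the squared norm of [x + y] gives the real parts, and replacing [x] by ['i *: x]
    gives the imaginary parts. *)
Lemma isometry_dot (R : realType) (H H' : lmodType R[i]) (d : {dot H for @conjc R})
    (d' : {dot H' for @conjc R}) (c : R) (A : H -> H') :
  (forall a x y, A (a *: x + y) = a *: A x + A y) ->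
  (forall x, sqn d' (A x) = c * sqn d x) ->
  forall x y, d' (A x) (A y) = c%:C * d x y.
Proof.
move=> AP Asqn x y.
have key z : Re (d' (A z) (A y)) = c * Re (d z y).
  have := Asqn (z + y); have := AP 1 z y; rewrite !scale1r => ->.
  by rewrite !sqnD !Asqn; lra.
have A0 : A 0 = 0 by have := AP (-1) 0 0; rewrite scaler0 addr0 scaleN1r addNr.
apply: ceqP; rewrite !ReImE /= mul0r ?subr0 ?addr0 ?add0r; first exact: key.
have := key ('i *: x); have := AP 'i x 0; rewrite !addr0 A0 addr0 => ->.
rewrite !dotZl !ReImE /= !mul0r !mul1r !sub0r mulrN => /oppr_inj ->.
by [].
Qed.

Lemma dsum_complete (R : realType) (I : finType) (H : I -> lmodType R[i])
    (d : forall i, {dot (H i) for @conjc R}) :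
  (forall i, hcomplete (d i)) -> hcomplete (dsum_dot d).
Proof.
move=> cd u cu.
have E (x : dsum H) : sqn (dsum_dot d) x = \sum_i sqn (d i) (x i).
  by rewrite /sqn /= /dsum_dot Re_sum.
have ci i : hcauchy (d i) (fun n => u n i).
  move=> e e0; have [k hk] := cu e e0; exists k => m n mn.
  apply: le_lt_trans (hk m n mn); rewrite E (bigD1 i)//= lerDl sumr_ge0// => j _.
  exact: sqn_ge0.
pose l : dsum H := fun i => sval (cid (cd i _ (ci i))).
have hl i : hlim (d i) (fun n => u n i) (l i) by exact: svalP (cid (cd i _ (ci i))).
exists l; rewrite /hlim.
rewrite (_ : (fun n => _) = (fun n => \sum_i sqn (d i) (u n i - l i))); last first.
  by apply/funext => n; rewrite E.
rewrite -[X in _ --> X](_ : \sum_(i : I) 0 = 0 :> R); last by rewrite big1.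
by apply: cvg_sumR => i; exact: hl.
Qed.

(** * The space L2 *)

Section L2Space.
Variable R : realType.
Local Notation C := R[i].
Local Notation mu := (@lebesgue_measure R).
Local Notation L2 := (L2 R).
Local Notation d := (@L2_dot R).
Implicit Types (f g h : L2) (u v : R -> C).

Lemma aeS (P Q : R -> Prop) : (forall x, P x -> Q x) ->
  {ae mu, forall x, P x} -> {ae mu, forall x, Q x}.
Proof. by move=> PQ; apply: (@filterS _ _ (ae_filter_ringOfSetsType mu)). Qed.

Lemma aeS2 (P Q S : R -> Prop) : (forall x, P x -> Q x -> S x) ->
  {ae mu, forall x, P x} -> {ae mu, forall x, Q x} -> {ae mu, forall x, S x}.
Proof. by move=> PQ; apply: (@filterS2 _ _ (ae_filter_ringOfSetsType mu)). Qed.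

Lemma n2_ae u v : cmeas u -> cmeas v -> {ae mu, forall x, u x = v x} -> n2 u = n2 v.
Proof.
move=> mu' mv uv; apply: ae_eq_integral => //.
- by apply/measurable_EFinP; exact: measurable_nsq.
- by apply/measurable_EFinP; exact: measurable_nsq.
- by apply: aeS uv => x ->.
Qed.

Lemma n2_eq0 u : cmeas u -> n2 u = 0%E -> {ae mu, forall x, u x = 0}.
Proof.
move=> mu' u0.
have : (\int[mu]_x `|(nsq (u x))%:E| = 0)%E.
  by rewrite -[RHS]u0; apply: eq_integral => x _; rewrite /= ger0_norm ?nsq_ge0.
have mn : measurable_fun setT (fun x => (nsq (u x))%:E).
  by apply/measurable_EFinP; exact: measurable_nsq.
move/(ae_eq_integral_abs mu measurableT mn).
by apply: (@filterS _ _ (ae_filter_ringOfSetsType mu)) => x /(_ I) /= [] /nsq_eq0.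
Qed.

Lemma sqint_cmeas u : u \in @sqint R -> cmeas u.
Proof. by move=> /sqintP[]. Qed.

Lemma sqint_n2 u : u \in @sqint R -> (n2 u < +oo)%E.
Proof. by move=> /sqintP[]. Qed.

Lemma L2_sqint f : (f : R -> C) \in @sqint R.
Proof. exact: (valP (repr f : sqintfun R)). Qed.

Lemma L2_cmeas f : cmeas f.
Proof. exact: sqint_cmeas (L2_sqint f). Qed.

Lemma L2_eqP f g : f = g <-> {ae mu, forall x, f x = g x}.
Proof.
split=> [->|fg]; first exact: aeW.
rewrite -[f]reprK -[g]reprK; apply/pi_eqP; rewrite inE.
by apply: aeS fg => x E; rewrite -[LHS]/(f x - g x) E subrr.
Qed.

Lemma L2_piE (u : sqintfun R) : {ae mu, forall x, (\pi_L2 u : L2) x = u x}.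
Proof.
have := repr_pi u; rewrite inE; apply: aeS => x h.
by apply/eqP; rewrite -subr_eq0; apply/eqP.
Qed.

(** The quotient class of [u] is a witness, so the default of [xget] is not reached. *)
Lemma L2_classE u : u \in @sqint R -> {ae mu, forall x, L2_class u x = u x}.
Proof.
move=> su; rewrite /L2_class; case: xgetP => [f _ //|].
by move=> /(_ (\pi_L2 (SqIntFun su))) []; exact: L2_piE.
Qed.

Lemma L2_scaleDE (a : C) f g : {ae mu, forall x, (a *: f + g : L2) x = a * f x + g x}.
Proof.
have E : a *: f + g = \pi_L2 (a *: (repr f : sqintfun R) + repr g).
  by rewrite -pi_addE reprK.
rewrite E; exact: L2_piE.
Qed.

Lemma L2_0E : {ae mu, forall x, (0 : L2) x = 0}.
Proof.
have E := L2_scaleDE (-1) (0 : L2) 0; rewrite scaler0 addr0 in E.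
by apply: aeS E => x ->; rewrite mulN1r addNr.
Qed.

Lemma L2_BE f g : {ae mu, forall x, (f - g : L2) x = f x - g x}.
Proof.
have := L2_scaleDE (-1) g f; rewrite scaleN1r addrC.
by apply: aeS => x ->; rewrite mulN1r addrC.
Qed.

Lemma L2_sqnE f : (sqn d f)%:E = n2 f.
Proof.
rewrite /sqn /= /L2_dot /cintegral /= /Rintegral.
rewrite (_ : (fun x => _) = (fun x => (nsq (f x))%:E)).
  rewrite fineK// ge0_fin_numE ?n2_ge0//; exact: sqint_n2 (L2_sqint f).
by apply/funext => x; rewrite nsqE.
Qed.

Lemma L2_sqnBE f g : (sqn d (f - g))%:E = n2 (fun x => f x - g x).
Proof.
rewrite L2_sqnE; apply: n2_ae (L2_BE f g); first exact: L2_cmeas.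
by apply: cmeasB; exact: L2_cmeas.
Qed.

Lemma L2_dotE f g : d f g = cint (fun x => f x * conjc (g x)).
Proof. by []. Qed.

Lemma L2_dot_class f u : u \in @sqint R -> d f (L2_class u) = cint (fun x => f x * conjc (u x)).
Proof.
move=> su; rewrite L2_dotE; apply: ae_eq_cint.
- by apply: cmeasM; [exact: L2_cmeas|apply: cmeasJ; exact: L2_cmeas].
- by apply: cmeasM; [exact: L2_cmeas|apply: cmeasJ; exact: sqint_cmeas].
- by apply: aeS (L2_classE su) => x ->.
Qed.

Lemma sqn_L2_class u : u \in @sqint R -> (sqn d (L2_class u))%:E = n2 u.
Proof.
by move=> su; rewrite L2_sqnE; apply: n2_ae (L2_classE su); [exact: L2_cmeas|exact: sqint_cmeas].
Qed.

Lemma geometric_step_cvg (a : nat -> R) (M r : R) : 0 <= M -> 0 <= r < 1 ->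
  (forall n, `|a n.+1 - a n| <= M * r ^+ n) -> cvgn a.
Proof.
move=> M0 /andP[r0 r1] h.
have cs : cvgn (series (telescope a)).
  apply: normed_cvg; apply: (@series_le_cvg _ _ (geometric M r)) => //.
  - by move=> n; exact: normr_ge0.
  - by move=> n; exact: mulr_ge0 M0 (exprn_ge0 n r0).
  - by apply: is_cvg_geometric_series; rewrite ger0_norm.
rewrite (_ : a = (fun n => a 0%N + series (telescope a) n)).
  by apply: is_cvgD => //; exact: is_cvg_cst.
by apply/funext => n; exact: eq_sum_telescope.
Qed.

(* If [\int |v_{j+1} - v_j|^2 <= 8^-j] then [\sum_j 2^j |v_{j+1} - v_j|^2] is finite
   almost everywhere, which forces geometric convergence of [v_j] pointwise. *)
Lemma fast_cauchy_ae_cvg (v : nat -> R -> C) : (forall j, cmeas (v j)) ->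
  (forall j, (n2 (fun x => (v j.+1 x - v j x)%R) <= (8^-1 ^+ j)%:E)%E) ->
  exists A : set R, [/\ measurable A, mu (~` A) = 0%E &
    forall x, A x -> cvgn (fun j => Re (v j x)) /\ cvgn (fun j => Im (v j x))].
Proof.
move=> mv hv.
pose D j x := v j.+1 x - v j x.
have mD j : cmeas (D j) by exact: cmeasB.
pose F (j : nat) (x : R) : \bar R := (2 ^+ j * nsq (D j x))%:E.
have mF j : measurable_fun setT (F j).
  by apply/measurable_EFinP; apply: measurable_funM => //; exact: measurable_nsq (mD j).
have F0 j x : (0 <= F j x)%E by rewrite lee_fin mulr_ge0 ?exprn_ge0 ?nsq_ge0.
pose h (x : R) := (\sum_(j <oo) F j x)%E.
have h0 x : (0 <= h x)%E by apply: nneseries_ge0.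
have mh : measurable_fun setT h by apply: ge0_emeasurable_sum => // *.
have ih : mu.-integrable setT h.
  apply/integrableP; split => //.
  under eq_integral do rewrite gee0_abs//.
  rewrite integral_nneseries//.
  have hj j : (\int[mu]_x F j x <= (geometric 1 4^-1 j)%:E)%E.
    have -> : (\int[mu]_x F j x = (2 ^+ j)%:E * n2 (D j))%E.
      rewrite /n2 -ge0_integralZl//.
      - by apply/measurable_EFinP; exact: measurable_nsq (mD j).
      - by move=> x _; rewrite lee_fin nsq_ge0.
    apply: (@le_trans _ _ ((2 ^+ j)%:E * (8^-1 ^+ j)%:E)%E).
      by rewrite lee_wpmul2l ?lee_fin ?exprn_ge0//; exact: hv.
    rewrite -EFinM lee_fin /geometric /= mul1r -exprMn lerXn2r ?nnegrE//; lra.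
  apply: (@le_lt_trans _ _ (\sum_(j <oo) (geometric 1 4^-1 j)%:E)%E).
    by apply: lee_nneseries => // j _ _; apply: integral_ge0.
  have cg : series (geometric (1 : R) 4^-1) @ \oo --> (1 * (1 - 4^-1)^-1 : R).
    by apply: cvg_geometric_series; rewrite ger0_norm; lra.
  have -> : (\sum_(j <oo) (geometric (1:R) 4^-1 j)%:E = (1 * (1 - 4^-1)^-1)%:E)%E.
    apply/cvg_lim => //.
    rewrite (_ : (fun n => _) = EFin \o series (geometric (1:R) 4^-1)).
      by apply: cvg_EFin; [exact: nearW|exact: cg].
    by apply/funext => n /=; rewrite sumEFin.
  exact: ltry.
have [N [mN N0 subN]] := integrable_ae measurableT ih.
exists (~` N); split; [exact: measurableC|by rewrite setCK|].
move=> x Nx.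
have hfin : h x \is a fin_num.
  by apply: contrapT => hx; apply: Nx; apply: subN => /= /(_ I).
pose M := Num.sqrt (fine (h x)).
have hM0 : 0 <= fine (h x) by rewrite fine_ge0.
have Dj j : nsq (D j x) <= fine (h x) * (2^-1 ^+ j).
  rewrite exprVn ler_pdivlMr ?exprn_gt0// mulrC -lee_fin fineK//.
  rewrite /h -/(F j x); apply: le_trans (nneseries_lim_ge j.+1 _); last by move=> *; exact: F0.
  rewrite big_mkord big_ord_recr /= leeDr//; apply: sume_ge0 => k _; exact: F0.
have r01 : 0 <= Num.sqrt (2^-1 : R) < 1.
  by rewrite sqrtr_ge0 /= -[ltRHS]sqrtr1 ltr_sqrt//; lra.
have key (a : nat -> R) : (forall j, (a j.+1 - a j) ^+ 2 <= nsq (D j x)) -> cvgn a.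
  move=> ha; apply: (geometric_step_cvg (sqrtr_ge0 (fine (h x))) r01) => j.
  rewrite -sqrtr_sqr -(@ger0_norm _ (Num.sqrt 2^-1 ^+ j)) ?exprn_ge0 ?sqrtr_ge0//.
  rewrite -[X in `|X|](_ : Num.sqrt (2^-1 ^+ j) = _); last first.
    by elim: {Dj ha} j => [|j IH]; rewrite ?expr0 ?sqrtr1// !exprS sqrtrM// IH.
  rewrite ger0_norm ?sqrtr_ge0// -sqrtrM// ler_wsqrtr// (le_trans (ha j))//.
split; apply: key => j; rewrite /D /nsq !ReImE.
  by rewrite lerDl sqr_ge0.
by rewrite lerDr sqr_ge0.
Qed.

(** Riesz-Fischer: a subsequence with rapidly decreasing steps converges almost everywhere, and
    Fatou's lemma turns the pointwise limit into a limit in norm. *)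
Lemma L2_complete : hcomplete d.
Proof.
move=> u cu.
have /choice[K hK] : forall j, exists k, forall m n, (k <= m <= n)%N ->
    sqn d (u n - u m) < 8^-1 ^+ j.
  by move=> j; apply: cu; rewrite exprn_gt0// invr_gt0.
pose k := fix k j := if j is j'.+1 then maxn (k j').+1 (K j) else K 0%N.
have kK j : (K j <= k j)%N by case: j => //= j; rewrite leq_maxr.
have kS j : (k j < k j.+1)%N by rewrite /= leq_maxl.
have kj j : (j <= k j)%N by elim: j => // j IH; exact: leq_ltn_trans IH (kS j).
have hk j n : (k j <= n)%N -> sqn d (u n - u (k j)) < 8^-1 ^+ j.
  by move=> kn; apply: hK; rewrite kK.
pose U n : R -> C := L2_fun (u n).
pose v0 j : R -> C := U (k j).
have [|j|A [mA A0 cA]] := @fast_cauchy_ae_cvg v0.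
- by move=> j; exact: L2_cmeas (u (k j)).
- by rewrite -(L2_sqnBE (u (k j.+1)) (u (k j))) lee_fin ltW// hk// ltnW.
have mU n : cmeas (U n) by exact: L2_cmeas (u n).
(* Replacing the values off [A] by 0 makes the sequence converge at every point, so the limit [g] is
   measurable as it stands. *)
pose v j := cutoff A (v0 j).
have mv j : cmeas (v j) by apply: cmeas_restrict => //; exact: mU.
pose g x : C := (limn (fun j => Re (v j x))) +i* (limn (fun j => Im (v j x))).
have vg x : (Re (v j x) @[j --> \oo] --> Re (g x)) /\ (Im (v j x) @[j --> \oo] --> Im (g x)).
  rewrite /g /v /cutoff; case: (boolP (x \in A)) => [/set_mem/cA[c1 c2]//|_].
  by split; apply: is_cvg_cst.
have mg : cmeas g.
  split; [apply: (@measurable_fun_cvg _ _ _ setT (fun j x => Re (v j x)))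
    |apply: (@measurable_fun_cvg _ _ _ setT (fun j x => Im (v j x)))].
  - by move=> j; case: (mv j).
  - by move=> x _; exact: (vg x).1.
  - by move=> j; case: (mv j).
  - by move=> x _; exact: (vg x).2.
have key n (e : R) : (\forall j \near \oo, sqn d (u n - u (k j)) <= e) ->
    (n2 (fun x => (U n x - g x)%R) <= e%:E)%E.
  move=> [j0 _ hj].
  (* The shift by [j0] makes the bound [e] valid for every index, hence for the infimum of every
     tail in the lower limit. *)
  pose G j x : \bar R := (nsq (U n x - v (j + j0)%N x))%:E.
  have cG x : G j x @[j --> \oo] --> (nsq (U n x - g x))%:E.
    apply: cvg_EFin; first exact: nearW.
    have [c1 c2] := vg x.
    have {}c1 : Re (v (j + j0)%N x) @[j --> \oo] --> Re (g x) by rewrite (cvg_shiftn j0 (fun j => Re (v j x))).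
    have {}c2 : Im (v (j + j0)%N x) @[j --> \oo] --> Im (g x) by rewrite (cvg_shiftn j0 (fun j => Im (v j x))).
    have E z : nsq (U n x - z) = (Re (U n x) - Re z) * (Re (U n x) - Re z) +
        (Im (U n x) - Im z) * (Im (U n x) - Im z) by rewrite /nsq !ReImE !expr2.
    rewrite E; rewrite (_ : _ \o _ = (fun j => (Re (U n x) - Re (v (j + j0)%N x)) *
        (Re (U n x) - Re (v (j + j0)%N x)) + (Im (U n x) - Im (v (j + j0)%N x)) *
        (Im (U n x) - Im (v (j + j0)%N x)))); last by apply/funext => j /=; rewrite E.
    by apply: cvgD; apply: cvgM; apply: cvgB => //; exact: cvg_cst.
  have mG j : measurable_fun setT (G j).
    by apply/measurable_EFinP/measurable_nsq/cmeasB => //; exact: mU.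
  have G0 j x : setT x -> (0 <= G j x)%E by rewrite lee_fin nsq_ge0.
  have fG := fatou mu measurableT mG G0.
  apply: (@le_trans _ _ (limn_einf (fun j => \int[mu]_x G j x)%E)).
    apply: le_trans fG; rewrite le_eqVlt; apply/orP; left; apply/eqP.
    by apply: eq_integral => x _; rewrite is_cvg_limn_einfE ?(cvg_lim _ (cG x))//; apply: cvgP (cG x).
  rewrite limn_einf_lim; apply: lime_le; first exact: is_cvg_einfs.
  apply: nearW => j; apply: (@le_trans _ _ (\int[mu]_x G j x)%E).
    by apply: ereal_inf_lbound; exists j => //=.
  rewrite -[leLHS](_ : n2 (fun x => U n x - U (k (j + j0)%N) x) = _).
    by rewrite -(L2_sqnBE (u n) (u (k (j + j0)%N))) lee_fin; apply: hj => /=; rewrite leq_addl.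
  apply: n2_ae.
  - by apply: cmeasB; exact: mU.
  - by apply: cmeasB => //; exact: mU.
  exists (~` A); split => //; first exact: measurableC.
  by move=> x /=; apply: contra_not => Ax; rewrite /v /cutoff mem_set.
have sg : g \in @sqint R.
  have s1 : (fun x => U (k 0%N) x - g x) \in @sqint R.
    apply/sqintP; split; first by apply: cmeasB => //; exact: mU.
    apply: (@le_lt_trans _ _ 1%:E); last exact: ltry.
    apply: key; exists 0%N => // j _ /=; rewrite sqnBC ltW//.
    have := @hk 0%N (k j); rewrite expr0; apply.
    by elim: j => // j IH; exact: leq_trans IH (ltnW (kS j)).
  have := rpredB (L2_sqint (u (k 0%N))) s1.
  rewrite (_ : _ - _ = g)//; apply/funext => x.
  by rewrite -[LHS]/(U (k 0%N) x - (U (k 0%N) x - g x)) subKr.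
exists (L2_class g); apply/cvgr0Pnorm_lt => e e0.
have e2 : 0 < e / 2 by rewrite divr_gt0.
have [m hm] := cu _ e2.
exists m => // n /= mn; rewrite ger0_norm ?sqn_ge0//.
apply: (@le_lt_trans _ _ (e / 2)); last by rewrite ltr_pdivrMr// ltr_pMr// ltr1n.
rewrite -lee_fin (L2_sqnBE (u n) (L2_class g)).
rewrite (@n2_ae _ (fun x => U n x - g x)); first last.
- by apply: aeS (L2_classE sg) => x ->.
- by apply: cmeasB => //; exact: mU.
- by apply: cmeasB; [exact: mU|exact: L2_cmeas].
apply: key; exists n => // j /= nj; rewrite sqnBC ltW// hm// mn /=.
exact: leq_trans nj (kj j).
Qed.

End L2Space.

(** * Total sets of exponentials *)

Section CircleCompleteness.
Variable R : realType.
Local Notation C := R[i].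
Local Notation mu := (@lebesgue_measure R).

(** Lebesgue differentiation: the averages over balls of radius $1/(n+1)$ converge almost everywhere
    to [f x], and on [A] they are eventually 0. *)
Lemma ae_zero_of_ball (f : R -> R) (A : set R) :
  mu.-integrable setT (EFin \o f) ->
  (forall x, A x -> exists2 r0, 0 < r0 &
     forall r, 0 < r < r0 -> (\int[mu]_(y in ball x r) (f y)%:E = 0)%E) ->
  {ae mu, forall x, A x -> f x = 0}.
Proof.
move=> intf h.
have locf : locally_integrable setT f.
  by apply: open_integrable_locally => //; exact: openT.
pose E (x : R) (n : nat) : set R := ball x n.+1%:R^-1.
have nE x : nicely_shrinking x (E x).
  split; first by move=> n; exact: measurable_ball.
  have pos n : 0 < n.+1%:R^-1 :> R by rewrite invr_gt0.
  exists (1, fun n => PosNum (pos n)) => /=.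
  split => //.
  - exact: cvg_harmonic.
  - by move=> n y.
  - by move=> n; rewrite mul1e.
move: (lebesgue_differentiation locf); apply: aeS => x lx Ax.
have [r0 r00 hr] := h x Ax.
have c := nice_lebesgue_differentiation nE locf lx.
have c0 : ((mu (E x n))^-1 * \int[mu]_(y in E x n) (f y)%:E)%E @[n --> \oo] --> 0%E.
  apply: cvg_trans (@cvg_cst _ (0%E : \bar R) _ \oo _).
  apply: near_eq_cvg; near=> n; rewrite hr ?mule0//.
  rewrite invr_gt0 ltr0n /=.
  by near: n; exact: near_infty_natSinv_lt (PosNum r00).
by have [] : (f x)%:E = 0%E by exact: (cvg_unique (@ereal_hausdorff R) c c0).
Unshelve. all: by end_near. Qed.

Lemma bernoulli_ge (t : R) m : 0 <= t <= 1 -> 1 - m%:R * t <= (1 - t) ^+ m.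
Proof.
move=> /andP[t0 t1]; elim: m => [|m IH]; first by rewrite mul0r subr0 expr0.
rewrite exprS; apply: (@le_trans _ _ ((1 - t) * (1 - m%:R * t))).
  rewrite -natr1; have : 0 <= m%:R * t * t :> R by rewrite !mulr_ge0.
  by set k := m%:R; nra.
by rewrite ler_wpM2l// subr_ge0.
Qed.

Lemma bernoulli_le (t : R) m : 0 <= t <= 1 -> (1 - t) ^+ m * (1 + m%:R * t) <= 1.
Proof.
move=> /andP[t0 t1]; elim: m => [|m IH]; first by rewrite expr0 mul0r addr0 mulr1.
apply: le_trans IH; rewrite exprSr -mulrA ler_wpM2l ?exprn_ge0 ?subr_ge0//.
rewrite -natr1; have : 0 <= m%:R * t * t :> R by rewrite !mulr_ge0.
by set k := m%:R; nra.
Qed.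

(** With $s = \sqrt r$, $n r^n = (n s^n) s^n$, and Bernoulli's inequality for $1/s = 1 + a$ bounds
    $n s^n$ by $1/a$. *)
Lemma cvg_natX (r : R) : 0 <= r < 1 -> n%:R * r ^+ n @[n --> \oo] --> (0 : R).
Proof.
move=> /andP[r0 r1]; have [->|rn0] := eqVneq r 0.
  apply: cvg_trans (@cvg_cst _ (0 : R) _ \oo _); apply: near_eq_cvg.
  by exists 1%N => // -[|n] // _; rewrite expr0n mulr0.
have rp : 0 < r by rewrite lt_def rn0.
pose s := Num.sqrt r; have sp : 0 < s by rewrite sqrtr_gt0.
have s1 : s < 1 by rewrite -[ltRHS]sqrtr1 ltr_sqrt.
pose a := s^-1 - 1; have ap : 0 < a by rewrite subr_gt0 invf_gt1.
have hn n : n%:R * s ^+ n <= a^-1.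
  have h : 1 + n%:R * a <= s^-1 ^+ n.
    elim: n => [|n IH]; first by rewrite mul0r addr0 expr0.
    rewrite exprS; apply: (@le_trans _ _ (s^-1 * (1 + n%:R * a))); last first.
      by rewrite ler_wpM2l// invr_ge0 ltW.
    have -> : s^-1 = 1 + a by rewrite /a addrC subrK.
    rewrite -natr1; have : 0 <= n%:R * a * a :> R by rewrite !mulr_ge0// ltW.
    by set k := n%:R; nra.
  have sn : 0 <= s ^+ n by rewrite exprn_ge0// ltW.
  have := ler_wpM2r sn h; rewrite -exprMn mulVf ?gt_eqF// expr1n => h2.
  rewrite -[a^-1]mul1r ler_pdivlMr// (le_trans _ h2)// mulrDl mul1r mulrAC.
  by rewrite lerDr.
have c : s ^+ n * a^-1 @[n --> \oo] --> (0 : R).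
  apply: cvg0_mulr; have := @cvg_geometric R 1 s; rewrite ger0_norm ?(ltW sp)// => /(_ s1).
  by apply: cvg_trans; apply: near_eq_cvg; apply: nearW => n /=; rewrite mul1r.
apply: (squeeze0 _ c) => n.
rewrite mulr_ge0 ?exprn_ge0//=.
have -> : r ^+ n = s ^+ n * s ^+ n by rewrite -exprMn -expr2 sqr_sqrtr.
by rewrite mulrA [leRHS]mulrC ler_wpM2r// exprn_ge0// ltW.
Qed.

(** With $m \approx n \delta^{-n}$, $(1 - v^n)^m$ behaves like $\exp(-n (v/\delta)^n)$. The factor
    $n$ settles the tie: at $v = \delta$ the limit is 0, in accordance with the strict inequality in
    the indicator. *)
Definition threshold_exp (delta : R) (n : nat) : nat := Num.truncn (n%:R * delta ^- n).

(* Polynomials in [v] converging boundedly on [0, 1] to the indicator of [v < delta]. *)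
Lemma cvg_threshold (delta v : R) : 0 < delta -> 0 <= v <= 1 ->
  (1 - v ^+ n) ^+ threshold_exp delta n @[n --> \oo] --> ((v < delta)%R%:R : R).
Proof.
move=> d0 /andP[v0 v1].
have vn n : 0 <= v ^+ n <= 1 by rewrite exprn_ge0//= exprn_ile1.
have b0 n m : 0 <= (1 - v ^+ n) ^+ m by rewrite exprn_ge0// subr_ge0; case/andP: (vn n).
have b1 n m : (1 - v ^+ n) ^+ m <= 1.
  by apply: exprn_ile1; rewrite ?subr_ge0 ?lerBlDr ?lerDl; case/andP: (vn n).
have tr n : (threshold_exp delta n)%:R <= n%:R * delta ^- n < (threshold_exp delta n).+1%:R.
  by apply: truncn_itv; rewrite mulr_ge0// invr_ge0 exprn_ge0// ltW.
have [vd|dv] := ltP v delta.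
  have r01 : 0 <= v / delta < 1 by rewrite divr_ge0 ?(ltW d0)//= ltr_pdivrMr// mul1r.
  have c : 1 - n%:R * (v / delta) ^+ n @[n --> \oo] --> (1 : R).
    rewrite -[X in _ --> X](subr0 1); apply: cvgB; first exact: cvg_cst.
    exact: cvg_natX.
  apply: (@squeeze_cvgr _ _ _ _ _ (fun=> 1)) c _; last exact: cvg_cst.
  apply: nearW => n; rewrite b1 andbT; apply: le_trans (bernoulli_ge _ (vn n)).
  rewrite lerD2l lerN2 exprMn exprVn [v ^+ n * _]mulrC mulrA ler_wpM2r//.
    by case/andP: (vn n).
  by case/andP: (tr n).
have c : (n.+1%:R)^-1 @[n --> \oo] --> (0 : R) by exact: cvg_harmonic.
rewrite -(cvg_shiftn 2); apply: (squeeze0 _ c) => n; rewrite b0/=.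
set m := threshold_exp _ _.
(* Truncation loses less than one: $(m+1)\delta^{n+2} > n+2$, and $\delta^{n+2} \le v^{n+2} \le
   1$. *)
have mp : n.+1%:R <= m%:R * v ^+ (n + 2).
  have := tr (n + 2)%N; rewrite -/m => /andP[_].
  rewrite ltr_pdivrMr ?exprn_gt0// => h.
  have dv' : delta ^+ (n + 2) <= v ^+ (n + 2) by rewrite lerXn2r ?nnegrE// ltW.
  have p1 : delta ^+ (n + 2) <= 1 by rewrite (le_trans dv')//; case/andP: (vn (n + 2)%N).
  have : m%:R * delta ^+ (n + 2) <= m%:R * v ^+ (n + 2) by rewrite ler_wpM2l.
  have e1 : m.+1%:R = m%:R + 1 :> R by rewrite natr1.
  have e2 : (n + 2)%:R = n.+1%:R + 1 :> R by rewrite natr1 addn2.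
  by move: h; rewrite e1 e2 mulrDl mul1r; lra.
have := bernoulli_le m (vn (n + 2)%N).
have : 0 < 1 + m%:R * v ^+ (n + 2) by rewrite ltr_pwDl// (le_trans _ mp).
move=> p; rewrite -ler_pdivlMr// div1r => h.
by apply: le_trans h _; rewrite lef_pV2 ?posrE// (le_trans mp)// lerDr.
Qed.

Variables (J : finType) (X : J -> set R) (w : J -> R -> C) (g : J -> R -> C).
Hypothesis mw : forall j, cmeas (w j).
Hypothesis w1 : forall j x, nsq (w j x) = 1.
Hypothesis ig : forall j, cintg (g j).
Hypothesis g0 : forall j x, ~ X j x -> g j x = 0.
Hypothesis moments : forall k : int, \sum_j cint (fun x => g j x * w j x ^ k) = 0.

(** The bounded multipliers under which all joint moments of [g] stay 0. Quantifying over every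
    exponent [k] inside makes the class stable under multiplication by powers of [w]. *)
Definition annihilated (h : J -> R -> C) : Prop :=
  [/\ forall j, cmeas (h j), exists M, forall j x, nsq (h j x) <= M &
    forall k : int, \sum_j cint (fun x => g j x * (h j x * w j x ^ k)) = 0].

Let cgh h : annihilated h -> forall j (k : int), cintg (fun x => g j x * (h j x * w j x ^ k)).
Proof.
move=> [mh [M hM] _] j k; apply: (@cintg_bounded _ _ _ M) => //.
  by apply: cmeasM => //; exact: cmeas_exprz.
by move=> x; rewrite nsqM nsq1_exprz// mulr1.
Qed.

Lemma annihilated1 : annihilated (fun _ _ => 1).
Proof.
split; first by move=> j; exact: cmeas_cst.
  by exists 1 => j x; rewrite nsq1.
move=> k; rewrite -[RHS](moments k); apply: eq_bigr => j _.
by apply: eq_cint => x; rewrite mul1r.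
Qed.

Lemma annihilatedP a b h1 h2 : annihilated h1 -> annihilated h2 ->
  annihilated (fun j x => a * h1 j x + b * h2 j x).
Proof.
move=> A1 A2; have [m1 [M1 b1] z1] := A1; have [m2 [M2 b2] z2] := A2; split.
- by move=> j; apply: cmeasD; apply: cmeasM => //; exact: cmeas_cst.
- exists (2 * (nsq a * M1) + 2 * (nsq b * M2)) => j x.
  rewrite (le_trans (nsqD_le _ _))// !nsqM lerD// ler_wpM2l// ler_wpM2l ?nsq_ge0//.
- move=> k.
  transitivity (a * (\sum_j cint (fun x => g j x * (h1 j x * w j x ^ k))) +
    b * (\sum_j cint (fun x => g j x * (h2 j x * w j x ^ k)))); last first.
    by rewrite z1 z2 !mulr0 addr0.
  rewrite !mulr_sumr -big_split; apply: eq_bigr => j _ /=.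
  rewrite -!cintZ; [|exact: cgh..].
  rewrite -cintD; [|apply: cintgZ; exact: cgh..].
  by apply: eq_cint => x; ring.
Qed.

Lemma annihilated_shift h l : annihilated h -> annihilated (fun j x => h j x * w j x ^ l).
Proof.
move=> [mh [M bh] zh]; split.
- by move=> j; apply: cmeasM => //; exact: cmeas_exprz.
- by exists M => j x; rewrite nsqM nsq1_exprz// mulr1.
- move=> k; rewrite -[RHS](zh (l + k)); apply: eq_bigr => j _; apply: eq_cint => x.
  by rewrite expfzDr ?nsq1_neq0// !mulrA.
Qed.

Section Arc.
Variable w0 : C.
Hypothesis w01 : nsq w0 = 1.

(** For unimodular [u] this is $|u - w_0|^2/4$: it lies in $[0,1]$, its sublevel sets are the arcs
    around [w0], and it is a trigonometric polynomial of degree 1. *)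
Definition arcval (u : C) : R := (1 - Re (u * conjc w0)) / 2.

Lemma arcval01 j x : 0 <= arcval (w j x) <= 1.
Proof.
have h : nsq (w j x * conjc w0) = 1 by rewrite nsqM nsqJ w1 w01 mulr1.
by rewrite /arcval; move/nsq1_Re : h => /andP[h1 h2]; apply/andP; split; lra.
Qed.

(** On the circle [conjc u] is [u ^ -1], so multiplication by [arcval] combines the shifts of the
    exponent by 1 and -1. *)
Lemma annihilated_arcval h : annihilated h -> annihilated (fun j x => (arcval (w j x))%:C * h j x).
Proof.
move=> Ah; have A1 := annihilated_shift 1 Ah; have A2 := annihilated_shift (-1) Ah.
have := annihilatedP 1 1 (annihilatedP (2^-1) 0 Ah Ah)
  (annihilatedP (- (4^-1 * conjc w0)) (- (4^-1 * w0)) A1 A2).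
congr annihilated; apply/funext => j; apply/funext => x.
rewrite expr1z exprN1 -(nsq1_conj (w1 j x)).
have -> : (arcval (w j x))%:C = 2^-1 - 4^-1 * (w j x * conjc w0 + conjc (w j x) * w0).
  rewrite /arcval -[w0 in conjc (w j x) * w0]conjcK -rmorphM addcJ.
  rewrite rmorphM rmorphB rmorph1 fmorphV rmorph_nat mulrBl mul1r.
  by congr (_ - _); field.
by ring.
Qed.

Lemma annihilated_arcval_poly n m :
  annihilated (fun j x => ((1 - arcval (w j x) ^+ n) ^+ m)%:C).
Proof.
have An h : annihilated h -> annihilated (fun j x => (arcval (w j x) ^+ n)%:C * h j x).
  elim: n h => [|n IH] h Ah.
    by move: Ah; congr annihilated; apply/funext => j; apply/funext => x; rewrite expr0 rmorph1 mul1r.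
  move: (IH _ (annihilated_arcval Ah)); congr annihilated.
  by apply/funext => j; apply/funext => x; rewrite exprSr rCM mulrA.
elim: m => [|m IH]; first exact: annihilated1.
move: (annihilatedP 1 (-1) IH (An _ IH)); congr annihilated.
apply/funext => j; apply/funext => x; rewrite exprS rCM rCB; ring.
Qed.

(** The threshold polynomials in [arcval] are annihilated multipliers with values in $[0,1]$;
    dominated convergence, with bound [|T (g j x)|], passes to the indicator of the arc. [T] treats
    both real components at once. *)
Lemma arc_integral_eq0 (delta : R) (T : C -> R) : 0 < delta ->
  (T = (fun z => Re z) \/ T = (fun z => Im z)) ->
  \sum_j \int[mu]_x (T (g j x) * (arcval (w j x) < delta)%R%:R) = 0.
Proof.
move=> d0 hT.
have TM z (r : R) : T (z * r%:C) = T z * r.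
  by case: hT => ->; rewrite !ReImE /= mulr0 ?subr0 ?addr0// add0r.
have iT j : mu.-integrable setT (fun x => (T (g j x))%:E).
  by have [i1 i2] := ig j; case: hT => ->.
have mT j : measurable_fun setT (fun x => T (g j x)).
  by apply/measurable_EFinP; exact: measurable_int (iT j).
pose q n x : R := (1 - x ^+ n) ^+ threshold_exp delta n.
have mv j : measurable_fun setT (fun x => arcval (w j x)).
  have [m1 _] := cmeasM (mw j) (@cmeas_cst _ _ _ (conjc w0)).
  by apply: measurable_funM => //; apply: measurable_funB.
have mq n j : measurable_fun setT (fun x => q n (arcval (w j x))).
  by apply: measurable_funX; apply: measurable_funB => //; exact: measurable_funX.
pose f n j x : R := T (g j x) * q n (arcval (w j x)).
have q01 n j x : 0 <= q n (arcval (w j x)) <= 1.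
  have /andP[v0 v1] := arcval01 j x.
  have vn : 0 <= arcval (w j x) ^+ n <= 1 by rewrite exprn_ge0//= exprn_ile1.
  apply/andP; split; first by rewrite exprn_ge0// subr_ge0; case/andP: vn.
  by apply: exprn_ile1; rewrite ?subr_ge0 ?lerBlDr ?lerDl; case/andP: vn.
have fle n j x : (`|(f n j x)%:E| <= `|T (g j x)|%:E)%E.
  rewrite /= lee_fin normrM ler_piMr// ger0_norm; by case/andP: (q01 n j x).
have if_ n j : mu.-integrable setT (fun x => (f n j x)%:E).
  apply: (le_integrable measurableT _ _ (iT j)); last by move=> x _; exact: fle.
  by apply/measurable_EFinP; exact: measurable_funM (mT j) (mq n j).
have cf j : \int[mu]_x f n j x @[n --> \oo] -->
    \int[mu]_x (T (g j x) * (arcval (w j x) < delta)%R%:R).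
  have md : measurable_fun setT (fun x => T (g j x) * (arcval (w j x) < delta)%R%:R).
    apply: measurable_funM => //.
    by apply: measurableT_comp => //; exact: measurable_fun_ltr.
  have [] := @dominated_convergence _ _ _ mu setT measurableT (fun n x => (f n j x)%:E)
    (fun x => (T (g j x) * (arcval (w j x) < delta)%R%:R)%:E) (fun x => `|T (g j x)|%:E).
  - by move=> n; apply/measurable_EFinP; exact: measurable_funM (mT j) (mq n j).
  - exact/measurable_EFinP.
  - apply: aeW => x _; apply: cvg_EFin; first exact: nearW.
    rewrite (_ : _ \o _ = (fun n => T (g j x) * q n (arcval (w j x))))//.
    by apply: cvgMl_tmp; exact: cvg_threshold (arcval01 j x).
  - exact: integrable_norm (iT j).
  - by apply: aeW => x n _; exact: fle.
  move=> il _ c; apply: fine_cvg; rewrite fineK//; exact: integrable_fin_num.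
have z n : \sum_j \int[mu]_x f n j x = 0.
  have [mh _ /(_ 0)] := annihilated_arcval_poly n (threshold_exp delta n).
  move/(congr1 T).
  have -> : T 0 = 0 by case: hT => ->.
  move=> E0; rewrite -[RHS]E0; transitivity (\sum_j T (cint (fun x => g j x *
      (((1 - arcval (w j x) ^+ n) ^+ threshold_exp delta n)%:C * w j x ^ 0)))); last first.
    by case: hT => E; rewrite E ?Re_sum ?Im_sum.
  apply: eq_bigr => j _.
  have TI h : T (cint h) = \int[mu]_x T (h x) by case: hT => ->.
  by rewrite TI; apply: eq_Rintegral => x _; rewrite expr0z mulr1 TM.
have c := @cvg_sumR _ _ (index_enum J) _ _ cf.
have c0 : \sum_j \int[mu]_x f n j x @[n --> \oo] --> (0 : R).
  rewrite (_ : (fun n => _) = (fun=> 0)); first exact: cvg_cst.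
  by apply/funext => n; rewrite z.
exact: (cvg_unique (@Rhausdorff R) c c0).
Qed.

End Arc.

(* Small arcs of the circle around a value of [w] come from a single small interval. *)
Hypothesis local_arc : forall j0 x0, X j0 x0 -> exists2 r0, 0 < r0 &
  forall r, 0 < r < r0 -> exists2 delta, 0 < delta & forall j x, X j x ->
    (arcval (w j0 x0) (w j x) < delta) = (j == j0) && (`|x0 - x| < r).

(** Over the sets [X], a small arc around the value at a point of [X j] pulls back to one small ball
    around that point. The vanishing arc integrals are thus integrals over balls, and Lebesgue
    differentiation applies. *)
Lemma circle_complete j : {ae mu, forall x, g j x = 0}.
Proof.
have key (T : C -> R) : (T = (fun z => Re z) \/ T = (fun z => Im z)) ->
    {ae mu, forall x, X j x -> T (g j x) = 0}.
  move=> hT.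
  have iT : mu.-integrable setT (fun x => (T (g j x))%:E).
    by have [i1 i2] := ig j; case: hT => ->.
  have T0 : T 0 = 0 by case: hT => ->.
  apply: ae_zero_of_ball => // x0 Xx0.
  have [r0 r00 hr0] := local_arc Xx0.
  exists r0 => // r r0r; have [delta d0 hd] := hr0 r r0r.
  have := arc_integral_eq0 (w1 j x0) d0 hT.
  rewrite (bigD1 j)//= [X in _ + X]big1 ?addr0; last first.
    move=> i ij; rewrite -[RHS](_ : \int[mu]_(x in setT) (0 : R) = 0); last first.
      by rewrite Rintegral_cst// mul0r.
    apply: eq_Rintegral => x _; have [Xx|nX] := pselect (X i x).
      by rewrite hd// (negbTE ij) mulr0.
    by rewrite g0// T0 mul0r.
  have -> : \int[mu]_x (T (g j x) * (arcval (w j x0) (w j x) < delta)%R%:R) =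
      \int[mu]_(x in ball x0 r) T (g j x).
    rewrite [RHS]Rintegral_mkcond; apply: eq_Rintegral => x _; rewrite /patch.
    have [Xx|nX] := pselect (X j x); last first.
      by rewrite g0// T0 mul0r; case: ifP.
    rewrite hd// eqxx /=; case: ifPn => [/set_mem xb|/negP xb].
      by rewrite (_ : _ < _ = true) ?mulr1//; exact: xb.
    rewrite (_ : _ < _ = false) ?mulr0//; apply/negbTE/negP => xr; apply: xb.
    exact/mem_set.
  move=> E0; rewrite -[LHS]fineK; first by rewrite -[fine _]/(Rintegral _ _ _) E0.
  apply: integrable_fin_num => //; first exact: measurable_ball.
  by apply: integrableS iT => //; exact: measurable_ball.
have kr := key (fun z => Re z) (or_introl erefl).
have ki := key (fun z => Im z) (or_intror erefl).
move: kr ki; apply: aeS2 => x kr ki; have [Xx|nX] := pselect (X j x); last exact: g0.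
by apply: ceqP; rewrite ?kr ?ki.
Qed.

End CircleCompleteness.

(** * Angles, and tiles mapped injectively into the circle *)

Section Angles.
Variable R : realType.
Local Notation C := R[i].
Local Notation mu := (@lebesgue_measure R).
Implicit Types (s t x y : R) (u : C).

Lemma angle_exists u : nsq u = 1 -> exists2 t, `|t| <= pi & u = expi (- t).
Proof.
move=> u1; have r1 := nsq1_Re u1.
pose a := acos (Re u).
have ca : cos a = Re u by rewrite acosK// in_itv.
have a0 : 0 <= a by exact: acos_ge0.
have ap : a <= pi by exact: acos_lepi.
have sa : sin a ^+ 2 = Im u ^+ 2.
  by rewrite sin2cos2 ca -u1 /nsq addrAC subrr add0r.
move/eqP : sa; rewrite eqf_sqr => /orP[|] /eqP sa.
  exists (- a); first by rewrite normrN ger0_norm.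
  by rewrite opprK; apply: ceqP.
exists a; first by rewrite ger0_norm.
by apply: ceqP; rewrite /= ?cosN ?sinN ?sa ?opprK.
Qed.

Lemma lt_cos_norm s t : `|s| <= pi -> `|t| <= pi -> (cos s < cos t) = (`|t| < `|s|).
Proof. by move=> sp tp; rewrite -(cos_norm s) -(cos_norm t) ltr_cos// in_itv/= normr_ge0. Qed.

Lemma sin_eq0_small t : `|t| < pi -> sin t = 0 -> t = 0.
Proof.
move=> tp st; apply/eqP; apply: contraPT tp => t0; apply/negP; rewrite -leNgt leNgt; apply/negP => tp.
have : 0 < sin `|t| by rewrite sin_gt0_pi// normr_gt0 t0.
by have [t1|t1] := leP 0 t; rewrite ?(ger0_norm t1) ?(ltr0_norm t1) ?sinN st ?oppr0 ltxx.
Qed.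

(** On $[-\pi,\pi]$ only the two endpoints share an image, and one strict bound excludes them. The
    weak bound on [y] is what the comparison with closed cells uses. *)
Lemma expi_inj_pi x y : `|x| < pi -> `|y| <= pi -> expi x = expi y -> x = y.
Proof.
move=> xp yp [cxy sxy].
have : `|x| = `|y|.
  by apply: cos_inj; rewrite ?in_itv/= ?normr_ge0 ?(ltW xp)// !cos_norm.
move/eqP; rewrite eqr_norm2 => /orP[|] /eqP // E.
have y0 : y = 0.
  apply: sin_eq0_small; first by rewrite -(opprK y) -E normrN.
  by move: sxy; rewrite E sinN => /eqP; rewrite -subr_eq0 -opprD oppr_eq0 -mulr2n mulrn_eq0 => /eqP.
by rewrite E y0 oppr0.
Qed.

Lemma sin_int_pi (k : int) : sin (k%:~R * pi) = 0 :> R.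
Proof.
have sn n : sin (n%:R * pi) = 0 :> R.
  elim: n => [|n IH]; first by rewrite mul0r sin0.
  by rewrite -natr1 mulrDl mul1r sinDpi IH oppr0.
case: k => n; first exact: sn.
by rewrite NegzE mulrNz mulNr sinN sn oppr0.
Qed.

Lemma sin_zeros t : sin t = 0 -> exists k : int, t = k%:~R * pi.
Proof.
move=> st; pose k := Num.floor (t / pi); exists k.
have /andP[k1 k2] := real_floor_itv (num_real (t / pi)).
have pp := pi_gt0 R.
move: k1 k2; rewrite -/k ler_pdivlMr// ltr_pdivrMr// intrD mulrDl mul1r => k1 k2.
apply/eqP; rewrite -subr_eq0; apply/eqP/sin_eq0_small.
  by rewrite ger0_norm ?subr_ge0// ltrBlDl.
by rewrite sinB st sin_int_pi mul0r mulr0 subrr.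
Qed.

(* The zero set of [Re (e^(-it) a)] is a translate of a subset of [pi Z]. *)
Lemma negligible_Re_expi (a : C) : a != 0 -> mu.-negligible [set t | Re (expi (- t) * a) = 0].
Proof.
move=> a0; have [[t0 h0]|h] := pselect (exists t, Re (expi (- t) * a) = 0); last first.
  rewrite (_ : [set t | _] = set0); first exact: negligible_set0.
  by apply/seteqP; split => // t ht; apply: h; exists t.
pose B := \bigcup_(k in [set: int]) [set (t0 + k%:~R * pi : R)].
have cB : countable B by apply: bigcup_countable => // *; exact: countable1.
exists B; split.
- by apply: countable_measurable => // r; exact: measurable_set1.
- exact: countable_lebesgue_measure0.
move=> t /= ht.
have [k hk] : exists k : int, t - t0 = k%:~R * pi.
  apply: sin_zeros; pose b := expi (- t0) * a.
  have Rb : Re b = 0 by [].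
  have Ib : Im b != 0.
    apply/eqP => Ib; move/eqP : a0; apply; apply: nsq_eq0.
    by rewrite -[LHS]mul1r -(nsq_expi (- t0)) -nsqM /nsq Rb Ib !expr0n /= addr0.
  move: ht; rewrite (_ : expi (- t) * a = expi (- (t - t0)) * b); last first.
    by rewrite /b mulrA -expiD; congr (expi _ * _); ring.
  rewrite cReM Rb mulr0 sub0r /= sinN mulNr opprK => /eqP.
  by rewrite mulf_eq0 (negbTE Ib) orbF => /eqP.
by exists k => //=; rewrite -hk addrC subrK.
Qed.

Lemma Rintegral_cosM (c a b : R) : c != 0 -> a < b ->
  \int[mu]_(x in `[a, b]) cos (c * x) = (sin (c * b) - sin (c * a)) / c.
Proof.
move=> c0 ab.
have D x : is_derive x 1 (fun x => c^-1 * sin (c * x)) (cos (c * x)).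
  by apply: is_derive_eq; rewrite /GRing.scale /= mulr1; field.
have cF : continuous (fun x => c^-1 * sin (c * x)).
  by move=> x; apply: differentiable_continuous; apply/derivable1_diffP; apply: ex_derive.
rewrite /Rintegral (@continuous_FTC2 _ _ (fun x => c^-1 * sin (c * x)))//.
- by rewrite -EFinB /= -mulrBr mulrC.
- apply: continuous_subspaceT => x.
  by apply: continuous_comp; [exact: mulrl_continuous|exact: continuous_cos].
- split => [x _||]; first exact: ex_derive.
  + by apply: cvg_at_right_filter; exact: cF.
  + by apply: cvg_at_left_filter; exact: cF.
- by move=> x _; rewrite derive1E derive_val.
Qed.

Lemma Rintegral_sinM (c a : R) : c != 0 -> 0 < a ->
  \int[mu]_(x in `[- a, a]) sin (c * x) = 0.
Proof.
move=> c0 a0.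
have D x : is_derive x 1 (fun x => - c^-1 * cos (c * x)) (sin (c * x)).
  by apply: is_derive_eq; rewrite /GRing.scale /= mulr1; field.
have cF : continuous (fun x => - c^-1 * cos (c * x)).
  by move=> x; apply: differentiable_continuous; apply/derivable1_diffP; apply: ex_derive.
rewrite /Rintegral (@continuous_FTC2 _ _ (fun x => - c^-1 * cos (c * x)))//.
- by rewrite -EFinB /= mulrN cosN subrr.
- by rewrite gtrN.
- apply: continuous_subspaceT => x.
  by apply: continuous_comp; [exact: mulrl_continuous|exact: continuous_sin].
- split => [x _||]; first exact: ex_derive.
  + by apply: cvg_at_right_filter; exact: cF.
  + by apply: cvg_at_left_filter; exact: cF.
- by move=> x _; rewrite derive1E derive_val.
Qed.

Lemma Rintegral_itv_cc (a b : R) (f : R -> R) : measurable_fun setT f ->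
  \int[mu]_(x in `]a, b[) f x = \int[mu]_(x in `[a, b]) f x.
Proof.
move=> mf; rewrite /Rintegral [in RHS]integral_itv_bndoo//.
by apply/measurable_EFinP; exact: measurable_funTS.
Qed.

Lemma cint_expi_window (c a : R) : 0 < a -> (c != 0 -> sin (c * a) = 0) ->
  cint (cutoff `]- a, a[ (fun x => expi (c * x))) = (if c == 0 then (a *+ 2)%:C else 0).
Proof.
move=> a0 hc; rewrite -cintegral_restrict /cintegral.
have [mc ms] := cmeas_expi c.
rewrite !Rintegral_itv_cc//; case: eqVneq => [->|c0].
  rewrite /real_complex_def; congr Complex.
    rewrite (@eq_Rintegral _ _ _ mu _ (fun=> 1)); last by move=> x _ /=; rewrite mul0r cos0.
    by rewrite Rintegral_cst//= lebesgue_measure_itv /= lte_fin gtrN// mul1r opprK mulr2n.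
  rewrite (@eq_Rintegral _ _ _ mu _ (fun=> 0)); last by move=> x _ /=; rewrite mul0r sin0.
  by rewrite Rintegral_cst// mul0r.
congr Complex => /=; last exact: Rintegral_sinM.
rewrite (Rintegral_cosM c0) ?gtrN//.
by rewrite mulrN sinN hc// oppr0 subrr mul0r.
Qed.

Section Tile.
Variables (J : finType) (X : J -> set R) (om : R) (z : J -> C).
Hypothesis om0 : 0 < om.
Hypothesis z1 : forall j, nsq (z j) = 1.
Hypothesis oX : forall j, open (X j).
(** Two values of [om] occur: 1 for the cells and rings of the cycle points, and $1/n$ for Fourier
    series on $]-n\pi, n\pi[$. *)
Definition wave (j : J) (x : R) : C := z j * expi (- (om * x)).
Hypothesis injw : forall j x j' x', X j x -> X j' x' -> wave j x = wave j' x' ->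
  j = j' /\ x = x'.

Lemma nsq_wave j x : nsq (wave j x) = 1.
Proof. by rewrite nsqM z1 nsq_expi mulr1. Qed.

Lemma cmeas_wave j : cmeas (wave j).
Proof.
apply: cmeasM; first exact: cmeas_cst.
by apply: (eq_cmeas _ (cmeas_expi (- om))) => x; rewrite mulNr.
Qed.

(** An arc of angular radius [om * r] below $\pi$ around [wave j0 x0] is the image of the ball of
    radius [r] around [x0], which lies in the open set [X j0]; by injectivity no other point of the
    tiles maps into it. The number $\delta = (1 - \cos(om\, r))/2$ is the value of [arcval] at that
    angle. *)
Lemma wave_local_arc j0 x0 : X j0 x0 -> exists2 r0, 0 < r0 &
  forall r, 0 < r < r0 -> exists2 delta, 0 < delta & forall j x, X j x ->
    (arcval (wave j0 x0) (wave j x) < delta) = (j == j0) && (`|x0 - x| < r).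
Proof.
move=> Xx0.
have [e /= e0 he] : nbhs_ball x0 (X j0) by apply/nbhs_ballP; exact: open_nbhs_nbhs.
exists (Num.min e (pi / om)); first by rewrite lt_min e0 divr_gt0// pi_gt0.
move=> r /andP[r0]; rewrite lt_min => /andP[re]; rewrite ltr_pdivlMr// mulrC => rp.
have or0 : 0 < om * r by rewrite mulr_gt0.
have rp' : `|om * r| <= pi by rewrite ger0_norm ltW.
exists ((1 - cos (om * r)) / 2).
  rewrite divr_gt0// subr_gt0 -[ltRHS](@cos0 R) lt_cos_norm// ?normr0 ?pi_ge0//.
  by rewrite normr_gt0 gt_eqF.
move=> j x Xx.
have u1 : nsq (wave j x * conjc (wave j0 x0)) = 1 by rewrite nsqM nsqJ !nsq_wave mulr1.
have [t tp ht] := angle_exists u1.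
have -> : (arcval (wave j0 x0) (wave j x) < (1 - cos (om * r)) / 2) = (`|t| < om * r).
  rewrite /arcval ht /= cosN ltr_pM2r ?invr_gt0// ltrD2l ltrN2 lt_cos_norm//.
  by rewrite (gtr0_norm or0).
(* The angle [t] between the two values is realized by moving from [x0] by [t / om]; [injw] then
   compares this point with [x]. *)
have E : wave j x = wave j0 (x0 + t / om).
  rewrite -[LHS]mulr1 -[1]/((1 : R)%:C) -(nsq_wave j0 x0) -nsqE.
  rewrite [wave j0 x0 * _]mulrC mulrA ht /wave mulrCA -expiD; congr (_ * expi _).
  by field; rewrite gt_eqF.
apply/idP/idP => [tr|/andP[/eqP jj xr]].
  have tr' : `|t / om| < r by rewrite normrM normfV (gtr0_norm om0) ltr_pdivrMr// mulrC.
  have Xt : X j0 (x0 + t / om).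
    apply: he; rewrite /ball /= opprD addrA subrr add0r normrN.
    exact: lt_trans tr' re.
  have [-> ->] := injw Xx Xt E; rewrite eqxx /=.
  by rewrite opprD addrA subrr add0r normrN.
have E2 : expi (om * (x - x0)) = expi t.
  move: E; rewrite /wave jj => /(mulfI (nsq1_neq0 (z1 j0))) /(congr1 (fun u => conjc u)).
  rewrite -!expiN !opprK => /(congr1 (fun u => u * expi (- (om * x0)))).
  rewrite -!expiD => E3; transitivity (expi (om * x - om * x0)); first by congr expi; ring.
  by rewrite E3; congr expi; field; rewrite gt_eqF.
have xr' : `|om * (x - x0)| < om * r by rewrite normrM (gtr0_norm om0) distrC ltr_pM2l.
rewrite -(@expi_inj_pi (om * (x - x0)) t)//.
exact: lt_trans xr' rp.
Qed.

Lemma tile_complete (g : J -> R -> C) : (forall j, cintg (g j)) ->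
  (forall j x, ~ X j x -> g j x = 0) ->
  (forall k : int, \sum_j cint (fun x => g j x * wave j x ^ k) = 0) ->
  forall j, {ae mu, forall x, g j x = 0}.
Proof.
move=> ig g0 mom.
exact: (circle_complete cmeas_wave nsq_wave ig g0 mom wave_local_arc).
Qed.

End Tile.
End Angles.

(** * The Fourier-Plancherel transform *)

Section Affine.
Variable R : realType.
Local Notation C := R[i].
Local Notation mu := (@lebesgue_measure R).
Variables (a b : R) (a0 : 0 < a).

Let phi (x : measurableTypeR R) : measurableTypeR R := a * x + b.

Let mphi : measurable_fun setT phi.
Proof. by apply: measurable_funD => //; exact: measurable_funM. Qed.

Let preimage_affine u v : phi @^-1` `]u, v]%classic = `](u - b) / a, (v - b) / a]%classic.
Proof.
apply/seteqP; split => x /=; rewrite !in_itv/= /phi.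
  by rewrite ltr_pdivrMr// ler_pdivlMr// ltrBlDr lerBrDr mulrC.
by rewrite ltr_pdivrMr// ler_pdivlMr// ltrBlDr lerBrDr mulrC.
Qed.

(** Uniqueness of Lebesgue measure: the rescaled pushforward gives every interval its length. *)
Lemma affine_measure (A : set R) : measurable A ->
  mu A = (a%:E * mu (phi @^-1` A))%E.
Proof.
move=> mA.
pose nu : {measure set (measurableTypeR R) -> \bar R} :=
  mscale (NngNum (ltW a0)) (measure_function_pushforward__canonical__measure_function_Measure mu mphi).
have := @lebesgue_measure_unique R nu _ A mA.
rewrite /nu /mscale /= /pushforward; apply => X [[u v]] _ <-.
rewrite /mscale /= /pushforward preimage_affine !lebesgue_measure_itv /=.
rewrite !lte_fin ltr_pM2r ?invr_gt0// ltrD2r.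
case: ifP => uv; last by rewrite mule0.
by rewrite -!EFinB -EFinM; congr EFin; field; rewrite gt_eqF.
Qed.

Lemma ge0_integral_affine (f : R -> \bar R) : measurable_fun setT f ->
  (forall x, 0 <= f x)%E ->
  (\int[mu]_x f x = a%:E * \int[mu]_x f (a * x + b)%R)%E.
Proof.
move=> mf f0.
have -> : (\int[mu]_x f (a * x + b)%R = \int[pushforward mu phi]_x f x)%E.
  by rewrite (ge0_integral_pushforward mphi).
rewrite -(ge0_integral_mscale (measure_function_pushforward__canonical__measure_function_Measure mu mphi) measurableT (NngNum (ltW a0)))//.
apply: eq_measure_integral => A mA _ /=.
by rewrite /mscale /= /pushforward; exact: affine_measure.
Qed.

Lemma measurable_affine (f : R -> \bar R) : measurable_fun setT f ->
  measurable_fun setT (fun x : R => f (a * x + b)%R).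
Proof. by move=> mf; exact: measurableT_comp mf mphi. Qed.

Lemma integrable_affine (f : R -> \bar R) : mu.-integrable setT f ->
  mu.-integrable setT (fun x => f (a * x + b)%R).
Proof.
move=> /integrableP[mf lf]; apply/integrableP; split; first exact: measurable_affine.
have := @ge0_integral_affine (fun x => `|f x|)%E; move/(_ (measurableT_comp _ mf)) => E.
move: lf; rewrite E//; set I := (\int[mu]_x _)%E => h.
rewrite ltey; apply/eqP => Iy; move: h.
by rewrite -[X in (_ * X)%E]/I Iy gt0_muley ?lte_fin// ltxx.
Qed.

Lemma Rintegral_affine (f : R -> R) : mu.-integrable setT (EFin \o f) ->
  \int[mu]_x f x = a * \int[mu]_x f (a * x + b).
Proof.
move=> intf; have [mf _] := integrableP _ _ _ intf.
have intg := integrable_affine intf.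
rewrite /Rintegral -[a]/(fine a%:E) -fineM//; last exact: (integrable_fin_num measurableT intg).
congr fine; rewrite integralE [in RHS]integralE muleBr//; last first.
  by apply: fin_num_adde_defr; exact: (integrable_pos_fin_num measurableT intg).
congr (_ - _)%E.
  rewrite (ge0_integral_affine (measurable_funepos mf))//; congr (_ * _)%E.
  apply: eq_integral => x _; transitivity (((EFin \o f)^\+ \o phi)%E x) => //.
  by rewrite -funepos_comp.
rewrite (ge0_integral_affine (measurable_funeneg mf))//; congr (_ * _)%E.
apply: eq_integral => x _; transitivity (((EFin \o f)^\- \o phi)%E x) => //.
by rewrite -funeneg_comp.
Qed.

Lemma cintg_affine (f : R -> C) : cintg f -> cintg (fun x => f (a * x + b)).
Proof.
move=> [rf jf]; split.
  exact: (integrable_affine (f := fun x => (Re (f x))%:E)).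
exact: (integrable_affine (f := fun x => (Im (f x))%:E)).
Qed.

Lemma cint_affine (f : R -> C) : cintg f ->
  cint f = a%:C * cint (fun x => f (a * x + b)).
Proof.
move=> [rf jf]; apply: ceqP; rewrite !ReImE /= mul0r ?subr0 ?addr0.
  exact: (Rintegral_affine (f := fun x => Re (f x))).
exact: (Rintegral_affine (f := fun x => Im (f x))).
Qed.

Lemma cmeas_affine (f : R -> C) : cmeas f -> cmeas (fun x => f (a * x + b)).
Proof. exact: cmeas_comp mphi. Qed.

Lemma n2_affine (f : R -> C) : cmeas f ->
  n2 f = (a%:E * n2 (fun x => f (a * x + b)%R))%E.
Proof.
move=> mf; rewrite /n2 (@ge0_integral_affine (fun x => (nsq (f x))%:E))//.
  by apply/measurable_EFinP; exact: measurable_nsq.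
by move=> x; rewrite lee_fin nsq_ge0.
Qed.

Lemma sqint_affine (f : R -> C) : f \in @sqint R -> (fun x => f (a * x + b)) \in @sqint R.
Proof.
move=> /sqintP[mf lf]; apply/sqintP; split; first exact: cmeas_affine.
move: lf; rewrite n2_affine// => h.
rewrite ltey; apply/eqP => Iy; move: h.
by rewrite Iy gt0_muley ?lte_fin// ltxx.
Qed.

Lemma ae_affine (P : R -> Prop) : {ae mu, forall x, P x} ->
  {ae mu, forall x, P (a * x + b)}.
Proof.
move=> [N [mN N0 subN]]; exists (phi @^-1` N); split.
- by rewrite -[X in measurable X]setTI; exact: mphi.
- have := affine_measure mN; rewrite N0 => /esym/eqP.
  by rewrite mule_eq0 eqe gt_eqF//= => /eqP.
- by move=> x /= nP; exact: subN.
Qed.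

End Affine.

(** * Square-integrable functions vanishing on a given set *)

Section Supported.
Variable R : realType.
Local Notation C := R[i].
Local Notation mu := (@lebesgue_measure R).
Local Notation L2 := (L2 R).
Local Notation d := (@L2_dot R).

Definition vanishes_on (A : set R) (f : R -> C) : Prop := {ae mu, forall x, A x -> f x = 0}.

Lemma vanishes_n2 (A : set R) (f : R -> C) : measurable A -> cmeas f ->
  vanishes_on A f <-> n2 (cutoff A f) = 0%E.
Proof.
move=> mA mf; have mc : cmeas (cutoff A f) by exact: cmeas_restrict.
split=> [h|/(n2_eq0 mc)]; last first.
  by apply: aeS => x; rewrite /cutoff => h Ax; rewrite mem_set in h.
have -> : n2 (cutoff A f) = n2 (fun=> 0 : C).
  apply: n2_ae => //.
  by apply: aeS h => x hx; rewrite /cutoff; case: ifP => // /set_mem /hx.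
rewrite /n2 (_ : (fun x => _) = cst 0%E) ?integral0//.
by apply/funext => x; rewrite nsq0.
Qed.

(** If [g] vanishes on [A], the norm of [f] over [A] is that of [f - g] over [A], hence at most the
    distance from [f] to [g]. *)
Lemma vanishes_closed (A : set R) : measurable A ->
  closed_subspace d [set f : L2 | vanishes_on A f].
Proof.
move=> mA; split.
- by rewrite /= /vanishes_on; apply: aeS (@L2_0E R) => x.
- move=> a f g /= hf hg; have h : {ae mu, forall x, A x -> a * (f : L2) x + (g : L2) x = 0}.
    by apply: aeS2 hf hg => x h1 h2 Ax; rewrite h1// h2// mulr0 addr0.
  by apply: aeS2 (L2_scaleDE a f g) h => x -> h2 Ax; rewrite h2.
move=> f /hclosureP hf /=; apply/vanishes_n2 => //; first exact: L2_cmeas.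
apply/eqP; rewrite eq_le n2_ge0 andbT.
apply/lee_addgt0Pr => e e0; rewrite add0e.
have [g /= hg fg] := hf e e0.
apply: (@le_trans _ _ (n2 (cutoff A (fun x => (f : L2) x - (g : L2) x)))).
  rewrite (@n2_ae _ (cutoff A (L2_fun f)) (cutoff A (fun x => (f : L2) x - (g : L2) x)))//.
  - by apply: cmeas_restrict => //; exact: L2_cmeas.
  - by apply: cmeas_restrict => //; apply: cmeasB; exact: L2_cmeas.
  - by apply: aeS hg => x h; rewrite /cutoff; case: ifP => // /set_mem/h ->; rewrite subr0.
apply: (@le_trans _ _ (n2 (fun x => (f : L2) x - (g : L2) x))).
  apply: n2_mono.
  - by apply: cmeas_restrict => //; apply: cmeasB; exact: L2_cmeas.
  - by apply: cmeasB; exact: L2_cmeas.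
  - by move=> x; rewrite /cutoff; case: ifP => // _; rewrite nsq0 nsq_ge0.
by rewrite -L2_sqnBE lee_fin ltW.
Qed.

End Supported.

(** * Plancherel's identity for compactly supported functions *)

Section CompactPlancherel.
Variable R : realType.
Local Notation C := R[i].
Local Notation mu := (@lebesgue_measure R).
Local Notation L2 := (L2 R).
Local Notation d := (@L2_dot R).

Definition ft (u : R -> C) (xi : R) : C := cint (fun x => u x * expi (- (xi * x))).

Lemma truncated_fourierE (f : L2) n :
  truncated_fourier f n = ft (cutoff (`[- n%:R, n%:R]%classic : set R) (L2_fun f)).
Proof.
apply/funext => xi; rewrite /truncated_fourier cintegral_restrict; apply: eq_cint => x.
by rewrite /cutoff; case: ifP; rewrite ?mul0r.
Qed.

Lemma cmeas_expiN (xi : R) : cmeas (fun x : R => expi (- (xi * x))).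
Proof. by apply: (eq_cmeas _ (cmeas_expi (- xi))) => x; rewrite mulNr. Qed.

Lemma cintg_ft (u : R -> C) xi : cintg u -> cintg (fun x => u x * expi (- (xi * x))).
Proof.
move=> iu; apply: (@cintg_bounded _ _ _ 1) => //; first exact: cmeas_expiN.
by move=> x; rewrite nsq_expi.
Qed.

(** The transform is continuous, by dominated convergence with bound $|\mathrm{Re} u| + |\mathrm{Im}
    u|$. *)
Lemma cmeas_ft (u : R -> C) : cintg u -> cmeas (ft u).
Proof.
move=> iu; have [ru ju] := iu.
pose b (x : R) : R := `|Re (u x)| + `|Im (u x)|.
have ib : mu.-integrable setT (EFin \o b).
  have := integrableD measurableT (integrable_abse ru) (integrable_abse ju).
  by apply: eq_integrable.
have key (T : C -> R) : (forall x : R, continuous (fun xi : R => T (u x * expi (- (xi * x))))) ->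
    (forall xi : R, mu.-integrable setT (EFin \o (fun x => T (u x * expi (- (xi * x)))))) ->
    (forall xi x : R, `|T (u x * expi (- (xi * x)))| <= b x) ->
    measurable_fun setT (fun xi : R => \int[mu]_x T (u x * expi (- (xi * x)))).
  move=> cT iT bT; apply: continuous_measurable_fun => xi0.
  apply: (@continuity_under_integral R _ _ mu (fun (xi x : R) => T (u x * expi (- (xi * x))))
    setT measurableT (xi0 - 1) (xi0 + 1) _ _ b ib _ xi0).
  - by move=> xi _; exact: iT.
  - by apply: aeW => x _ xi _; exact: cT.
  - by move=> xi _; apply: aeW => x _; exact: bT.
  - by rewrite inE /= in_itv /= gtrBl ltrDl ltr01.
have cc (x : R) : continuous (fun xi : R => cos (- (xi * x))).
  move=> xi; apply: continuous_comp; last exact: continuous_cos.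
  by apply: continuousN; exact: mulrr_continuous.
have cs (x : R) : continuous (fun xi : R => sin (- (xi * x))).
  move=> xi; apply: continuous_comp; last exact: continuous_sin.
  by apply: continuousN; exact: mulrr_continuous.
have ble (p q s t : R) : `|s| <= 1 -> `|t| <= 1 -> `|p * s + q * t| <= `|p| + `|q|.
  move=> s1 t1; rewrite (le_trans (ler_normD _ _))// !normrM lerD//.
    by rewrite ler_piMr.
  by rewrite ler_piMr.
split; apply: key.
- move=> x xi; rewrite (_ : (fun xi => _) =
    (fun xi : R => Re (u x) * cos (- (xi * x)) - Im (u x) * sin (- (xi * x)))); last first.
    by apply/funext => t; rewrite cReM.
  by apply: cvgB; apply: cvgMl_tmp; [exact: cc|exact: cs].
- by move=> xi; have [] := cintg_ft xi iu.
- by move=> xi x; rewrite cReM /= -[- (Im _ * _)]mulNr (le_trans (ble _ _ _ _ (cos_max _) (sin_max _)))// normrN.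
- move=> x xi; rewrite (_ : (fun xi => _) =
    (fun xi : R => Re (u x) * sin (- (xi * x)) + Im (u x) * cos (- (xi * x)))); last first.
    by apply/funext => t; rewrite cImM.
  by apply: cvgD; apply: cvgMl_tmp; [exact: cs|exact: cc].
- by move=> xi; have [] := cintg_ft xi iu.
- by move=> xi x; rewrite cImM /= (le_trans (ble _ _ _ _ (sin_max _) (cos_max _))).
Qed.

Lemma L2_dot_class2 (u v : R -> C) : u \in @sqint R -> v \in @sqint R ->
  d (L2_class u) (L2_class v) = cint (fun x => u x * conjc (v x)).
Proof.
move=> su sv; rewrite L2_dot_class//; apply: ae_eq_cint.
- by apply: cmeasM; [exact: L2_cmeas|apply: cmeasJ; exact: sqint_cmeas].
- by apply: cmeasM; [exact: sqint_cmeas|apply: cmeasJ; exact: sqint_cmeas].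
- by apply: aeS (L2_classE su) => x ->.
Qed.

Variables (n : nat) (u : R -> C).
Hypothesis n0 : (0 < n)%N.
Hypothesis su : u \in @sqint R.
Hypothesis u0 : forall x, ~ (`[- n%:R, n%:R]%classic : set R) x -> u x = 0.

Let nR : 0 < n%:R :> R. Proof. by rewrite ltr0n. Qed.
(** The exponentials with frequencies in $\frac1n\mathbb{Z} + s$ are orthogonal on an interval of
    length $2\pi n$, and $]-\pi n, \pi n[$ contains the support $[-n, n]$. *)
Let a : R := pi * n%:R.
Let a0 : 0 < a. Proof. by rewrite mulr_gt0// pi_gt0. Qed.
Let W : set R := `]- a, a[%classic.
Let mW : measurable W. Proof. exact: measurable_itv. Qed.
Let lW : (mu W < +oo)%E.
Proof. by rewrite /W lebesgue_measure_itv /=; case: ifP => _; rewrite ?ltry. Qed.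
Let c : R := (Num.sqrt (a *+ 2))^-1.
Let c2 : c ^+ 2 = (a *+ 2)^-1.
Proof. by rewrite exprVn sqr_sqrtr// mulrn_wge0// ltW. Qed.

Lemma cintg_compact : cintg u.
Proof.
have := @sqint_cintg _ (`[- n%:R, n%:R]%classic : set R) u (measurable_itv _) _ su.
rewrite (_ : cutoff _ u = u); last first.
  apply/funext => x; rewrite /cutoff; case: ifPn => // /negP xn.
  by rewrite u0// => xm; apply: xn; exact: mem_set.
by apply; rewrite lebesgue_measure_itv /=; case: ifP => _; rewrite ?ltry.
Qed.

Let nW x : (`[- n%:R, n%:R]%classic : set R) x -> W x.
Proof.
have h : n%:R < a by rewrite /a ltr_pMl// (lt_le_trans _ (pi_ge2 R))// ltr1n.
rewrite /W /= !in_itv /= => /andP[x1 x2].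
by rewrite (lt_le_trans _ x1) ?ltrN2//= (le_lt_trans x2).
Qed.

Section Shift.
Variable s : R.
Let freq (k : int) : R := k%:~R / n%:R + s.
Let ef (k : int) (x : R) : C := c%:C * cutoff W (fun x => expi (freq k * x)) x.
Let e (k : int) : L2 := L2_class (ef k).

Let sef k : ef k \in @sqint R.
Proof.
rewrite (_ : ef k = fun x => (c%:C * expi (freq k * x)) * (\1_W x)%:C).
  apply: (@sqint_bounded _ _ _ (c ^+ 2)); first exact: sqint_indic.
    by apply: cmeasM; [exact: cmeas_cst|exact: cmeas_expi].
  by move=> x; rewrite nsqM nsqR nsq_expi mulr1.
apply/funext => x; rewrite /ef /cutoff indicE; case: ifP => _; by rewrite ?mulr1 ?mulr0.
Qed.

Let e_orth k l : d (e k) (e l) = (k == l)%:R.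
Proof.
rewrite L2_dot_class2//.
have E x : ef k x * conjc (ef l x) =
    (c ^+ 2)%:C * cutoff W (fun x => expi ((k - l)%:~R / n%:R * x)) x.
  rewrite /ef /cutoff; case: ifP => _; last by rewrite !mulr0 mul0r.
  rewrite cJM cJR mulrACA -rCM -expr2 -expiN -expiD; congr (_ * expi _).
  by rewrite /freq rmorphB /=; ring.
rewrite (eq_cint E) cintZ; last first.
  by apply: (@cintg_cutoff _ _ _ 1) => //; [exact: cmeas_expi|move=> x; rewrite nsq_expi].
have nn0 : n%:R != 0 :> R by rewrite gt_eqF.
rewrite cint_expi_window//; last first.
  move=> _; rewrite (_ : _ * a = (k - l)%:~R * pi) ?sin_int_pi// /a.
  by move: (_%:~R) => r; field.
rewrite mulf_eq0 invr_eq0 (negbTE nn0) orbF intr_eq0 subr_eq0; case: eqP => _; last by rewrite mulr0.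
by rewrite -rCM c2 mulVf// mulrn_eq0/= gt_eqF.
Qed.

Let V : set L2 := [set g | vanishes_on (~` W) (L2_fun g)].

Let cV : closed_subspace d V.
Proof. by apply: vanishes_closed; exact: measurableC. Qed.

Let Ve k : V (e k).
Proof.
rewrite /V /=; apply: aeS (L2_classE (sef k)) => x -> nWx.
by rewrite /ef /cutoff memNset// mulr0.
Qed.

Let total g : V g -> (forall k, d g (e k) = 0) -> g = 0.
Proof.
move=> Vg ge.
(* Modulation by $e^{-isx}$ absorbs the shift [s], leaving the integer powers of a single wave on
   the single tile [W]. *)
pose h (x : R) : C := cutoff W (fun x => L2_fun g x * expi (- (s * x))) x.
have ih : cintg h.
  rewrite (_ : h = fun x => cutoff W (L2_fun g) x * expi (- (s * x))).
    by apply: cintg_ft; apply: sqint_cintg => //; exact: L2_sqint.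
  by apply/funext => x; rewrite /h /cutoff; case: ifP; rewrite ?mul0r.
have h0 : {ae mu, forall x, h x = 0}.
  apply: (@tile_complete R unit (fun=> W) (n%:R^-1) (fun=> 1) _ _ _ _ (fun=> h) _ _ _ tt).
  - by rewrite invr_gt0.
  - by move=> _; rewrite nsq1.
  - by move=> _; exact: interval_open.
  - move=> [] x [] y; rewrite /W /= !in_itv /= => /andP[x1 x2] /andP[y1 y2].
    rewrite /wave !mul1r => E; split => //.
    have hx t : - a < t -> t < a -> `|- (n%:R^-1 * t)| < pi.
      by move=> t1 t2; rewrite normrN normrM gtr0_norm ?invr_gt0// mulrC ltr_pdivrMr// ltr_norml t1.
    have := expi_inj_pi (hx x x1 x2) (ltW (hx y y1 y2)) E.
    by move/oppr_inj/mulfI; apply; rewrite invr_eq0 gt_eqF.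
  - by [].
  - by move=> _ x nWx; rewrite /h /cutoff memNset.
  move=> k; rewrite (bigD1 tt)//= big1 ?addr0; last by case.
  have := ge k; rewrite L2_dot_class//.
  have E x : L2_fun g x * conjc (ef k x) =
      c%:C * (h x * wave n%:R^-1 (fun=> 1) tt x ^ k).
    rewrite /ef /h /cutoff /wave; case: ifP => _; last by rewrite mulr0 cJ0 !mul0r !mulr0.
    rewrite cJM cJR mul1r expi_exprz -!mulrA -expiD mulrCA -expiN; congr (_ * (_ * expi _)).
    by rewrite /freq; ring.
  rewrite (eq_cint E) cintZ; last first.
    apply: (@cintg_bounded _ _ _ 1) => //.
      apply: cmeas_exprz; first by apply: cmeas_wave => _; rewrite nsq1.
      by move=> x; apply: nsq_wave => _; rewrite nsq1.
    by move=> x; rewrite nsq1_exprz//; apply: nsq_wave => _; rewrite nsq1.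
  move/eqP; rewrite mulf_eq0 => /orP[/eqP[c0]|/eqP//].
  have : c ^+ 2 = 0 by rewrite c0 expr0n.
  by rewrite c2 => /eqP; rewrite invr_eq0 mulrn_eq0/= gt_eqF.
apply/L2_eqP; have h2 : {ae mu, forall x, L2_fun g x = 0}.
  apply: aeS2 h0 Vg => x; rewrite /h /cutoff; case: ifPn => [xW hx _|/negP xW _ gx].
    move/eqP : hx; rewrite mulf_eq0 => /orP[/eqP//|]; rewrite (negbTE (nsq1_neq0 _))//.
    exact: nsq_expi.
  by apply: gx => xW'; apply: xW; exact: mem_set.
by apply: aeS2 h2 (@L2_0E R) => x -> ->.
Qed.

Lemma parseval_shift :
  (\sum_(m <oo) (if pickle_inv m is Some k then nsq (ft u (k%:~R / n%:R + s)) else 0)%:E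
   = (a *+ 2)%:E * n2 u)%E.
Proof.
have Vu : V (L2_class u).
  rewrite /V /=; apply: aeS (L2_classE su) => x -> nWx; apply: u0 => xn; apply: nWx; exact: nW.
have p := parseval e_orth (@L2_complete R) cV Ve total Vu.
have E k : nsq (d (L2_class u) (e k)) = (a *+ 2)^-1 * nsq (ft u (freq k)).
  rewrite L2_dot_class2// -c2 -nsqR -nsqM -cintZ; last exact: cintg_ft cintg_compact.
  congr nsq; apply: eq_cint => x; rewrite /ef /cutoff; case: ifPn => xW.
    by rewrite cJM cJR expiN; ring.
  rewrite mulr0 cJ0 mulr0 u0 ?mul0r ?mulr0// => xn; move/negP : xW; apply.
  by apply/mem_set/nW.
pose G m : R := if pickle_inv m is Some k then nsq (ft u (k%:~R / n%:R + s)) else 0.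
have a2 : a *+ 2 != 0 by rewrite mulrn_eq0/= gt_eqF.
have EG m : nsq (d (L2_class u) (seq_basis e m)) = (a *+ 2)^-1 * G m.
  by rewrite /seq_basis /G; case: (pickle_inv m) => [k|]; rewrite ?E// dot0r nsq0 mulr0.
have p2 : \sum_(m < N) G m @[N --> \oo] --> a *+ 2 * sqn d (L2_class u).
  rewrite (_ : (fun N => _) = (fun N => (a *+ 2) * \sum_(m < N) nsq (d (L2_class u) (seq_basis e m)))).
    exact: cvgMl_tmp.
  apply/funext => N; rewrite mulr_sumr; apply: eq_bigr => m _.
  by rewrite EG mulrA mulfV// mul1r.
rewrite -(sqn_L2_class su) -EFinM; apply/cvg_lim => //.
rewrite (_ : (fun N => _) = EFin \o (fun N => \sum_(m < N) G m)).
  by apply: cvg_EFin; [exact: nearW|exact: p2].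
by apply/funext => N /=; rewrite big_mkord sumEFin.
Qed.

End Shift.

Let block (m : nat) : set R :=
  if pickle_inv m is Some k then `[k%:~R / n%:R, (k + 1)%:~R / n%:R[%classic else set0.

Let block_cover : \bigcup_m block m = setT.
Proof.
apply/seteqP; split => // x _; pose k : int := Num.floor (x * n%:R).
exists (pickle k); first exact: I.
rewrite /block (pickleK_inv k) /= in_itv /=.
have /andP[k1 k2] := real_floor_itv (num_real (x * n%:R)).
by rewrite ler_pdivrMr// ltr_pdivlMr// k1.
Qed.

Let block_triv : trivIset setT block.
Proof.
apply/trivIsetP => i j _ _ ij; rewrite -subset0 => x [].
rewrite /block; case Ei : (pickle_inv i) => [k|] //; case Ej : (pickle_inv j) => [l|] //.
rewrite /= !in_itv /= !ler_pdivrMr// !ltr_pdivlMr// => /andP[k1 k2] /andP[l1 l2].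
have kl : k = l.
  apply/eqP; rewrite eq_le -!ltzD1 -!(ltr_int R).
  by rewrite (le_lt_trans k1 l2) (le_lt_trans l1 k2).
have := @pickle_invK int i; have := @pickle_invK int j.
by rewrite Ei Ej /= kl => lj li; move: ij; rewrite -lj -li eqxx.
Qed.

(* The frequencies [k / n + s], [k] an integer, run once through the line as [s] runs through
   [0 <= s < 1 / n]. *)
Lemma plancherel_compact : n2 (ft u) = ((pi *+ 2)%:E * n2 u)%E.
Proof.
have mft := cmeas_ft cintg_compact.
have mn : measurable_fun setT (fun xi => (nsq (ft u xi))%:E).
  by apply/measurable_EFinP; exact: measurable_nsq.
pose I : set R := `[0, n%:R^-1[%classic.
have mI : measurable I by exact: measurable_itv.
pose G m (s : R) : R := if pickle_inv m is Some k then nsq (ft u (k%:~R / n%:R + s)) else 0.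
have mG m : measurable_fun setT (fun s => (G m s)%:E).
  rewrite /G; case: (pickle_inv m) => [k|]; last exact: measurable_cst.
  have := @measurable_affine R 1 (k%:~R / n%:R) _ mn.
  by under eq_fun do rewrite mul1r addrC.
transitivity (\int[mu]_(x in \bigcup_m block m) (nsq (ft u x))%:E)%E.
  by rewrite block_cover.
rewrite ge0_integral_bigcup//; last 3 first.
- by move=> m; rewrite /block; case: (pickle_inv m) => [k|] //; exact: measurable_itv.
- by rewrite block_cover.
- by move=> x _; rewrite lee_fin nsq_ge0.
transitivity (\sum_(m <oo) \int[mu]_(s in I) (G m s)%:E)%E.
  apply: eq_eseriesr => m _; rewrite /block /G; case: (pickle_inv m) => [k|]; last first.
    by rewrite integral_set0 integral0.
  rewrite integral_mkcond [RHS]integral_mkcond.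
  rewrite (@ge0_integral_affine R 1 (k%:~R / n%:R) ltr01); last 2 first.
  - by apply: (iffLR (measurable_restrictT _ (measurable_itv _))); exact: measurable_funTS.
  - by move=> x; rewrite /patch; case: ifP => // _; rewrite lee_fin nsq_ge0.
  rewrite mul1e; apply: eq_integral => s _; rewrite mul1r /patch.
  rewrite [s + _]addrC (_ : (_ \in _) = (s \in I))//.
  apply/idP/idP => /set_mem /= h; apply/mem_set; move: h; rewrite /I /= !in_itv /=;
    by rewrite lerDl -ltrBrDl rmorphD /= -mulrBl [_ + 1]addrC addrK mul1r.
rewrite -integral_nneseries//; last 2 first.
- by move=> m; exact: measurable_funTS (mG m).
- by move=> m s _; rewrite lee_fin /G; case: (pickle_inv m) => [k|] //; exact: nsq_ge0.
rewrite (eq_integral (fun=> (a *+ 2)%:E * n2 u)%E); last by move=> s _; exact: parseval_shift.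
(* The shifts fill an interval of length $1/n$, on which the integrand is the constant $2\pi n$
   times [n2 u]; this leaves the factor $2\pi$. *)
have muI : mu I = (n%:R^-1)%:E.
  by rewrite /I lebesgue_measure_itv /= lte_fin invr_gt0 nR ?sube0 ?subr0.
rewrite -(sqn_L2_class su) -EFinM integral_cst//.
rewrite [X in (_ * X)%E](_ : _ = (n%:R^-1)%:E)//.
by rewrite -!EFinM; congr EFin; rewrite /a; field; rewrite gt_eqF.
Qed.

End CompactPlancherel.

(** * Fubini's theorem and the multiplication formula *)

Section ComplexFubini.
Variable R : realType.
Local Notation C := R[i].
Local Notation mu := (@lebesgue_measure R).

Lemma integrable_tensor (b c : R -> R) : (forall x, 0 <= b x) -> (forall y, 0 <= c y) ->
  mu.-integrable setT (EFin \o b) -> mu.-integrable setT (EFin \o c) ->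
  (mu \x mu)%E.-integrable setT (fun z : R * R => (b z.1 * c z.2)%:E).
Proof.
move=> b0 c0 ib ic.
have mb : measurable_fun setT b by apply/measurable_EFinP; exact: measurable_int ib.
have mc : measurable_fun setT c by apply/measurable_EFinP; exact: measurable_int ic.
apply/integrable12ltyP.
  apply/measurable_EFinP; apply: measurable_funM.
    exact: measurableT_comp mb measurable_fst.
  exact: measurableT_comp mc measurable_snd.
have -> : (\int[mu]_x \int[mu]_y `|(b x * c y)%:E| =
    (\int[mu]_x (b x)%:E) * (\int[mu]_y (c y)%:E))%E.
  have E x : (\int[mu]_y `|(b x * c y)%:E| = (b x)%:E * \int[mu]_y (c y)%:E)%E.
    have := integralZl measurableT ic (b x) => <-.
    by apply: eq_integral => y _; rewrite /= ger0_norm ?mulr_ge0.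
  under eq_integral do rewrite E muleC.
  have f2 : (\int[mu]_x (c x)%:E)%E \is a fin_num by exact: integrable_fin_num ic.
  rewrite -(fineK f2); have := integralZl measurableT ib (fine (\int[mu]_x (c x)%:E)) => ->.
  by rewrite muleC.
have f1 : (\int[mu]_x (b x)%:E)%E \is a fin_num by exact: integrable_fin_num ib.
have f2 : (\int[mu]_x (c x)%:E)%E \is a fin_num by exact: integrable_fin_num ic.
by rewrite ltey_eq fin_numM.
Qed.

(** The bound by a product $b(x) c(y)$ of integrable functions yields integrability over the
    plane. *)
Lemma cint_fubini (K : R -> R -> C) (b c : R -> R) :
  cmeas (fun z : R * R => K z.1 z.2) ->
  (forall x, 0 <= b x) -> (forall y, 0 <= c y) ->
  mu.-integrable setT (EFin \o b) -> mu.-integrable setT (EFin \o c) ->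
  (forall x y, nsq (K x y) <= (b x * c y) ^+ 2) ->
  (forall x, cintg (K x)) -> (forall y, cintg (fun x => K x y)) ->
  cint (fun x => cint (K x)) = cint (fun y => cint (fun x => K x y)).
Proof.
move=> [mr mj] b0 c0 ib ic hK i1 i2.
have key (T : C -> R) : measurable_fun setT (fun z : R * R => T (K z.1 z.2)) ->
    (forall w, T w ^+ 2 <= nsq w) ->
    (forall x, mu.-integrable setT (fun y => (T (K x y))%:E)) ->
    (forall y, mu.-integrable setT (fun x => (T (K x y))%:E)) ->
    \int[mu]_x \int[mu]_y T (K x y) = \int[mu]_y \int[mu]_x T (K x y).
  move=> mT Tn j1 j2.
  have iT : (mu \x mu)%E.-integrable setT (fun z : R * R => (T (K z.1 z.2))%:E).
    apply: (le_integrable measurableT _ _ (integrable_tensor b0 c0 ib ic)).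
      exact/measurable_EFinP.
    move=> [x y] _ /=; rewrite lee_fin [leRHS]ger0_norm ?mulr_ge0//.
    rewrite -ler_sqr ?nnegrE ?mulr_ge0// real_normK ?num_real//.
    exact: le_trans (Tn _) (hK x y).
  rewrite /Rintegral; congr fine.
  transitivity (\int[mu]_x \int[mu]_y (T (K x y))%:E)%E.
    by apply: eq_integral => x _; rewrite fineK//; exact: integrable_fin_num.
  rewrite (Fubini iT).
  by apply: eq_integral => y _; rewrite fineK//; exact: integrable_fin_num.
apply: ceqP => /=.
  by apply: key => // [w|x|y]; [rewrite lerDl sqr_ge0|case: (i1 x)|case: (i2 y)].
by apply: key => // [w|x|y]; [rewrite lerDr sqr_ge0|case: (i1 x)|case: (i2 y)].
Qed.

(** The kernel $e^{-i\xi x}$ is symmetric in its two variables, so exchanging the integrals moves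
    the transform from one factor to the other. *)
Lemma ft_sym (u v : R -> C) : cintg u -> cintg v ->
  cint (fun xi => ft u xi * v xi) = cint (fun x => u x * ft v x).
Proof.
move=> iu iv.
have mu' := cintg_cmeas iu; have mv := cintg_cmeas iv.
pose ab (w : R -> C) x : R := `|Re (w x)| + `|Im (w x)|.
have iab w : cintg w -> mu.-integrable setT (EFin \o ab w).
  move=> [rw jw]; have := integrableD measurableT (integrable_abse rw) (integrable_abse jw).
  by apply: eq_integrable.
have ab0 w x : 0 <= ab w x by rewrite addr_ge0.
have nab w x : nsq (w x) <= ab w x ^+ 2.
  rewrite /nsq /ab -(real_normK (num_real (Re (w x)))) -(real_normK (num_real (Im (w x)))).
  by have := normr_ge0 (Re (w x)); have := normr_ge0 (Im (w x)); nra.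
have me : cmeas (fun z : R * R => expi (- (z.1 * z.2)) : C).
  have m2 : measurable_fun setT (fun z : R * R => - (z.1 * z.2)).
    apply: measurableT_comp => //; apply: measurable_funM.
      exact: measurable_fst.
    exact: measurable_snd.
  split.
    exact: (measurableT_comp (continuous_measurable_fun (@continuous_cos R)) m2).
  exact: (measurableT_comp (continuous_measurable_fun (@continuous_sin R)) m2).
have i1 xi : cintg (fun x => u x * expi (- (xi * x)) * v xi).
  apply: (eq_cintg (fun x => mulrC (v xi) _)); apply: cintgZ; exact: cintg_ft.
have i2 x : cintg (fun xi => u x * expi (- (xi * x)) * v xi).
  apply: (@eq_cintg _ (fun xi => u x * (v xi * expi (- (x * xi))))).
    by move=> xi; rewrite [x * xi]mulrC; ring.
  by apply: cintgZ; exact: cintg_ft.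
transitivity (cint (fun xi => cint (fun x => u x * expi (- (xi * x)) * v xi))).
  apply: eq_cint => xi; rewrite /ft mulrC -cintZ; last exact: cintg_ft.
  by apply: eq_cint => x; rewrite mulrC.
rewrite (@cint_fubini (fun xi x => u x * expi (- (xi * x)) * v xi) (ab v) (ab u))//.
- apply: eq_cint => x; rewrite /ft -cintZ; last exact: cintg_ft.
  by apply: eq_cint => xi; rewrite [x * xi]mulrC; ring.
- apply: cmeasM; last exact: cmeas_comp measurable_fst mv.
  by apply: cmeasM => //; exact: cmeas_comp measurable_snd mu'.
- exact: iab.
- exact: iab.
- move=> xi x; rewrite !nsqM nsq_expi mulr1 exprMn mulrC.
  by apply: ler_pM; rewrite ?nsq_ge0.
Qed.

End ComplexFubini.

(** * Extension of the transform to L2 *)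

Section Fourier.
Variable R : realType.
Local Notation C := R[i].
Local Notation mu := (@lebesgue_measure R).
Local Notation L2 := (L2 R).
Local Notation d := (@L2_dot R).
Implicit Types f g : L2.

Definition window (n : nat) : set R := `[- n%:R, n%:R]%classic.
Definition truncf f n : R -> C := cutoff (window n) (L2_fun f).
(** The index is shifted by one here and in [fourierN] because Plancherel on a window is stated for
    $n > 0$. *)
Definition truncL2 f n : L2 := L2_class (truncf f n.+1).
Definition fourierN f n : L2 := L2_class (truncated_fourier f n.+1).

Lemma window_fin n : (mu (window n) < +oo)%E.
Proof. by rewrite /window lebesgue_measure_itv /=; case: ifP => _; rewrite ?ltry. Qed.

Lemma measurable_window n : measurable (window n).
Proof. exact: measurable_itv. Qed.

Lemma sqint_truncf f n : truncf f n \in @sqint R.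
Proof. by apply: sqint_restrict; [exact: measurable_window|exact: L2_sqint]. Qed.

Lemma truncf0 f m n x : (m <= n)%N -> ~ (window n) x -> truncf f m x = 0.
Proof.
move=> mn nx; rewrite /truncf /cutoff memNset// => xm; apply: nx; move: xm.
rewrite /window /= !in_itv /= => /andP[x1 x2]; rewrite (le_trans x2) ?ler_nat// andbT.
by rewrite (le_trans _ x1)// lerN2 ler_nat.
Qed.

Lemma cintg_truncf f n : cintg (truncf f n).
Proof.
by apply: sqint_cintg; [exact: measurable_window|exact: window_fin|exact: L2_sqint].
Qed.

Lemma sqint_ft (u : R -> C) n : (0 < n)%N -> u \in @sqint R ->
  (forall x, ~ window n x -> u x = 0) -> ft u \in @sqint R.
Proof.
move=> n0 su u0; apply/sqintP; split; first exact: cmeas_ft (cintg_compact su u0).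
rewrite (plancherel_compact n0 su u0) lte_mul_pinfty//.
  by rewrite lee_fin mulrn_wge0// pi_ge0.
exact: sqint_n2.
Qed.

Lemma sqint_fourierN f n : truncated_fourier f n.+1 \in @sqint R.
Proof.
rewrite truncated_fourierE; apply: (@sqint_ft _ n.+1) => //; first exact: sqint_truncf.
by move=> x; exact: truncf0.
Qed.

Lemma L2_classB (u v : R -> C) : u \in @sqint R -> v \in @sqint R ->
  L2_class u - L2_class v = L2_class (fun x => u x - v x).
Proof.
move=> su sv; apply/L2_eqP.
have suv : (fun x => u x - v x) \in @sqint R by exact: (rpredB su sv).
have h := aeS2 (fun x (h1 : L2_class u x = u x) (h2 : L2_class v x = v x) =>
  congr2 (fun a b => a - b) h1 h2) (L2_classE su) (L2_classE sv).
apply: aeS2 (L2_classE suv) (aeS2 (fun x h1 h2 => etrans h1 h2) (L2_BE (L2_class u) (L2_class v)) h).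
by move=> x -> ->.
Qed.

Lemma fourierN_diff f m n : (m <= n)%N ->
  sqn d (fourierN f n - fourierN f m) = pi *+ 2 * sqn d (truncL2 f n - truncL2 f m).
Proof.
move=> mn; apply: EFin_inj; rewrite EFinM.
rewrite !L2_classB ?sqint_fourierN ?sqint_truncf//.
have s1 : (fun x => truncf f n.+1 x - truncf f m.+1 x) \in @sqint R.
  exact: (rpredB (sqint_truncf f n.+1) (sqint_truncf f m.+1)).
have s2 : (fun x => truncated_fourier f n.+1 x - truncated_fourier f m.+1 x) \in @sqint R.
  exact: (rpredB (sqint_fourierN f n) (sqint_fourierN f m)).
rewrite !sqn_L2_class//.
rewrite -(@plancherel_compact R n.+1)//; last by move=> x nx; rewrite !(@truncf0 _ _ n.+1)// subrr.
congr n2; apply/funext => xi; rewrite !truncated_fourierE /ft -cintB.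
- by apply: eq_cint => x; rewrite mulrBl.
- by apply: cintg_ft; exact: cintg_truncf.
- by apply: cintg_ft; exact: cintg_truncf.
Qed.

Lemma truncL2_hlim f : hlim d (truncL2 f) f.
Proof.
pose D n x : C := truncf f n.+1 x - L2_fun f x.
have mD n : cmeas (D n) by apply: cmeasB; [exact: sqint_cmeas (sqint_truncf f n.+1)|exact: L2_cmeas].
have E n : (sqn d (truncL2 f n - f))%:E = n2 (D n).
  rewrite L2_sqnBE; apply: n2_ae => //.
    by apply: cmeasB; exact: L2_cmeas.
  by apply: aeS (L2_classE (sqint_truncf f n.+1)) => x ->.
have DE n x : D n x = if x \in window n.+1 then 0 else - L2_fun f x.
  by rewrite /D /truncf /cutoff; case: ifP => _; rewrite ?subrr ?sub0r.
have mDn n : measurable_fun setT (fun x => (nsq (D n x))%:E).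
  by apply/measurable_EFinP; exact: measurable_nsq.
have cD : {ae mu, forall x, setT x -> (nsq (D n x))%:E @[n --> \oo] --> (cst 0 x : \bar R)}.
  apply: aeW => x _; apply: cvg_trans (@cvg_cst _ (0%E : \bar R) _ \oo _).
  apply: near_eq_cvg; near=> n; rewrite DE ifT ?nsq0//.
  apply/mem_set; rewrite /window /= in_itv /= -ler_norml.
  apply: (@le_trans _ _ n%:R); last by rewrite ler_nat.
  by near: n; exact: nbhs_infty_ger.
have iF : mu.-integrable setT (fun x => (nsq (L2_fun f x))%:E).
  apply/integrableP; split.
    by apply/measurable_EFinP/measurable_nsq; exact: L2_cmeas.
  under eq_integral do rewrite gee0_abs ?lee_fin ?nsq_ge0//.
  exact: sqint_n2 (L2_sqint f).
have bD : {ae mu, forall x n, setT x -> (`|(nsq (D n x))%:E| <= (nsq (L2_fun f x))%:E)%E}.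
  apply: aeW => x n _; rewrite /= ger0_norm ?nsq_ge0// lee_fin DE.
  by case: ifP => _; rewrite ?nsq0 ?nsq_ge0 ?nsqN.
have mz : measurable_fun setT (cst 0%E : R -> \bar R) by exact: measurable_cst.
have [_ _ c] := @dominated_convergence _ _ _ mu setT measurableT _ _ _ mDn mz cD iF bD.
move: c; rewrite integral0 => /fine_cvgP[_ c].
rewrite /hlim (_ : (fun n => _) = fine \o (fun n => n2 (D n))); first exact: c.
by apply/funext => n /=; rewrite -E.
Unshelve. all: by end_near. Qed.

Lemma fourierN_cvg f : exists l, hlim d (fourierN f) l.
Proof.
apply: L2_complete => e e0.
have p0 : 0 < pi *+ 2 :> R by rewrite mulrn_wgt0// pi_gt0.
have e1 : 0 < e / (pi *+ 2) by rewrite divr_gt0.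
have [k hk] := hlim_hcauchy (truncL2_hlim f) e1.
exists k => m n /andP[km mn]; rewrite fourierN_diff// mulrC -ltr_pdivlMr//.
by apply: hk; rewrite km.
Qed.

(** Plancherel turns the Cauchy property of the truncations into that of their transforms, so a
    limit exists by completeness and the default of [xget] is not reached. *)
Lemma fourier_hlim f : hlim d (fourierN f) (fourier f).
Proof.
have E g : (fun n => \int[mu]_xi (Normc.normc (truncated_fourier f n xi - L2_fun g xi) ^+ 2)%:E)%E
      @ \oo --> 0%E <-> hlim d (fourierN f) g.
  have Es n : (\int[mu]_xi (Normc.normc (truncated_fourier f n.+1 xi - L2_fun g xi) ^+ 2)%:E)%E
     = (sqn d (fourierN f n - g))%:E.
    rewrite L2_sqnBE; transitivity (n2 (fun xi => truncated_fourier f n.+1 xi - L2_fun g xi)).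
      by apply: eq_integral => x _; rewrite normc_nsq.
    apply: n2_ae.
    - by apply: cmeasB; [exact: sqint_cmeas (sqint_fourierN f n)|exact: L2_cmeas].
    - by apply: cmeasB; exact: L2_cmeas.
    - by apply: aeS (L2_classE (sqint_fourierN f n)) => x ->.
  rewrite /hlim; split.
    rewrite -(cvg_shiftS (fun n => \int[mu]_xi _)%E) => /fine_cvgP[_ h].
    rewrite (_ : (fun n => sqn d _) = fine \o (fun n => \int[mu]_xi (Normc.normc
      (truncated_fourier f n.+1 xi - L2_fun g xi) ^+ 2)%:E)%E)//.
    by apply/funext => n /=; rewrite Es.
  move=> h; rewrite -(cvg_shiftS (fun n => \int[mu]_xi _)%E).
  under eq_fun do rewrite Es.
  by apply: cvg_EFin; [exact: nearW|exact: h].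
rewrite /fourier; case: xgetP => [g _ /E//|nE].
by have [l /E hl] := fourierN_cvg f; case: (nE l).
Qed.

End Fourier.

(** * Isometry, adjoint and surjectivity of the transform *)

Section FourierIsometry.
Variable R : realType.
Local Notation C := R[i].
Local Notation mu := (@lebesgue_measure R).
Local Notation L2 := (L2 R).
Local Notation d := (@L2_dot R).
Implicit Types f g : L2.

Lemma fourierP (a : C) f g : fourier (a *: f + g) = a *: fourier f + fourier g.
Proof.
apply: (hlim_unique (fourier_hlim (a *: f + g))).
rewrite (_ : fourierN _ = (fun n => a *: fourierN f n + fourierN g n)).
  by apply: hlimP; exact: fourier_hlim.
apply/funext => n; apply/L2_eqP.
have E (xi : R) : truncated_fourier (a *: f + g : L2) n.+1 xi =
    a * truncated_fourier f n.+1 xi + truncated_fourier g n.+1 xi.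
  have i1 (h : L2) := cintg_ft xi (cintg_truncf h n.+1).
  rewrite !truncated_fourierE /ft -(cintZ a (i1 f)) -cintD; [|exact: cintgZ (i1 f)|exact: i1].
  apply: ae_eq_cint; [exact: cintg_cmeas (i1 _)|
    by apply: cintg_cmeas; apply: cintgD; [exact: cintgZ (i1 f)|exact: i1]|].
  apply: aeS (L2_scaleDE a f g) => x Ex; rewrite /truncf /cutoff; case: ifP => _.
    by rewrite Ex mulrDl mulrA.
  by rewrite !mul0r mulr0 addr0.
have hN (h : L2) : {ae mu, forall x, L2_fun (fourierN h n) x = truncated_fourier h n.+1 x}.
  exact: L2_classE (sqint_fourierN h n).
have h1 := aeS2 (fun x p q => conj p q) (hN f) (hN g).
have h2 := aeS2 (fun x p q => conj p q) (hN (a *: f + g)) h1.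
have h3 := aeS2 (fun x p q => conj p q) (L2_scaleDE a (fourierN f n) (fourierN g n)) h2.
by apply: aeS h3 => x [e1 [e2 [e3 e4]]]; rewrite e1 e2 e3 e4; exact: E.
Qed.

Lemma sqn_fourier f : sqn d (fourier f) = pi *+ 2 * sqn d f.
Proof.
have h := hlim_sqn (fourier_hlim f).
have h2 := cvgMl_tmp (a := pi *+ 2) (hlim_sqn (truncL2_hlim f)).
apply: (cvg_unique (@Rhausdorff R) h).
rewrite (_ : (fun n => sqn d (fourierN f n)) = (fun n => pi *+ 2 * sqn d (truncL2 f n))).
  exact: h2.
apply/funext => n; apply: EFin_inj; rewrite EFinM.
rewrite !sqn_L2_class ?sqint_fourierN ?sqint_truncf//.
rewrite truncated_fourierE (@plancherel_compact R n.+1)//; first exact: sqint_truncf.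
by move=> x; exact: truncf0.
Qed.

Lemma fourier_dot f g : d (fourier f) (fourier g) = (pi *+ 2)%:C * d f g.
Proof. exact: (isometry_dot fourierP sqn_fourier). Qed.

Lemma pi2_gt0 : 0 < pi *+ 2 :> R.
Proof. by rewrite pmulrn_lgt0; [exact: pi_gt0|]. Qed.

Lemma fourier_inj : injective (@fourier R).
Proof.
move=> f g fg; apply/eqP; rewrite -subr_eq0; apply/eqP; apply: (@sqn_eq0 _ _ d).
have F0 : fourier (f - g) = 0.
  by rewrite -[f - g]addrC -[- g]scaleN1r fourierP fg scaleN1r addNr.
have h := sqn_fourier (f - g); rewrite F0 sqn0 in h.
have /eqP h' := esym h.
by rewrite mulf_eq0 (gt_eqF pi2_gt0) in h'; exact/eqP.
Qed.

Definition conjL2 f : L2 := L2_class (fun x => conjc (L2_fun f x)).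

Lemma conjL2E f : {ae mu, forall x, L2_fun (conjL2 f) x = conjc (L2_fun f x)}.
Proof. by apply: L2_classE; apply: sqintJ; exact: L2_sqint. Qed.

Lemma sqn_conjL2B f g : sqn d (conjL2 f - conjL2 g) = sqn d (f - g).
Proof.
apply: EFin_inj; rewrite !L2_sqnBE.
rewrite (@n2_ae _ _ (fun x => conjc (L2_fun f x - L2_fun g x))).
- by apply: eq_integral => x _; rewrite nsqJ.
- by apply: cmeasB; exact: L2_cmeas.
- by apply: cmeasJ; apply: cmeasB; exact: L2_cmeas.
- by apply: aeS2 (conjL2E f) (conjL2E g) => x -> ->; rewrite rmorphB.
Qed.

Lemma conjL2_hlim (u : nat -> L2) l : hlim d u l -> hlim d (fun n => conjL2 (u n)) (conjL2 l).
Proof.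
rewrite /hlim => h; rewrite (_ : (fun n => _) = (fun n => sqn d (u n - l)))//.
by apply/funext => n; rewrite sqn_conjL2B.
Qed.

(** The adjoint of the transform: by the multiplication formula $\int \widehat f\,\overline g = \int
    f\,\widehat{\overline g}$, and the last factor is the conjugate of this vector. *)
Definition fourier_adj f : L2 := conjL2 (fourier (conjL2 f)).

Lemma sqn_conjL2 f : sqn d (conjL2 f) = sqn d f.
Proof.
apply: EFin_inj; rewrite !L2_sqnE (@n2_ae _ _ (fun x => conjc (L2_fun f x))).
- by apply: eq_integral => x _; rewrite nsqJ.
- exact: L2_cmeas.
- by apply: cmeasJ; exact: L2_cmeas.
- exact: conjL2E.
Qed.

Lemma sqn_fourier_adj f : sqn d (fourier_adj f) = pi *+ 2 * sqn d f.
Proof. by rewrite sqn_conjL2 sqn_fourier sqn_conjL2. Qed.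

Lemma fourierN_adj f g n m :
  d (fourierN f n) (truncL2 g m) = d (truncL2 f n) (conjL2 (fourierN (conjL2 g) m)).
Proof.
rewrite L2_dot_class2 ?sqint_fourierN ?sqint_truncf//.
rewrite L2_dot_class; last by apply: sqintJ; exact: L2_sqint.
pose v := truncf (conjL2 g) m.+1.
have E1 : cint (fun x => truncated_fourier f n.+1 x * conjc (truncf g m.+1 x)) =
    cint (fun x => ft (truncf f n.+1) x * v x).
  rewrite truncated_fourierE; apply: ae_eq_cint.
  - by apply: cmeasM; [apply: cmeas_ft; exact: cintg_truncf|
      apply: cmeasJ; apply: cintg_cmeas; exact: cintg_truncf].
  - by apply: cmeasM; [apply: cmeas_ft; exact: cintg_truncf|apply: cintg_cmeas; exact: cintg_truncf].
  apply: aeS (conjL2E g) => x Ex; rewrite /v /truncf /cutoff; case: ifP => _; first by rewrite Ex.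
  by rewrite cJ0.
rewrite E1 ft_sym; [|exact: cintg_truncf..].
apply: ae_eq_cint.
- by apply: cmeasM; [apply: cintg_cmeas; exact: cintg_truncf|apply: cmeas_ft; exact: cintg_truncf].
- by apply: cmeasM; [exact: L2_cmeas|apply: cmeasJ; apply: cmeasJ; exact: L2_cmeas].
apply: aeS2 (L2_classE (sqint_truncf f n.+1)) (L2_classE (sqint_fourierN (conjL2 g) m)) => x h1 h2.
by rewrite conjcK -/(truncL2 f n) h1 -/(fourierN _ m) h2 truncated_fourierE.
Qed.

(** The multiplication formula holds for truncations of both arguments; the limits are taken one
    variable at a time. *)
Lemma fourier_adjP f g : d (fourier f) g = d f (fourier_adj g).
Proof.
apply: (hlim_dot_eq (fourier_hlim f) (truncL2_hlim f)) => n.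
rewrite dotC [RHS]dotC; congr conjc.
apply: (hlim_dot_eq (truncL2_hlim g) (conjL2_hlim (fourier_hlim (conjL2 g)))) => m.
by rewrite dotC [RHS]dotC; congr conjc; exact: fourierN_adj.
Qed.

(* With [h = F* g / 2 pi], [|F h - g|^2 = 2 pi |h|^2 - 2 Re <h, F* g> + |g|^2 = 0]
   because [F] and [F*] both multiply squared norms by [2 pi]. *)
Lemma fourier_surj g : exists f, fourier f = g.
Proof.
have p0 : pi *+ 2 != 0 :> R by rewrite (gt_eqF pi2_gt0).
pose h : L2 := ((pi *+ 2)^-1)%:C *: fourier_adj g.
exists h; apply/eqP; rewrite -subr_eq0; apply/eqP/(sqn_eq0 (d := d)).
rewrite sqnB sqn_fourier [X in Re X](fourier_adjP h g) /h sqnZ nsqR.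
rewrite dotZl sqnE -rCM [X in Re X]/= sqn_fourier_adj.
by move: (sqn d g) p0 => s; move: (pi *+ 2) => q q0 /=; field.
Qed.

(** Multiplication by a unimodular function preserves square-integrability, and surjectivity of the
    transform supplies the element that [xget] looks for. *)
Lemma multiplierE (z : C) f : nsq z = 1 ->
  {ae mu, forall x, L2_fun (fourier (multiplier (fun w => z * w) f)) x =
    z * expi (- x) * L2_fun (fourier f) x}.
Proof.
move=> z1; rewrite /multiplier; case: xgetP => [g _ //|nE].
have su : (fun x => z * expi (- x) * L2_fun (fourier f) x) \in @sqint R.
  apply: (@sqint_bounded _ _ _ 1); first exact: L2_sqint.
    apply: cmeasM; first exact: cmeas_cst.
    by apply: (eq_cmeas _ (cmeas_expi (-1))) => x; rewrite mulN1r.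
  by move=> x; rewrite nsqM z1 nsq_expi mulr1.
have [g hg] := fourier_surj (L2_class (fun x => z * expi (- x) * L2_fun (fourier f) x)).
by case: (nE g); rewrite /= hg; exact: L2_classE su.
Qed.

End FourierIsometry.

(** * Dilation on the Fourier side *)

Section Dilation.
Variable R : realType.
Local Notation C := R[i].
Local Notation mu := (@lebesgue_measure R).
Local Notation L2 := (L2 R).
Local Notation d := (@L2_dot R).
Implicit Types f g : L2.

Lemma sqint_scale (a : R) (u : R -> C) : 0 < a -> u \in @sqint R -> (fun x => u (a * x)) \in @sqint R.
Proof.
move=> a0 su; rewrite (_ : (fun x => _) = (fun x => u (a * x + 0))).
  have h := @sqint_affine R a 0 a0 u su. exact: h.
by apply/funext => x; rewrite addr0.
Qed.

Lemma ae_scale (a : R) (P : R -> Prop) : 0 < a -> {ae mu, forall x, P x} ->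
  {ae mu, forall x, P (a * x)}.
Proof. by move=> a0 h; apply: aeS (ae_affine 0 a0 h) => x; rewrite addr0. Qed.

Lemma n2_scale (a : R) (u : R -> C) : 0 < a -> cmeas u ->
  n2 u = (a%:E * n2 (fun x => u (a * x)%R))%E.
Proof.
by move=> a0 mu'; rewrite (n2_affine 0 a0)//; congr (_ * n2 _)%E; apply/funext => x; rewrite addr0.
Qed.

(** The factor $\sqrt a$ makes the rescaling unitary. [dilation] is the case $a = 1/2$, and the
    Fourier transform conjugates it to the case $a = 2$. *)
Definition stretch (a : R) f : L2 := L2_class (fun x => (Num.sqrt a)%:C * L2_fun f (a * x)).

Lemma sqint_stretch a f : 0 < a -> (fun x => (Num.sqrt a)%:C * L2_fun f (a * x)) \in @sqint R.
Proof.
move=> a0; apply: (@sqint_bounded _ (fun x => L2_fun f (a * x)) (fun=> (Num.sqrt a)%:C) a).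
- exact: (sqint_scale a0 (L2_sqint f)).
- exact: cmeas_cst.
- by move=> x; rewrite nsqR sqr_sqrtr// ltW.
Qed.

Lemma stretchE a f : 0 < a ->
  {ae mu, forall x, L2_fun (stretch a f) x = (Num.sqrt a)%:C * L2_fun f (a * x)}.
Proof. by move=> a0; apply: L2_classE; exact: sqint_stretch. Qed.

Lemma stretchP a b f g : 0 < a -> stretch a (b *: f + g) = b *: stretch a f + stretch a g.
Proof.
move=> a0; apply/L2_eqP.
have h1 := aeS2 (fun x p q => conj p q) (stretchE f a0) (stretchE g a0).
have h2 := aeS2 (fun x p q => conj p q) (L2_scaleDE b (stretch a f) (stretch a g)) h1.
have h3 := aeS2 (fun x p q => conj p q) (stretchE (b *: f + g) a0) h2.
apply: aeS2 (ae_scale a0 (L2_scaleDE b f g)) h3 => x e0 [e1 [e2 [e3 e4]]].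
by rewrite e1 e0 e2 e3 e4; ring.
Qed.

Lemma sqn_stretch a f : 0 < a -> sqn d (stretch a f) = sqn d f.
Proof.
move=> a0; apply: EFin_inj; rewrite sqn_L2_class ?sqint_stretch// L2_sqnE.
rewrite n2M_const; last by apply: sqint_cmeas; exact: (sqint_scale a0 (L2_sqint f)).
by rewrite nsqR sqr_sqrtr ?ltW// -n2_scale//; exact: L2_cmeas.
Qed.

Lemma stretchK a f : 0 < a -> stretch a (stretch a^-1 f) = f.
Proof.
move=> a0; have ai : 0 < a^-1 by rewrite invr_gt0.
apply/L2_eqP; apply: aeS2 (stretchE (stretch a^-1 f) a0) (ae_scale a0 (stretchE f ai)) => x -> ->.
rewrite mulrA -rCM -sqrtrM; last exact: ltW.
by rewrite mulfV ?(gt_eqF a0)// sqrtr1 mul1r mulrA mulVf ?(gt_eqF a0)// mul1r.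
Qed.

Lemma dilationE f : dilation f = stretch 2^-1 f.
Proof.
rewrite /dilation /stretch; congr L2_class; apply/funext => x.
by rewrite sqrtrV// mulrC [x / 2]mulrC mulrC.
Qed.

Lemma hlim_sub (u : nat -> L2) l (k : nat -> nat) : (forall n, (n <= k n)%N) ->
  hlim d u l -> hlim d (fun n => u (k n)) l.
Proof.
move=> kn /cvgr0Pnorm_lt h; apply/cvgr0Pnorm_lt => e e0.
have [N _ hN] := h e e0; exists N => // n /= Nn; apply: hN.
exact: leq_trans Nn (kn n).
Qed.

Lemma truncated_fourier_dilation f m xi :
  truncated_fourier (dilation f) m.*2 xi = (Num.sqrt 2)%:C * truncated_fourier f m (2 * xi).
Proof.
rewrite !truncated_fourierE /ft.
have i1 := cintg_ft xi (cintg_truncf (dilation f) m.*2).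
have t2 : 0 < 2 :> R by [].
have i2 := cintg_affine 0 t2 i1.
rewrite (cint_affine 0 t2 i1) -(cintZ _ i2).
have i3 := cintg_ft (2 * xi) (cintg_truncf f m).
rewrite -(cintZ _ i3).
apply: ae_eq_cint.
- exact: cintg_cmeas (cintgZ _ i2).
- exact: cintg_cmeas (cintgZ _ i3).
have hi : 0 < 2^-1 :> R by rewrite invr_gt0.
apply: aeS (ae_scale t2 (stretchE f hi)) => x Ex.
rewrite addr0 /truncf /cutoff.
have -> : (2 * x \in (`[- (m.*2)%:R, (m.*2)%:R]%classic : set R)) = (x \in (`[- m%:R, m%:R]%classic : set R)).
  apply/idP/idP => /set_mem /= h; apply/mem_set; move: h; rewrite /= !in_itv /= -mul2n natrM;
    by rewrite -mulrN !ler_pM2l.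
case: ifP => _; last by rewrite !mul0r !mulr0.
rewrite dilationE Ex (_ : 2^-1 * (2 * x) = x); last by rewrite mulKf.
rewrite !mulrA -rCM.
(* The Jacobian 2 of the substitution $x \mapsto 2x$ meets the normalization $1/\sqrt2$ of the
   dilation. *)
have -> : 2 * Num.sqrt 2^-1 = Num.sqrt 2 :> R.
  rewrite sqrtrV// -{1}(@sqr_sqrtr R 2)// expr2 mulfK// sqrtr_eq0 -ltNge//.
by congr (_ * expi _); ring.
Qed.

Lemma fourier_dilation f : fourier (dilation f) = stretch 2 (fourier f).
Proof.
have t2 : 0 < 2 :> R by [].
(* Dilation doubles the window, so a subsequence is used: [fourierN] at index [n.*2.+1] has window
   [n.+1.*2], twice that at index [n]. *)
have k2 n : (n <= n.*2.+1)%N by rewrite -addnn leqW// leq_addr.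
have h1 := hlim_sub k2 (fourier_hlim (dilation f)).
have h2 : hlim d (fun n => stretch 2 (fourierN f n)) (stretch 2 (fourier f)).
  have := fourier_hlim f; rewrite /hlim => h.
  rewrite (_ : (fun n => _) = (fun n => sqn d (fourierN f n - fourier f)))//.
  apply/funext => n; rewrite -[RHS](@sqn_stretch 2)//; congr (sqn d _).
  have e := stretchP (-1) (fourier f) (fourierN f n) t2; rewrite !scaleN1r in e.
  by rewrite [LHS]addrC -e [in RHS]addrC.
apply: (hlim_unique h1).
rewrite (_ : (fun n => _) = (fun n => stretch 2 (fourierN f n)))//.
apply/funext => n; apply/L2_eqP.
have h3 := aeS2 (fun x p q => conj p q)
  (stretchE (fourierN f n) t2) (ae_scale t2 (L2_classE (sqint_fourierN f n))).
apply: aeS2 (L2_classE (sqint_fourierN (dilation f) n.*2.+1)) h3 => x e0 [e1 e2].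
by rewrite e0 e1 e2; exact: (truncated_fourier_dilation f n.+1 x).
Qed.

End Dilation.

(** * Voronoi cells of the cycle points *)

Section PeriodicShift.
Variable R : realType.
Local Notation C := R[i].
Local Notation mu := (@lebesgue_measure R).

Lemma ae_neq (a : R) : {ae mu, forall x, x <> a}.
Proof.
exists [set a]; split; first exact: measurable_set1.
  exact: lebesgue_measure_set1.
by move=> x /= /contrapT.
Qed.

Lemma ae_forall_fin (J : finType) (P : J -> R -> Prop) :
  (forall j, {ae mu, forall x, P j x}) -> {ae mu, forall x, forall j, P j x}.
Proof. by move=> h; apply: (@filter_forall _ _ _ _ (ae_filter_ringOfSetsType mu)). Qed.

Lemma itv_fin (a b : R) : (mu `]a, b[ < +oo)%E.
Proof. by rewrite lebesgue_measure_itv /=; case: ifP => _; rewrite ?ltry. Qed.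

Let W : set R := `]- pi, pi[.

(** Passing from $]-\pi,\pi[$ to $]-\pi+t,\pi+t[$ drops $]-\pi,-\pi+t[$ and adds $]\pi,\pi+t[$, its
    translate by one period. The points $\pi$ and $-\pi+t$ are discarded as null. *)
Lemma cint_periodic_shift_ge0 (h : R -> C) M t : cmeas h -> (forall x, nsq (h x) <= M) ->
  (forall x, h (x + pi *+ 2) = h x) -> 0 <= t <= pi *+ 2 ->
  cint (cutoff W (fun x => h (x + t))) = cint (cutoff W h).
Proof.
move=> mh hM per /andP[t0 t2].
have ig a b : cintg (cutoff (`]a, b[ : set R) h).
  by apply: (cintg_cutoff (M := M)) => //; exact: itv_fin.
pose f := cutoff (`]- pi + t, pi + t[ : set R) h.
pose g := cutoff (`]- pi, - pi + t[ : set R) h.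
pose g' := cutoff (`]pi, pi + t[ : set R) h.
have -> : cint (cutoff W (fun x => h (x + t))) = cint f.
  rewrite (cint_affine t (@ltr01 R) (ig _ _)) mul1r; apply: eq_cint => x.
  rewrite /cutoff mul1r; congr (if _ then _ else _).
  by apply/idP/idP => /set_mem /= e; apply/mem_set; move: e; rewrite /W /= !in_itv /= !ltrD2r.
have gg : cint g = cint g'.
  rewrite [RHS](cint_affine (pi *+ 2) (@ltr01 R) (ig _ _)) mul1r; apply: eq_cint => x.
  rewrite /g /cutoff mul1r per; congr (if _ then _ else _).
  apply/idP/idP => /set_mem /= e; apply/mem_set; move: e; rewrite /= !in_itv /= mulr2n => /andP[a b];
    by apply/andP; split; lra.
rewrite -[RHS](subrK (cint g)) {2}gg -cintB; [|exact: ig..].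
rewrite -cintD; [|by apply: cintgB; exact: ig|exact: ig].
apply: ae_eq_cint.
- exact: cintg_cmeas (ig _ _).
- by apply: cintg_cmeas; apply: cintgD; [apply: cintgB; exact: ig|exact: ig].
have cE a b x : cutoff (`]a, b[ : set R) h x = if (a < x) && (x < b) then h x else 0.
  rewrite /cutoff; congr (if _ then _ else _).
  by apply/idP/idP => [/set_mem|e]; [|apply/mem_set]; rewrite /= in_itv.
apply: aeS2 (ae_neq pi) (ae_neq (- pi + t)) => x /eqP x1 /eqP x2.
rewrite /f /g /g' /W !cE.
have p0 := pi_gt0 R.
case: (ltgtP x pi) x1 => // a _; case: (ltgtP x (- pi + t)) x2 => // b _;
  case: (ltP x (pi + t)) => c; case: (ltP (- pi) x) => e //=;
  rewrite ?subrr ?subr0 ?add0r ?addr0 ?subrK //; exfalso; move: t2; rewrite mulr2n => t2; lra.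
Qed.

Lemma cint_periodic_shift (h : R -> C) M t : cmeas h -> (forall x, nsq (h x) <= M) ->
  (forall x, h (x + pi *+ 2) = h x) -> `|t| <= pi ->
  cint (cutoff W (fun x => h (x + t))) = cint (cutoff W h).
Proof.
move=> mh hM per tp; have [t0|t0] := leP 0 t.
  apply: (cint_periodic_shift_ge0 (M := M)) => //; rewrite t0 /= mulr2n.
  by move: tp; rewrite ger0_norm// => tp; have := pi_ge0 R; lra.
rewrite -[LHS](@cint_periodic_shift_ge0 _ M (- t)).
- by apply: eq_cint => x; rewrite /cutoff subrK.
- by apply: eq_cmeas (cmeas_affine 1 t mh) => x; rewrite mul1r.
- by move=> x; exact: hM.
- by move=> x; rewrite addrAC per.
- rewrite oppr_ge0 ltW//= mulr2n.
  by move: tp; rewrite ltr0_norm// => tp; have := pi_ge0 R; lra.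
Qed.

End PeriodicShift.

Section Voronoi.
Variable R : realType.
Local Notation C := R[i].
Local Notation mu := (@lebesgue_measure R).
Variables (J : finType) (z : J -> C) (sigma tau : J -> J).
Hypothesis z1 : forall j, nsq (z j) = 1.
Hypothesis z_inj : injective z.
Hypothesis sigmaK : cancel sigma tau.
Hypothesis tauK : cancel tau sigma.
Hypothesis z_sq : forall j, z (sigma j) = z j ^+ 2.

Local Notation w := (wave 1 z).

Lemma wave1E j x : w j x = z j * expi (- x).
Proof. by rewrite /wave mul1r. Qed.

(* The cosine of the distance from [w j x] to [z j], minus the cosine of its distance to [z l]. *)
Definition gap j l x : R := Re (expi (- x) * (1 - z j * conjc (z l))).

(** The totality argument asks for open tiles, hence the strict inequalities here and the removal of
    the closed cell in [ring_cell]. The weak inequalities of [closed_cell] ensure that no point of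
    the circle is left uncovered. *)
Definition cell j : set R := [set x | `|x| < pi /\ forall l, l != j -> 0 < gap j l x].
Definition closed_cell j : set R := [set x | `|x| <= pi /\ forall l, 0 <= gap j l x].
Definition ring_cell j : set R := [set x | cell (tau j) (x / 2) /\ ~ closed_cell j x].

Lemma gapE j l x : gap j l x = cos x - Re (w j x * conjc (z l)).
Proof.
rewrite /gap wave1E mulrBr mulr1 cReD cReN /= cosN; congr (_ - Re _).
by rewrite mulrCA mulrA.
Qed.

Lemma Re_wave_self j x : Re (w j x * conjc (z j)) = cos x.
Proof. by rewrite wave1E mulrAC nsqE z1 mul1r /= cosN. Qed.

Lemma gap_self j x : gap j j x = 0.
Proof. by rewrite gapE Re_wave_self subrr. Qed.

Lemma cell_sub j : cell j `<=` closed_cell j.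
Proof.
move=> x [xp h]; split; first exact: ltW.
by move=> l; have [->|/h/ltW//] := eqVneq l j; rewrite gap_self.
Qed.

(** For $j \ne l$ the common value would be strictly nearer to $z_j$ than to $z_l$ and at least as
    near to $z_l$. For $j = l$ the angle in $[-\pi,\pi]$ is determined by the value. *)
Lemma cell_closed_inj j x l y : cell j x -> closed_cell l y -> w j x = w l y ->
  j = l /\ x = y.
Proof.
move=> [xp hx] [yp hy] e; have [jl|jl] := eqVneq j l.
  split=> //; apply/oppr_inj; apply: expi_inj_pi; rewrite ?normrN//.
  by apply: (mulfI (nsq1_neq0 (z1 j))); rewrite -!wave1E e jl.
have := hx l; rewrite eq_sym jl => /(_ isT); rewrite gapE e Re_wave_self subr_gt0.
have := hy j; rewrite gapE -e Re_wave_self subr_ge0 => h1 h2.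
by have := le_lt_trans h1 h2; rewrite ltxx.
Qed.

Lemma cell_inj j x l y : cell j x -> cell l y -> w j x = w l y -> j = l /\ x = y.
Proof. by move=> hx /cell_sub; exact: cell_closed_inj. Qed.

(** Among finitely many points a nearest one exists; [x] is the angle from it to [u], and [j0]
    witnesses that there are points at all. *)
Lemma closed_cell_surj (j0 : J) u : nsq u = 1 -> exists j x, closed_cell j x /\ w j x = u.
Proof.
move=> u1; have [j _ hj] := @arg_maxP _ _ _ j0 xpredT (fun l => Re (u * conjc (z l))) isT.
have : nsq (u * conjc (z j)) = 1 by rewrite nsqM nsqJ u1 z1 mulr1.
move=> /angle_exists[t tp ht].
have e : w j t = u by rewrite wave1E -ht mulrCA nsqE z1 mulr1.
exists j, t; split=> //; split=> // l.
by rewrite gapE e subr_ge0 -(Re_wave_self j t) e; exact: hj.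
Qed.

Lemma cos_double (x : R) : cos x = 2 * cos (x / 2) ^+ 2 - 1.
Proof. by rewrite {1}(splitr x) cosD -!expr2 sin2cos2; ring. Qed.

Lemma Re_sqr_unit (v : C) : nsq v = 1 -> Re (v ^+ 2) = 2 * Re v ^+ 2 - 1.
Proof. by move=> v1; rewrite expr2 cReM -[X in _ = _ - X]v1 /nsq; ring. Qed.

Lemma wave_half j x : w j (x / 2) ^+ 2 = w (sigma j) x.
Proof.
rewrite !wave1E z_sq exprMn; congr (_ * _).
by rewrite expr2 -expiD -opprD -splitr.
Qed.

(** The double angle formula $\mathrm{Re}(v^2) = 2(\mathrm{Re}\,v)^2 - 1$ on the circle: comparing
    distances after squaring amounts to comparing squared cosines before it. *)
Lemma gap_half j l x :
  gap (sigma j) (sigma l) x = 2 * (cos (x / 2) ^+ 2 - Re (w j (x / 2) * conjc (z l)) ^+ 2).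
Proof.
rewrite gapE -wave_half z_sq cos_double.
have -> : w j (x / 2) ^+ 2 * conjc (z l ^+ 2) = (w j (x / 2) * conjc (z l)) ^+ 2.
  by rewrite [RHS]exprMn; congr (_ * _); rewrite [z l ^+ 2]expr2 cJM -expr2.
rewrite Re_sqr_unit; first by ring.
by rewrite (nsqM (w j _)) nsqJ (nsq_wave _ z1) z1 mulr1.
Qed.

Lemma norm_half (x : R) : `|x / 2| = `|x| / 2.
Proof. by rewrite normrM normfV normr_nat. Qed.

(** For $|x| < \pi$ the cosine of $x/2$ is positive, so a comparison of squares gives $\cos(x/2) >
    |\mathrm{Re}(w_j \overline{z_l})|$, stronger than what the cell requires. *)
Lemma cell_half j x : cell (sigma j) x -> cell j (x / 2).
Proof.
move=> [xp h]; have p0 := pi_gt0 R.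
split; first by rewrite norm_half; have := normr_ge0 x; lra.
have c0 : 0 < cos (x / 2).
  by apply: cos_gt0_pihalf; rewrite -ltr_norml norm_half; lra.
move=> l lj; have := h (sigma l); rewrite (can_eq sigmaK) lj => /(_ isT).
rewrite gap_half pmulr_rgt0// subr_gt0 gapE subr_gt0 => h2.
by rewrite (le_lt_trans (ler_norm _))// -(ltr_pXn2r (n := 2))// ?nnegrE ?ltW// -normrX ger0_norm ?sqr_ge0.
Qed.

Lemma closed_cell_half j x : closed_cell (sigma j) x -> closed_cell j (x / 2).
Proof.
move=> [xp h]; have p0 := pi_gt0 R.
split; first by rewrite norm_half; have := normr_ge0 x; lra.
have c0 : 0 <= cos (x / 2).
  by apply: cos_ge0_pihalf; rewrite -ler_norml norm_half; lra.
move=> l; have := h (sigma l).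
rewrite gap_half pmulr_rge0// subr_ge0 gapE subr_ge0 => h2.
by rewrite (le_trans (ler_norm _))// -(ler_pXn2r (n := 2))// ?nnegrE// -normrX ger0_norm ?sqr_ge0.
Qed.

(* [w j x] has exactly two square roots, and one of them lies over [closed_cell]. *)
Lemma ring_cell_inj j x l y : ring_cell j x -> ring_cell l y -> w j x = w l y -> j = l /\ x = y.
Proof.
move=> [cx nx] [cy ny] e.
have hw i t : w (tau i) (t / 2) ^+ 2 = w i t by rewrite wave_half tauK.
have fin i k (s t : R) : tau i = tau k /\ s / 2 = t / 2 -> i = k /\ s = t.
  by move=> [/(can_inj tauK) -> /(congr1 (fun r => r * 2)) /=]; rewrite !divfK.
have /eqP := etrans (hw j x) (etrans e (esym (hw l y))).
rewrite eqf_sqr => /orP[/eqP e1|/eqP e1]; first exact: fin (cell_inj cx cy e1).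
have u1 : nsq (w j x) = 1 by exact: nsq_wave.
have [k [t [ct et]]] := closed_cell_surj j u1.
have ct2 : closed_cell (tau k) (t / 2) by apply: closed_cell_half; rewrite tauK.
(* The root over [t / 2] equals the one over [x / 2] or the one over [y / 2]; accordingly [x] or [y]
   falls into its own closed cell, which the ring excludes. *)
have /eqP := etrans (hw k t) (etrans et (esym (hw j x))).
rewrite eqf_sqr => /orP[/eqP e2|/eqP e2].
  have [kj tx] := fin _ _ _ _ (cell_closed_inj cx ct2 (esym e2)).
  by case: nx; rewrite kj tx.
have e3 : w (tau l) (y / 2) = w (tau k) (t / 2) by rewrite e2 e1 opprK.
have [kl ty] := fin _ _ _ _ (cell_closed_inj cy ct2 e3).
by case: ny; rewrite kl ty.
Qed.

End Voronoi.

(** * Topology and moments of the cells and rings *)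

Section VoronoiIntegrals.
Variable R : realType.
Local Notation C := R[i].
Local Notation mu := (@lebesgue_measure R).

Lemma continuous_Re_expi (A : C) : continuous (fun x : R => Re (expi (- x) * A)).
Proof.
have -> : (fun x : R => Re (expi (- x) * A)) = (fun x => Re A * cos x + Im A * sin x).
  by apply/funext => x; rewrite cReM /= cosN sinN; ring.
by move=> x; apply: differentiable_continuous; apply/derivable1_diffP; apply: ex_derive.
Qed.

Lemma open_all_pos (J : finType) (Q : pred J) (A : J -> C) :
  open [set x : R | forall l, Q l -> 0 < Re (expi (- x) * A l)].
Proof.
rewrite openE => x hx; rewrite /interior.
apply: (@filter_forall _ _ (fun l => [set y : R | Q l -> 0 < Re (expi (- y) * A l)]) (nbhs x)) => l.
case Ql : (Q l); last by apply: nearW.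
have : nbhs x [set y : R | 0 < Re (expi (- y) * A l)].
  apply: open_nbhs_nbhs; split; last exact: hx.
  apply: (@open_comp _ _ (fun y : R => Re (expi (- y) * A l)) [set r | 0 < r]).
    by move=> y _; exact: continuous_Re_expi.
  exact: open_gt.
by apply: filterS => y h _; exact: h.
Qed.

Lemma closed_all_ge0 (J : finType) (A : J -> C) :
  closed [set x : R | forall l, 0 <= Re (expi (- x) * A l)].
Proof.
rewrite (_ : [set x | _] = \bigcap_(l in [set: J]) [set x : R | 0 <= Re (expi (- x) * A l)]).
  apply: closed_bigI => l _.
  apply: (@closed_comp _ _ (fun y : R => Re (expi (- y) * A l)) [set r | 0 <= r]).
    by move=> y _; exact: continuous_Re_expi.
  exact: closed_ge.
by apply/seteqP; split => x /= h l; [move=> _|]; exact: h.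
Qed.

Variables (J : finType) (z : J -> C) (sigma tau : J -> J).
Hypothesis z1 : forall j, nsq (z j) = 1.
Hypothesis z_inj : injective z.
Hypothesis sigmaK : cancel sigma tau.
Hypothesis tauK : cancel tau sigma.
Hypothesis z_sq : forall j, z (sigma j) = z j ^+ 2.

Local Notation w := (wave 1 z).
Local Notation cell := (cell z).
Local Notation closed_cell := (closed_cell z).
Local Notation ring_cell := (ring_cell z tau).

Let W : set R := `]- pi, pi[.

Lemma cellE j : cell j = W `&` [set x | forall l, l != j -> 0 < gap z j l x].
Proof. by apply/seteqP; split => x [h1 h2]; split=> //; move: h1; rewrite /W /= in_itv /= ltr_norml. Qed.

Lemma open_cell j : open (cell j).
Proof. by rewrite cellE; apply: openI; [exact: interval_open|exact: open_all_pos]. Qed.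

Lemma closed_closed_cell j : closed (closed_cell j).
Proof.
rewrite (_ : closed_cell j = `[- pi, pi] `&` [set x | forall l, 0 <= gap z j l x]).
  by apply: closedI; [exact: interval_closed|exact: closed_all_ge0].
by apply/seteqP; split => x [h1 h2]; split=> //; move: h1; rewrite /= in_itv /= ler_norml.
Qed.

Lemma open_ring_cell j : open (ring_cell j).
Proof.
apply: openI; last by apply: closed_openC; exact: closed_closed_cell.
apply: (@open_comp _ _ (fun y : R => y / 2) (cell (tau j))); last exact: open_cell.
by move=> y _; exact: mulrr_continuous.
Qed.

Lemma sub1_conj_neq0 j l : l != j -> 1 - z j * conjc (z l) != 0.
Proof.
apply: contra; rewrite subr_eq0 => /eqP e; apply/eqP/z_inj.
by rewrite -[LHS]mulr1 e mulrCA nsqE z1 mulr1.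
Qed.

Lemma ae_gap_neq0 j : {ae mu, forall x, forall l, l != j -> gap z j l x <> 0}.
Proof.
apply: ae_forall_fin => l; have [->|lj] := eqVneq l j; first exact: aeW.
have := negligible_Re_expi (sub1_conj_neq0 lj).
by apply: negligibleS => x /= /not_implyP[_ /contrapT].
Qed.

(** The two sets differ only at $\pm\pi$ and at zeros of the functions [gap], which are countably
    many. *)
Lemma ae_closed_cell j : {ae mu, forall x, closed_cell j x <-> cell j x}.
Proof.
have h := aeS2 (fun x p q => conj p q) (ae_neq pi) (ae_neq (- pi : R)).
apply: aeS2 h (ae_gap_neq0 j) => x [h1 h2] h3; split; last exact: cell_sub.
move=> [xp hx]; split.
  rewrite lt_neqAle xp andbT; apply/eqP => e.
  by have [x0|x0] := ger0P x; move: e; rewrite ?(ger0_norm x0) ?(ltr0_norm x0) => e;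
    [apply: h1|apply: h2; rewrite -e opprK].
by move=> l lj; rewrite lt_neqAle hx andbT eq_sym; apply/eqP/h3.
Qed.

(** Equality in $\mathrm{Re}(z_j \overline{z_l}) \le 1$ would force $z_j = z_l$. Density of the
    spaces and the passage to small frequencies both start from this point. *)
Lemma cell_center j : cell j 0.
Proof.
split; first by rewrite normr0 pi_gt0.
move=> l lj; rewrite /gap oppr0 expi0 mul1r cReD cReN /= subr_gt0.
have u1 : nsq (z j * conjc (z l)) = 1 by rewrite nsqM nsqJ !z1 mulr1.
have /andP[_ u2] := nsq1_Re u1; rewrite lt_neqAle u2 andbT; apply/eqP => e.
move/eqP: (sub1_conj_neq0 lj); apply; apply: nsq_eq0.
have : Im (z j * conjc (z l)) ^+ 2 = 0 by move: u1; rewrite /nsq e; lra.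
by rewrite /nsq cReD cImD cReN cImN e /= subrr sub0r sqrrN expr0n /= add0r.
Qed.

Lemma measurable_cell j : measurable (cell j).
Proof. by apply: open_measurable; exact: open_cell. Qed.

Lemma measurable_ring_cell j : measurable (ring_cell j).
Proof. by apply: open_measurable; exact: open_ring_cell. Qed.

Lemma cmeas_w j k : cmeas (fun x => w j x ^ k).
Proof. by apply: cmeas_exprz; [exact: cmeas_wave|exact: nsq_wave]. Qed.

Lemma nsq_w j k x : nsq (w j x ^ k) = 1.
Proof. by apply: nsq1_exprz; exact: nsq_wave. Qed.

Lemma nsq_w_le j k x : nsq (w j x ^ k) <= 1.
Proof. by rewrite nsq_w. Qed.

Lemma cintg_cell j k : cintg (cutoff (cell j) (fun x => w j x ^ k)).
Proof.
apply: (cintg_cutoff (M := 1)); [exact: measurable_cell| |exact: cmeas_w|exact: nsq_w_le].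
apply: le_lt_trans (itv_fin (- pi) pi); apply: le_measure; rewrite ?inE//.
  exact: measurable_cell.
by rewrite cellE => x [].
Qed.

Variable j0 : J.

(* Membership of [expi (- y)] in the open Voronoi arc of [z j]. *)
Let arc j : set R := [set y | forall l, l != j -> 0 < Re (expi (- y) * (conjc (z j) - conjc (z l)))].

(** Outside a null set no two cycle points are equally near, so exactly one arc, that of the nearest
    point, contains $e^{-iy}$. *)
Let ae_arc (h : R -> C) : {ae mu, forall y, \sum_j cutoff (arc j) h y = h y}.
Proof.
have sep : {ae mu, forall x : R, forall p : J * J, p.1 != p.2 ->
    Re (expi (- x) * (conjc (z p.1) - conjc (z p.2))) <> 0}.
  apply: ae_forall_fin => -[j l] /=; have [->|lj] := eqVneq j l; first exact: aeW.
  have a0 : conjc (z j) - conjc (z l) != 0.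
    rewrite subr_eq0; apply: contra lj => /eqP e; apply/eqP/z_inj.
    by rewrite -[LHS]conjcK e conjcK.
  have := negligible_Re_expi a0.
  by apply: negligibleS => x /= /not_implyP[_ /contrapT].
apply: aeS sep => y hy.
have [j _ hj] := @arg_maxP _ _ _ j0 xpredT (fun l => Re (expi (- y) * conjc (z l))) isT.
have {}hj l : Re (expi (- y) * conjc (z l)) <= Re (expi (- y) * conjc (z j)) by exact: hj.
have in_arc l : (y \in arc l) = (l == j).
  apply/idP/eqP => [/set_mem hl|->]; last first.
    apply/mem_set => i ij; have hp := hy (j, i); rewrite eq_sym ij in hp.
    move: (hp isT) => /= /eqP ne; rewrite lt_neqAle eq_sym ne /=.
    by rewrite mulrBr cReD cReN subr_ge0; exact: hj.
  apply/eqP; apply: contraT; rewrite eq_sym => jl; have := hl _ jl.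
  by rewrite mulrBr cReD cReN subr_gt0 ltNge hj.
rewrite (bigD1 j)//= big1 ?addr0 => [|l lj]; rewrite /cutoff in_arc ?eqxx//.
by rewrite (negbTE lj).
Qed.

(** Rotation by the angle of $z_j$ carries the cell to the arc of points nearest to $z_j$. The arcs
    fill one period, so the sum is the integral of $e^{-iky}$ over it. *)
Lemma cell_sum k : \sum_j cint (cutoff (cell j) (fun x => w j x ^ k)) =
  if k == 0 then (pi *+ 2)%:C else 0.
Proof.
have mW : measurable W by exact: measurable_itv.
pose e (y : R) : C := expi (- y) ^ k.
have me : cmeas e.
  apply: (@cmeas_exprz _ _ _ (fun y : R => expi (- y))) => [|x]; last exact: nsq_expi.
  by apply: eq_cmeas (cmeas_expi (-1)) => x; rewrite mulN1r.
have ne x : nsq (e x) <= 1 by rewrite nsq1_exprz// nsq_expi.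
have ma j : measurable (arc j) by apply: open_measurable; exact: open_all_pos.
have mea j : cmeas (cutoff (arc j) e) by exact: cmeas_restrict.
have nea j x : nsq (cutoff (arc j) e x) <= 1.
  by rewrite /cutoff; case: ifP => _ //; rewrite nsq0.
have per (x : R) : expi (- (x + pi *+ 2)) = expi (- x) :> C.
  rewrite opprD expiD (_ : expi (- (pi *+ 2)) = 1) ?mulr1//.
  by rewrite /expi cosN sinN cos2pi sin2pi oppr0.
transitivity (\sum_j cint (cutoff W (cutoff (arc j) e))).
  apply: eq_bigr => j _.
  (* Writing $z_j = e^{-it}$ gives $w_j(x) = e^{-i(x+t)}$: the rotation becomes a translation by
     [t]. *)
  have [t tp ht] := angle_exists (z1 j).
  have wt x : w j x = expi (- (x + t)) by rewrite wave1E ht -expiD; congr expi; ring.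
  have arc_per x : (x + pi *+ 2 \in arc j) = (x \in arc j).
    by apply/idP/idP => /set_mem h; apply/mem_set => l /h; rewrite per.
  have perc x : cutoff (arc j) e (x + pi *+ 2) = cutoff (arc j) e x.
    by rewrite /cutoff arc_per /e per.
  rewrite -(cint_periodic_shift (mea j) (nea j) perc tp); apply: eq_cint => x.
  have hx : (x \in cell j) = (x \in W) && (x + t \in arc j).
    have gE l : Re (expi (- (x + t)) * (conjc (z j) - conjc (z l))) = gap z j l x.
      by rewrite /gap -wt wave1E [z j * _]mulrC -mulrA mulrBr nsqE z1.
    rewrite cellE; apply/idP/andP => [/set_mem[h1 h2]|[/set_mem h1 /set_mem h2]].
      by split; apply/mem_set => // l /h2; rewrite gE.
    by apply/mem_set; split=> // l /h2; rewrite gE.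
  by rewrite /cutoff hx; case: (x \in W) => //=; case: ifP => // _; rewrite /e wt.
rewrite -cint_sum; last first.
  move=> j _; exact: cintg_cutoff mW (itv_fin _ _) (mea j) (nea j).
transitivity (cint (cutoff W (fun y => expi ((- k%:~R) * y)))).
  apply: ae_eq_cint.
  - by apply: cmeas_sum => j _; apply: cmeas_restrict.
  - by apply: cmeas_restrict => //; exact: cmeas_expi.
  apply: aeS (ae_arc e) => x Ex; rewrite /cutoff -/(cutoff _ _); case: ifP => _; last by rewrite big1.
  by rewrite -[LHS]/(\sum_j cutoff (arc j) e x) Ex /e expi_exprz mulrN mulNr.
rewrite cint_expi_window ?pi_gt0//; last by rewrite mulNr sinN sin_int_pi oppr0.
by rewrite oppr_eq0 intr_eq0.
Qed.

Lemma cell_window j : cell j `<=` `]- (pi *+ 2), pi *+ 2[.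
Proof.
move=> x [xp _]; rewrite /= in_itv /= -ltr_norml (lt_trans xp)// mulr2n ltrDl.
exact: pi_gt0.
Qed.

Lemma ring_cell_window j : ring_cell j `<=` `]- (pi *+ 2), pi *+ 2[.
Proof.
move=> x [[xp _] _]; rewrite /= in_itv /= -ltr_norml.
by move: xp; rewrite norm_half [pi *+ 2]mulr2n; lra.
Qed.

Lemma window_subset_fin (A : set R) a b : measurable A -> A `<=` `]a, b[ -> (mu A < +oo)%E.
Proof.
move=> mA Aab; apply: le_lt_trans (itv_fin a b); apply: le_measure; rewrite ?inE//.
Qed.

Lemma cintg_ring_cell j k : cintg (cutoff (ring_cell j) (fun x => w j x ^ k)).
Proof.
have mF := measurable_ring_cell j.
exact: cintg_cutoff mF (window_subset_fin mF (@ring_cell_window j)) (cmeas_w j k) (@nsq_w_le j k).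
Qed.

(** Up to a null set the ring is the doubled cell minus the cell inside it. The doubled cells
    contribute twice the moment of order $2k$ of the cells, that is $4\pi$ or 0, and subtracting the
    moment of order $k$ leaves $2\pi$ or 0. *)
Lemma ring_cell_sum k : \sum_j cint (cutoff (ring_cell j) (fun x => w j x ^ k)) =
  if k == 0 then (pi *+ 2)%:C else 0.
Proof.
pose dbl j : set R := [set x | cell (tau j) (x / 2)].
have dbl_win j : dbl j `<=` `]- (pi *+ 2), pi *+ 2[.
  move=> x [xp _]; rewrite /= in_itv /= -ltr_norml.
  by move: xp; rewrite norm_half [pi *+ 2]mulr2n; lra.
have mdbl j : measurable (dbl j).
  apply: open_measurable; apply: (@open_comp _ _ (fun y : R => y / 2) (cell (tau j))).
    by move=> y _; exact: mulrr_continuous.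
  exact: open_cell.
have ig j : cintg (cutoff (dbl j) (fun x => w j x ^ k)).
  exact: cintg_cutoff (mdbl j) (window_subset_fin (mdbl j) (dbl_win j)) (cmeas_w j k) (@nsq_w_le j k).
have E1 j : cint (cutoff (ring_cell j) (fun x => w j x ^ k)) =
    cint (cutoff (dbl j) (fun x => w j x ^ k)) - cint (cutoff (cell j) (fun x => w j x ^ k)).
  rewrite -cintB; [|exact: ig|exact: cintg_cell].
  apply: ae_eq_cint.
  - exact: cintg_cmeas (cintg_ring_cell j k).
  - by apply: cintg_cmeas; apply: cintgB; [exact: ig|exact: cintg_cell].
  apply: aeS (ae_closed_cell j) => x hx; rewrite /cutoff.
  have cd : cell j x -> dbl j x.
    by rewrite -{1}(tauK j); exact: cell_half.
  case: ifP => [/set_mem[h1 h2]|/negP h1].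
    rewrite ifT ?ifF ?subr0//; last by apply/mem_set.
    by apply/negP => /set_mem /hx.
  case: ifP => [/set_mem h2|/negP h2].
    rewrite ifT ?subrr//; apply/mem_set; apply/hx; apply: contrapT => h3.
    by apply: h1; apply/mem_set; split.
  rewrite ifF ?subrr//; apply/negP => /set_mem /cd h3; apply: h2; exact/mem_set.
have E2x (x : R) : 2 * x / 2 = x by rewrite mulrAC divff ?mul1r ?pnatr_eq0.
(* The substitution $x \mapsto 2x$ brings the factor 2, and $w_j(2x) = w_{\tau j}(x)^2$ doubles the
   exponent. *)
have E2 j : cint (cutoff (dbl j) (fun x => w j x ^ k)) =
    2 * cint (cutoff (cell (tau j)) (fun x => w (tau j) x ^ (2 * k))).
  rewrite (cint_affine 0 (@ltr0Sn R 1) (ig j)); congr (_ * _); first by apply: ceqP => //=; rewrite addr0.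
  apply: eq_cint => x; rewrite /cutoff addr0.
  have -> : (2 * x \in dbl j) = (x \in cell (tau j)).
    by apply/idP/idP => /set_mem h; apply/mem_set; move: h; rewrite /dbl /= E2x.
  case: ifP => // _; rewrite -exprz_exp; congr (_ ^ k).
  by rewrite -{1}(tauK j) -(wave_half z_sq) E2x.
rewrite (eq_bigr _ (fun j _ => E1 j)) sumrB cell_sum (eq_bigr _ (fun j _ => E2 j)) -mulr_sumr.
have -> : \sum_j cint (cutoff (cell (tau j)) (fun x => w (tau j) x ^ (2 * k))) =
    \sum_j cint (cutoff (cell j) (fun x => w j x ^ (2 * k))).
  by rewrite [RHS](reindex_inj (can_inj tauK)).
rewrite cell_sum mulf_eq0 /=; case: eqP => _; last by rewrite mulr0 subrr.
by ring.
Qed.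

End VoronoiIntegrals.

(** * Multiresolution analysis *)

Lemma int_succ_ind (P : int -> Prop) : P 0 -> (forall k, P k -> P (k + 1)) ->
  (forall k, P (k + 1) -> P k) -> forall k, P k.
Proof.
move=> P0 PS SP; elim/int_rect => // n IH; first by rewrite intS addrC; exact: PS.
by apply: SP; rewrite intS opprD addrAC addNr add0r.
Qed.

Section IntegerPowers.
Variables (H : zmodType) (A B : H -> H).
Hypotheses (AK : cancel A B) (BK : cancel B A).

Lemma pinv_cancel : 'pinv_(fun=> 0) setT A = B.
Proof.
apply/funext => y; rewrite -{1}(BK y) pinvKV ?inE//.
by move=> u v _ _ /(can_inj AK).
Qed.

Lemma iterzS k x : iterz A (k + 1) x = A (iterz A k x).
Proof.
case: k => [n|n]; first by rewrite -PoszD addn1.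
case: n => [|n]; first by rewrite /= pinv_cancel BK.
have -> : Negz n.+1 + 1 = Negz n by rewrite !NegzE -[n.+2]addn1 PoszD opprD subrK.
by rewrite /= pinv_cancel BK.
Qed.

Lemma iterzSr k x : iterz A (k + 1) x = iterz A k (A x).
Proof.
elim/int_succ_ind: k x => // k IH x; first by rewrite iterzS IH iterzS.
by apply: (can_inj AK); rewrite -!iterzS IH.
Qed.

Lemma iterzD k l x : iterz A (k + l) x = iterz A k (iterz A l x).
Proof.
elim/int_succ_ind: k => [|k IH|k IH]; first by rewrite add0r.
  by rewrite addrAC !iterzS IH.
by apply: (can_inj AK); rewrite -!iterzS addrAC.
Qed.
End IntegerPowers.

Lemma isometry_closed_preimage (R : realType) (H : lmodType R[i]) (d : {dot H for @conjc R})
    (A : H -> H) (V : set H) : (forall a x y, A (a *: x + y) = a *: A x + A y) ->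
  (forall x, sqn d (A x) = sqn d x) -> closed_subspace d V ->
  closed_subspace d [set x | V (A x)].
Proof.
move=> AP As [V0 VP Vc].
have AB x y : A (x - y) = A x - A y.
  by rewrite -[x - y]addrC -[- y]scaleN1r AP scaleN1r addrC.
split=> /= [|a x y Vx Vy|x /hclosureP hx].
- by rewrite -[0](subrr 0) AB subrr.
- by rewrite AP; exact: VP.
- apply/Vc/hclosureP => e /hx[y Vy xy]; exists (A y) => //.
  by rewrite -AB As.
Qed.

Lemma sum_sqn (R : realType) (J : finType) (H H' : lmodType R[i]) (d : {dot H for @conjc R})
    (d' : {dot H' for @conjc R}) (A : H -> J -> H') (c : R) :
  (forall x y, \sum_a d' (A x a) (A y a) = c%:C * d x y) ->
  forall x, \sum_a sqn d' (A x a) = c * sqn d x.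
Proof.
move=> dA x; have := congr1 (fun u : R[i] => Re u) (dA x x).
by rewrite [d x x]sqnE -rCM /= => <-; rewrite Re_sum.
Qed.

(** * The operators of the representation on the Fourier side *)

Section Frequency.
Variable R : realType.
Local Notation C := R[i].
Local Notation mu := (@lebesgue_measure R).
Variables (W : wavelet_rep R) (J : finType) (z : J -> C) (sigma tau : J -> J).
Local Notation H := (wspace W).
Local Notation d := (wdot W).
Local Notation L2 := (L2 R).
Local Notation dL := (@L2_dot R).
Local Notation w := (wave 1 z).
Variables (comp : H -> J -> L2) (mk : (J -> L2) -> H).
Hypothesis z1 : forall j, nsq (z j) = 1.
Hypothesis sigmaK : cancel sigma tau.
Hypothesis tauK : cancel tau sigma.
Hypothesis mkE : forall f a, comp (mk f) a = f a.
Hypothesis comp_ext : forall x y, (forall a, comp x a = comp y a) -> x = y.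
Hypothesis compP : forall c x y a, comp (c *: x + y) a = c *: comp x a + comp y a.
Hypothesis dotE : forall x y, d x y = \sum_a dL (comp x a) (comp y a).
Hypothesis compU : forall x a, comp (wU x) a = dilation (comp x (sigma a)).
Hypothesis compT : forall x a, comp (wT x) a = multiplier (fun v => z a * v) (comp x a).

Definition freq (x : H) (a : J) : L2 := fourier (comp x a).

Lemma freqP c x y a : freq (c *: x + y) a = c *: freq x a + freq y a.
Proof. exact: etrans (congr1 _ (compP c x y a)) (fourierP _ _ _). Qed.

Lemma freq_ext x y : (forall a, freq x a = freq y a) -> x = y.
Proof. by move=> h; apply: comp_ext => a; exact: fourier_inj (h a). Qed.

Lemma freq_surj (g : J -> L2) : exists x, forall a, freq x a = g a.
Proof.
exists (mk (fun a => sval (cid (fourier_surj (g a))))) => a.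
by rewrite /freq mkE; case: cid.
Qed.

Lemma freq_dot x y : \sum_a dL (freq x a) (freq y a) = (pi *+ 2)%:C * d x y.
Proof. by rewrite dotE mulr_sumr; apply: eq_bigr => a _; exact: fourier_dot. Qed.

Lemma freq_U x a : freq (wU x) a = stretch 2 (freq x (sigma a)).
Proof. by rewrite /freq compU fourier_dilation. Qed.

Lemma freq_UE x a : {ae mu, forall xi, freq (wU x) a xi = (Num.sqrt 2)%:C * freq x (sigma a) (2 * xi)}.
Proof. by rewrite freq_U; exact: stretchE. Qed.

Lemma freq_TE x a : {ae mu, forall xi, freq (wT x) a xi = w a xi * freq x a xi}.
Proof.
have e : freq (wT x) a = fourier (multiplier (fun v => z a * v) (comp x a)).
  exact: congr1 _ (compT x a).
rewrite e; have h := multiplierE (comp x a) (z1 a).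
by apply: aeS h => xi E; rewrite wave1E; exact: E.
Qed.

Local Opaque freq.

Lemma U_bij : exists B, cancel (@wU R W) B /\ cancel B (@wU R W).
Proof.
have h y : exists x, forall a, freq x a = stretch 2^-1 (freq y (tau a)) by exact: freq_surj.
exists (fun y => sval (cid (h y))); split=> y; case: cid => x hx /=; apply: freq_ext => a.
  have i2 : 0 < 2^-1 :> R by rewrite invr_gt0.
  by have := stretchK (freq y a) i2; rewrite invrK hx freq_U tauK.
by rewrite freq_U hx sigmaK stretchK.
Qed.

Lemma T_bij : exists B, cancel (@wT R W) B /\ cancel B (@wT R W).
Proof.
pose q y a xi : C := (w a xi)^-1 * freq y a xi.
have sq y a : q y a \in @sqint R.
  apply: (@sqint_bounded _ (freq y a) (fun xi => (w a xi)^-1) 1).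
  - exact: L2_sqint.
  - apply: (eq_cmeas _ (cmeasJ (cmeas_wave 1 z a))) => xi.
    by rewrite nsq1_conj// nsq_wave.
  - by move=> xi; rewrite nsqV// nsq_wave.
have h y : exists x, forall a, freq x a = L2_class (q y a) by exact: freq_surj.
have w0 a xi : w a xi != 0 by apply: nsq1_neq0; exact: nsq_wave.
exists (fun y => sval (cid (h y))); split=> y; case: cid => x hx /=; apply: freq_ext => a.
  rewrite hx; apply/L2_eqP; apply: aeS2 (L2_classE (sq (wT y) a)) (freq_TE y a) => xi E1 E2.
  exact: etrans E1 (etrans (congr1 (fun c => (w a xi)^-1 * c) E2) (mulKf (w0 a xi) _)).
apply/L2_eqP; apply: aeS2 (L2_classE (sq y a)) (freq_TE x a) => xi E1 E2.
have E3 : freq x a xi = q y a xi by rewrite hx; exact: E1.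
exact: etrans E2 (etrans (congr1 (fun c => w a xi * c) E3) (mulVKf (w0 a xi) _)).
Qed.

Lemma UP c x y : wU (c *: x + y) = c *: wU x + wU y :> H.
Proof.
by apply: freq_ext => a; rewrite freqP !freq_U freqP stretchP.
Qed.

Lemma sqn_U x : sqn d (wU x) = sqn d x.
Proof.
have p0 : pi *+ 2 != 0 :> R by rewrite (gt_eqF (pi2_gt0 R)).
apply: (mulfI p0); rewrite -!(sum_sqn freq_dot) [RHS](reindex_inj (can_inj sigmaK)) /=.
by apply: eq_bigr => a _; rewrite freq_U sqn_stretch.
Qed.

Lemma dot_U x y : d (wU x) (wU y) = d x y.
Proof. by rewrite -[RHS]mul1r; apply: (isometry_dot (c := 1) UP) => u; rewrite mul1r sqn_U. Qed.

Local Notation "'Uz' k" := (iterz (@wU R W) k) (at level 10, k at level 9).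
Local Notation "'Tz' k" := (iterz (@wT R W) k) (at level 10, k at level 9).

Lemma UzP k c x y : Uz k (c *: x + y) = c *: Uz k x + Uz k y.
Proof.
have [B [AK BK]] := U_bij.
elim/int_succ_ind: k => // k IH; first by rewrite !(iterzS AK BK) IH UP.
by apply: (can_inj AK); rewrite UP -!(iterzS AK BK).
Qed.

Lemma dot_Uz k x y : d (Uz k x) (Uz k y) = d x y.
Proof.
have [B [AK BK]] := U_bij.
elim/int_succ_ind: k => // k IH; first by rewrite !(iterzS AK BK) dot_U.
by rewrite -dot_U -!(iterzS AK BK).
Qed.

(** The constant is $\sqrt2^{\,n}$; what matters for supports is that it is nonzero. *)
Lemma freq_UnE x n : exists2 c : C, c != 0 &
  forall a, {ae mu, forall xi, freq (iter n (@wU R W) x) a xi = c * freq x (iter n sigma a) (2 ^+ n * xi)}.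
Proof.
elim: n => [|n [c c0 IH]].
  by exists 1; [exact: oner_neq0|move=> a; apply: aeW => xi; rewrite expr0 !mul1r].
exists ((Num.sqrt 2)%:C * c) => [|a].
  by rewrite mulf_neq0// ; apply/eqP => -[] /eqP; rewrite sqrtr_eq0 leNgt ltr0Sn.
have t2 : 0 < 2 :> R by [].
apply: aeS2 (freq_UE (iter n (@wU R W) x) a) (ae_scale t2 (IH (sigma a))) => xi e1 e2.
have e3 : 2 ^+ n.+1 * xi = 2 ^+ n * (2 * xi) by rewrite exprSr mulrA.
rewrite e3 (iterSr n sigma a); apply: etrans e1 _.
exact: etrans (congr1 (fun u => (Num.sqrt 2)%:C * u) e2) (mulrA _ _ _).
Qed.

Lemma freq_TzE x a k : {ae mu, forall xi, freq (Tz k x) a xi = w a xi ^ k * freq x a xi}.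
Proof.
have [B [AK BK]] := T_bij.
have w0 xi : w a xi != 0 by apply: nsq1_neq0; exact: nsq_wave.
have ek (v : C) k' : v != 0 -> v ^ (k' + 1) = v * v ^ k'.
  by move=> v0; rewrite expfzDr// expr1z mulrC.
have ekf k' xi : w a xi * (w a xi ^ k' * freq x a xi) = w a xi ^ (k' + 1) * freq x a xi.
  exact: etrans (mulrA _ _ _) (congr1 (fun u => u * freq x a xi) (esym (ek _ _ (w0 xi)))).
elim/int_succ_ind: k => [|k IH|k IH]; first by apply: aeW => xi; rewrite expr0z mul1r.
  rewrite (iterzS AK BK); apply: aeS2 (freq_TE (Tz k x) a) IH => xi E1 E2.
  by apply: (etrans E1); apply: etrans (ekf k xi); congr (_ * _); exact: E2.
move: IH; rewrite (iterzS AK BK) => IH; apply: aeS2 (freq_TE (Tz k x) a) IH => xi E1 E2.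
exact: (mulfI (w0 xi)) (etrans (esym E1) (etrans E2 (esym (ekf k xi)))).
Qed.

End Frequency.

(** * Subspaces defined by spectral support, and their bases *)

Section SpectralSupport.
Variable R : realType.
Local Notation C := R[i].
Local Notation mu := (@lebesgue_measure R).
Variables (W : wavelet_rep R) (J : finType) (z : J -> C).
Local Notation H := (wspace W).
Local Notation d := (wdot W).
Local Notation L2 := (L2 R).
Local Notation dL := (@L2_dot R).
Local Notation w := (wave 1 z).
Local Notation "'Tz' k" := (iterz (@wT R W) k) (at level 10, k at level 9).
Variable freq : H -> J -> L2.
Hypothesis z1 : forall j, nsq (z j) = 1.
Hypothesis freqP : forall c x y a, freq (c *: x + y) a = c *: freq x a + freq y a.
Hypothesis freq_ext : forall x y, (forall a, freq x a = freq y a) -> x = y.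
Hypothesis freq_surj : forall g, exists x, forall a, freq x a = g a.
Hypothesis freq_dot : forall x y, \sum_a dL (freq x a) (freq y a) = (pi *+ 2)%:C * d x y.
Hypothesis freq_TzE : forall x a k,
  {ae mu, forall xi, freq (Tz k x) a xi = w a xi ^ k * freq x a xi}.
Hypothesis cH : hcomplete d.

Lemma spectrumB x y a : freq (x - y) a = freq x a - freq y a.
Proof.
have -> : x - y = -1 *: y + x by rewrite scaleN1r addrC.
by rewrite freqP scaleN1r addrC.
Qed.

Lemma spectrum0 a : freq 0 a = 0.
Proof. by rewrite -[0](subrr 0) spectrumB subrr. Qed.

Lemma freq_ae0 x : (forall a, {ae mu, forall xi, freq x a xi = 0}) -> x = 0.
Proof.
move=> h; apply: freq_ext => a; rewrite spectrum0; apply/L2_eqP.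
by apply: aeS2 (h a) (@L2_0E R) => xi -> ->.
Qed.

Definition supp (G : J -> set R) : set H :=
  [set x | forall a, vanishes_on (~` G a) (freq x a)].

Lemma supp_closed G : (forall a, measurable (G a)) -> closed_subspace d (supp G).
Proof.
move=> mG; have cl a := vanishes_closed (measurableC (mG a)).
split=> [a|c x y hx hy a|x /hclosureP hx a] /=; have [V0 VP Vc] := cl a.
- by rewrite spectrum0; exact: V0.
- by rewrite freqP; apply: VP; [exact: hx|exact: hy].
- apply/Vc/hclosureP => e e0; have e1 : 0 < e / (pi *+ 2) by rewrite divr_gt0// pi2_gt0.
  have [y hy xy] := hx _ e1; exists (freq y a); first exact: hy.
  have := sum_sqn freq_dot (x - y); rewrite (bigD1 a)//= spectrumB => E.
  apply: le_lt_trans (_ : pi *+ 2 * sqn d (x - y) < e).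
    by rewrite -E lerDl sumr_ge0// => b _; exact: sqn_ge0.
  by rewrite mulrC -ltr_pdivlMr ?pi2_gt0.
Qed.

Lemma supp_cutoff G x : (forall a, measurable (G a)) ->
  exists2 y, supp G y & forall a, {ae mu, forall xi, freq y a xi = cutoff (G a) (freq x a) xi}.
Proof.
move=> mG; have [y hy] := freq_surj (fun a => L2_class (cutoff (G a) (freq x a))).
have yE a : {ae mu, forall xi, freq y a xi = cutoff (G a) (freq x a) xi}.
  by rewrite hy; apply: L2_classE; apply: sqint_restrict => //; exact: L2_sqint.
exists y => // a; apply: aeS (yE a) => xi -> nG.
by rewrite /cutoff ifF//; apply/negP => /set_mem.
Qed.

(** Let [y] be [x] with its transform cut off to [G]. It lies in [supp G] and $\langle x, y\rangle =
    \langle y, y\rangle$, so orthogonality forces $y = 0$. *)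
Lemma ortho_supp G x : (forall a, measurable (G a)) -> (forall y, supp G y -> d x y = 0) ->
  forall a, vanishes_on (G a) (freq x a).
Proof.
move=> mG xG; have [y Gy yE] := supp_cutoff x mG.
have mc a : cmeas (freq x a) by exact: L2_cmeas.
have dxy : \sum_a dL (freq x a) (freq y a) = \sum_a dL (freq y a) (freq y a).
  apply: eq_bigr => a _; rewrite !L2_dotE; have my : cmeas (freq y a) by exact: L2_cmeas.
  apply: ae_eq_cint; [by apply: cmeasM => //; exact: cmeasJ|by apply: cmeasM => //; exact: cmeasJ|].
  apply: aeS (yE a) => xi ->; rewrite /cutoff; case: ifP => // _.
  by rewrite cJ0 !mulr0.
have y0 : y = 0.
  apply: (@sqn_eq0 _ _ d).
  have := freq_dot y y; rewrite -dxy freq_dot (xG y Gy) mulr0 [d y y]sqnE -rCM.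
  move=> /(congr1 (fun c : C => Re c)) /= /esym/eqP.
  by rewrite mulf_eq0 (gt_eqF (pi2_gt0 R)) => /eqP.
move=> a; have := yE a; rewrite y0 spectrum0 => E.
apply: aeS2 E (@L2_0E R) => xi E0 E1 Gxi.
by move: E0; rewrite /cutoff mem_set// => E0; exact: etrans (esym E0) E1.
Qed.

Lemma sqint_cutoff1 (D : set R) : measurable D -> (mu D < +oo)%E ->
  cutoff D (fun=> 1) \in @sqint R.
Proof.
move=> mD fD; rewrite (_ : cutoff D _ = (fun x => (\1_D x)%:C)); first exact: sqint_indic.
by apply/funext => x; rewrite indicE /cutoff; case: (x \in D).
Qed.

Section Tiles.
Variables (G : J -> set R) (phi : H).
Hypothesis oG : forall a, open (G a).
Hypothesis fG : forall a, (mu (G a) < +oo)%E.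
Hypothesis injG : forall a x b y, G a x -> G b y -> w a x = w b y -> a = b /\ x = y.
Hypothesis sumG : forall k : int, \sum_a cint (cutoff (G a) (fun xi => w a xi ^ k)) =
  if k == 0 then (pi *+ 2)%:C else 0.
Hypothesis phiE : forall a, freq phi a = L2_class (cutoff (G a) (fun=> 1)).

Let mG a : measurable (G a).
Proof. by apply: open_measurable; exact: oG. Qed.

Let mw a k : cmeas (fun xi => w a xi ^ k).
Proof. by apply: cmeas_exprz; [exact: cmeas_wave|exact: nsq_wave]. Qed.

Let w0 a xi : w a xi != 0.
Proof. by apply: nsq1_neq0; exact: nsq_wave. Qed.

Lemma tile_freq a k : {ae mu, forall xi, freq (Tz k phi) a xi = cutoff (G a) (fun xi => w a xi ^ k) xi}.
Proof.
have h := L2_classE (sqint_cutoff1 (mG a) (fG a)); rewrite -phiE in h.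
apply: aeS2 (freq_TzE phi a k) h => xi E1 E2; apply: etrans E1 _.
by rewrite E2 /cutoff; case: ifP => _; rewrite ?mulr1 ?mulr0.
Qed.

Lemma tile_dot x k : (pi *+ 2)%:C * d x (Tz k phi) =
  \sum_a cint (fun xi => cutoff (G a) (freq x a) xi * w a xi ^ (- k)).
Proof.
rewrite -freq_dot; apply: eq_bigr => a _; rewrite L2_dotE.
apply: ae_eq_cint.
- by apply: cmeasM; [exact: L2_cmeas|apply: cmeasJ; exact: L2_cmeas].
- by apply: cmeasM => //; apply: cmeas_restrict => //; exact: L2_cmeas.
apply: aeS (tile_freq a k) => xi ->; rewrite /cutoff; case: ifP => _; last by rewrite cJ0 mulr0 mul0r.
congr (_ * _); rewrite nsq1_conj; last by apply: nsq1_exprz; exact: nsq_wave.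
by rewrite expfV exprz_inv.
Qed.

Lemma tile_supp k : supp G (Tz k phi).
Proof.
move=> a; apply: aeS (tile_freq a k) => xi -> nG.
by rewrite /cutoff ifF//; apply/negP => /set_mem.
Qed.

(** The inner product of two powers of $T$ on [phi] is a moment of the tile, given by [sumG] at the
    difference of the exponents. A vector orthogonal to all of them has a transform whose moments on
    the tile vanish, and totality on the circle makes it 0. *)
Lemma tile_basis : orthonormal_basis d (supp G) (fun k : int => Tz k phi).
Proof.
apply: complete_orthonormal_basis => //.
- move=> k l; have p0 : (pi *+ 2)%:C != 0 :> C.
    by apply/eqP => -[] /eqP; rewrite (gt_eqF (pi2_gt0 R)).
  apply: (mulfI p0); rewrite tile_dot.
  transitivity (\sum_a cint (cutoff (G a) (fun xi => w a xi ^ (k - l)))).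
    apply: eq_bigr => a _; apply: ae_eq_cint.
    + by apply: cmeasM => //; apply: cmeas_restrict => //; exact: L2_cmeas.
    + by apply: cmeas_restrict.
    apply: aeS (tile_freq a k) => xi E; rewrite /cutoff; case: ifP => Gx; last by rewrite mul0r.
    by rewrite E /cutoff Gx -expfzDr.
  by rewrite sumG subr_eq0; case: ifP => _; rewrite ?mulr1 ?mulr0.
- exact: supp_closed.
- exact: tile_supp.
move=> x Gx x0; apply: freq_ae0 => a.
pose g b := cutoff (G b) (freq x b).
have g0 : forall b, {ae mu, forall xi, g b xi = 0}.
  apply: (tile_complete (@ltr01 R) z1 oG injG).
  + by move=> b; apply: sqint_cintg => //; exact: L2_sqint.
  + by move=> b xi nG; rewrite /g /cutoff ifF//; apply/negP => /set_mem.
  + by move=> k; have := tile_dot x (- k); rewrite x0 mulr0 opprK => <-.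
apply: aeS2 (g0 a) (Gx a) => xi; rewrite /g /cutoff; case: ifP => // /negP nG _ h.
by apply: h => Gxi; apply: nG; exact/mem_set.
Qed.

End Tiles.
End SpectralSupport.

(** * The scaling spaces and the super-wavelet *)

Section Multiresolution.
Variable R : realType.
Local Notation C := R[i].
Local Notation mu := (@lebesgue_measure R).
Variables (W : wavelet_rep R) (J : finType) (z : J -> C) (sigma tau : J -> J).
Local Notation H := (wspace W).
Local Notation d := (wdot W).
Local Notation L2 := (L2 R).
Local Notation dL := (@L2_dot R).
Local Notation w := (wave 1 z).
Local Notation U := (@wU R W).
Local Notation "'Tz' k" := (iterz (@wT R W) k) (at level 10, k at level 9).
Local Notation "'Uz' k" := (iterz (@wU R W) k) (at level 10, k at level 9).
Variable freq : H -> J -> L2.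
Hypothesis z1 : forall j, nsq (z j) = 1.
Hypothesis z_inj : injective z.
Hypothesis sigmaK : cancel sigma tau.
Hypothesis tauK : cancel tau sigma.
Hypothesis z_sq : forall j, z (sigma j) = z j ^+ 2.
Variable j0 : J.
Hypothesis freqP : forall c x y a, freq (c *: x + y) a = c *: freq x a + freq y a.
Hypothesis freq_ext : forall x y, (forall a, freq x a = freq y a) -> x = y.
Hypothesis freq_surj : forall g, exists x, forall a, freq x a = g a.
Hypothesis freq_dot : forall x y, \sum_a dL (freq x a) (freq y a) = (pi *+ 2)%:C * d x y.
Hypothesis freq_TzE : forall x a k,
  {ae mu, forall xi, freq (Tz k x) a xi = w a xi ^ k * freq x a xi}.
Hypothesis freq_UnE : forall x n, exists2 c : C, c != 0 & forall a,
  {ae mu, forall xi, freq (iter n U x) a xi = c * freq x (iter n sigma a) (2 ^+ n * xi)}.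
Variable B : H -> H.
Hypothesis UK : cancel U B.
Hypothesis BK : cancel B U.
Hypothesis UzP : forall k c x y, Uz k (c *: x + y) = c *: Uz k x + Uz k y.
Hypothesis dot_Uz : forall k x y, d (Uz k x) (Uz k y) = d x y.
Hypothesis cH : hcomplete d.

Local Notation supp := (supp freq).
Local Notation cell := (cell z).
Local Notation closed_cell := (closed_cell z).
Local Notation ring_cell := (ring_cell z tau).

(** The space $U^{-n} V_0$ written as a preimage, so that $U V_n = V_{n-1}$ is a change of index and
    closedness is inherited through the isometry. *)
Definition mra_space (n : int) : set H := [set x | supp cell (Uz n x)].
Local Notation V := mra_space.

Let mcell a : measurable (cell a).
Proof. exact: measurable_cell. Qed.

Lemma mra_closed n : closed_subspace d (V n).
Proof.
apply: (isometry_closed_preimage (UzP n)).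
  by move=> x; rewrite /sqn dot_Uz.
exact: (supp_closed freqP freq_dot mcell).
Qed.

Lemma freq_UE1 x : exists2 c : C, c != 0 & forall a,
  {ae mu, forall xi, freq (U x) a xi = c * freq x (sigma a) (2 * xi)}.
Proof. by have [c c0 E] := freq_UnE x 1; exists c => // a; exact: E. Qed.

Lemma supp_cell_U x : supp cell x -> supp cell (U x).
Proof.
move=> hx a; have [c c0 E] := freq_UE1 x; have t2 : 0 < 2 :> R by [].
apply: aeS2 (E a) (ae_scale t2 (hx (sigma a))) => xi E1 h nc; apply: etrans E1 _.
rewrite h ?mulr0// => /(cell_half z1 sigmaK z_sq).
by rewrite mulrAC divff ?mul1r ?pnatr_eq0.
Qed.

Lemma mra_incr n : V n `<=` V (n + 1).
Proof. by move=> x; rewrite /mra_space /= (iterzS UK BK) => /supp_cell_U. Qed.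

Lemma mra_U n : U @` V n = V (n - 1).
Proof.
have e x : Uz (n - 1) (U x) = Uz n x by rewrite -(iterzSr UK BK) subrK.
apply/seteqP; split => [_ [x Vx <-]|y Vy]; first by rewrite /mra_space /= e.
by exists (B y); [rewrite /mra_space /= -e BK|exact: BK].
Qed.

Lemma cell_ball : exists2 delta : R, 0 < delta & forall a xi, `|xi| < delta -> cell a xi.
Proof.
have : \forall xi \near (0 : R), forall a, cell a xi.
  apply: (@filter_forall _ _ (fun a => cell a) (nbhs (0 : R))) => a.
  by apply: open_nbhs_nbhs; split; [exact: open_cell|exact: cell_center].
move/nbhs_ballP => [e /= e0 he]; exists e => // a xi xie.
by apply: he; rewrite /ball /= sub0r normrN.
Qed.

Lemma pow2_gt (r : R) : exists n, r < 2 ^+ n.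
Proof. by exists (Num.bound r); exact: upper_nthrootP. Qed.

(** Vectors with boundedly supported transforms are dense, and enough dilations shrink such a
    support into a ball contained in every cell. *)
Lemma mra_dense : hclosure d (\bigcup_n V n) = setT.
Proof.
apply/seteqP; split=> // x _.
have h n : exists y, forall a, freq y a = truncL2 (freq x a) n by exact: freq_surj.
pose xs n := sval (cid (h n)).
have xsE n a : freq (xs n) a = truncL2 (freq x a) n by rewrite /xs; case: cid.
apply: (hlim_closure (u := xs)) => [n|].
  have [delta d0 hd] := cell_ball.
  (* Since $2^m > (n+1)/\delta$, the $m$-th dilate has its transform supported in $|\xi| \le
     (n+1)/2^m < \delta$; hence [xs n] lies in $V_m$. *)
  have [m hm] := pow2_gt (n.+1%:R / delta).
  exists (Posz m) => // a; have [c c0 E] := freq_UnE (xs n) m.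
  have p2 : 0 < 2 ^+ m :> R by rewrite exprn_gt0.
  have E1 := L2_classE (sqint_truncf (freq x (iter m sigma a)) n.+1).
  apply: aeS2 (E a) (ae_scale p2 E1) => xi e1 e2 nc; apply: etrans e1 _.
  rewrite xsE [X in c * X]e2 (truncf0 _ (leqnn _)) ?mulr0//.
  move=> hw; apply: nc; apply: hd.
  have : `|2 ^+ m * xi| <= n.+1%:R by move: hw; rewrite /window /= in_itv /= ler_norml.
  rewrite normrM (ger0_norm (ltW p2)) => hx.
  rewrite -(ltr_pM2l p2); apply: le_lt_trans hx _.
  by rewrite -ltr_pdivrMr.
rewrite /hlim (_ : (fun n => _) = (fun n => (pi *+ 2)^-1 *
    \sum_a sqn dL (truncL2 (freq x a) n - freq x a))).
  have s0 : \sum_(a : J) (0 : R) = 0 by exact: big1_eq.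
  have h1 a : sqn dL (truncL2 (freq x a) n - freq x a) @[n --> \oo] --> (0 : R).
    exact: truncL2_hlim.
  have h2 := cvg_sumR (s := index_enum J) h1.
  have h3 := cvgMl_tmp (a := (pi *+ 2)^-1) h2.
  by rewrite s0 mulr0 in h3; exact: h3.
apply/funext => n; have p0 : pi *+ 2 != 0 :> R by rewrite (gt_eqF (pi2_gt0 R)).
apply: (mulfI p0); rewrite -(sum_sqn freq_dot) mulVKf//.
by apply: eq_bigr => a _; rewrite (spectrumB freqP) xsE.
Qed.

(** A vector of $V_{-n}$ is $U^n y$ with $y \in V_0$, so its transform vanishes where $|2^n \xi| \ge
    \pi$. Over all $n$ this leaves only $\xi = 0$. *)
Lemma mra_inter : \bigcap_n V n = [set 0].
Proof.
apply/seteqP; split => [x hx|_ -> n _]; last by have [V0 _ _] := mra_closed n.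
apply: (freq_ae0 freqP freq_ext) => a.
have h n : {ae mu, forall xi, pi <= `|2 ^+ n * xi| -> freq x a xi = 0}.
  pose y := Uz (- n%:Z) x; have hy : supp cell y := hx (- n%:Z) I.
  have xy : x = iter n U y by rewrite -[iter n U y]/(Uz n (Uz (- n%:Z) x)) -(iterzD UK BK) subrr.
  have [c c0 E] := freq_UnE y n; have p2 : 0 < 2 ^+ n :> R by rewrite exprn_gt0.
  rewrite xy; apply: aeS2 (E a) (ae_scale p2 (hy (iter n sigma a))) => xi e1 e2 xip.
  apply: etrans e1 _; rewrite e2 ?mulr0// => -[]; by rewrite ltNge xip.
apply: aeS2 (ae_foralln h) (ae_neq 0) => xi hxi /eqP xi0.
have x0 : 0 < `|xi| by rewrite normr_gt0.
have [n hn] := pow2_gt (pi / `|xi|); apply: (hxi n).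
by rewrite normrM ger0_norm ?exprn_ge0// ltW// -ltr_pdivrMr.
Qed.

Let injc : forall a x b y, cell a x -> cell b y -> w a x = w b y -> a = b /\ x = y.
Proof. by move=> a x b y; exact: cell_inj. Qed.

Let fcell a : (mu (cell a) < +oo)%E.
Proof. exact: window_subset_fin (mcell a) (@cell_window _ _ z a). Qed.

Lemma scaling_vector_basis phi : (forall a, freq phi a = L2_class (cutoff (cell a) (fun=> 1))) ->
  orthonormal_basis d (supp cell) (fun k : int => Tz k phi).
Proof.
exact: (tile_basis z1 freqP freq_ext freq_dot freq_TzE cH (@open_cell R J z) fcell injc
  (cell_sum z1 z_inj j0)).
Qed.

Lemma mra_spaceP : exists phi, mra_with V phi.
Proof.
have [phi hphi] := freq_surj (fun a => L2_class (cutoff (cell a) (fun=> 1))).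
exists phi; split.
- exact: mra_closed.
- exact: mra_incr.
- by split; [exact: mra_dense|exact: mra_inter].
- exact: mra_U.
- split; last exact: scaling_vector_basis.
  exact: (tile_supp freq_TzE (@open_cell R J z) fcell hphi 0).
Qed.

Let dbl a : set R := [set xi | cell (tau a) (xi / 2)].

Lemma mra_space1P x : V 1 x <-> supp dbl x.
Proof.
have [c c0 E] := freq_UE1 x; have t2 : 0 < 2 :> R by []; have i2 : 0 < 2^-1 :> R by rewrite invr_gt0.
split=> hx a; last first.
  apply: aeS2 (E a) (ae_scale t2 (hx (sigma a))) => xi E1 h nc; apply: etrans E1 _.
  by rewrite h ?mulr0// /dbl /= sigmaK mulrAC divff ?mul1r ?pnatr_eq0.
have h1 := ae_scale i2 (aeS2 (fun xi p q => conj p q) (E (tau a)) (hx (tau a))).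
apply: aeS h1 => xi [E1 h] nd; apply: (mulfI c0); rewrite mulr0.
move: E1; rewrite tauK mulVKf// => E1; apply: etrans (esym E1) (h _).
by rewrite mulrC.
Qed.

(** Membership in $V_1$ confines the transform to the doubled cells, and orthogonality to $V_0$
    makes it vanish on the cells; the boundary between open and closed cells is null. *)
Lemma wavelet_space : orthocomplement d (V 1) (V 0) = supp ring_cell.
Proof.
apply/seteqP; split => x.
  move=> [/mra_space1P hx xV] a; have h := ortho_supp freqP freq_surj freq_dot mcell xV.
  have h1 := aeS2 (fun xi p q => conj p q) (hx a) (h a).
  apply: aeS2 (ae_closed_cell z1 z_inj a) h1 => xi hc [h2 h3] nr.
  have [hd|/h2//] := pselect (dbl a xi).
  by apply: h3; apply/hc; apply: contrapT => nc; apply: nr; split.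
move=> hx; split.
  apply/mra_space1P => a; apply: aeS (hx a) => xi h nd; apply: h => -[hd _]; exact: nd.
move=> y hy; have p0 : (pi *+ 2)%:C != 0 :> C.
  by apply/eqP => -[] /eqP; rewrite (gt_eqF (pi2_gt0 R)).
apply: (mulfI p0); rewrite -freq_dot mulr0 big1// => a _; rewrite L2_dotE -[RHS]cint0.
apply: ae_eq_cint; [by apply: cmeasM; [exact: L2_cmeas|apply: cmeasJ; exact: L2_cmeas]|exact: cmeas_cst|].
apply: aeS2 (hx a) (hy a) => xi h1 h2.
have [hr|nr] := pselect (ring_cell a xi); last by rewrite (h1 nr) mul0r.
rewrite h2 ?cJ0 ?mulr0// => hc; case: hr => _; apply.
by have := cell_sub z1 hc.
Qed.

Let fring a : (mu (ring_cell a) < +oo)%E.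
Proof. exact: window_subset_fin (@measurable_ring_cell R J z tau a) (@ring_cell_window _ _ z tau a). Qed.

Lemma wavelet_vector_basis psi :
  (forall a, freq psi a = L2_class (cutoff (ring_cell a) (fun=> 1))) ->
  orthonormal_basis d (supp ring_cell) (fun k : int => Tz k psi).
Proof.
have injr a x b y : ring_cell a x -> ring_cell b y -> w a x = w b y -> a = b /\ x = y.
  exact: ring_cell_inj.
exact: (tile_basis z1 freqP freq_ext freq_dot freq_TzE cH (@open_ring_cell R J z tau) fring injr
  (ring_cell_sum z1 z_inj sigmaK tauK z_sq j0)).
Qed.

(* For [xi] outside the cell of [b] there is a largest [n] with [xi / 2^n] outside the cell of
   [tau^n b]; then [xi / 2^n] lies in the ring of [tau^n b], up to a null set. *)
Lemma ring_free_mra x : (forall (n : nat) a, vanishes_on (ring_cell a) (freq (iter n U x) a)) ->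
  V 0 x.
Proof.
move=> hx b.
have h n : {ae mu, forall xi, ring_cell (iter n tau b) (xi / 2 ^+ n) -> freq x b xi = 0}.
  have [c c0 E] := freq_UnE x n; have p2 : 0 < (2 ^+ n)^-1 :> R by rewrite invr_gt0 exprn_gt0.
  have h1 := ae_scale p2 (aeS2 (fun xi p q => conj p q) (E (iter n tau b)) (hx n (iter n tau b))).
  have st : iter n sigma (iter n tau b) = b.
    by elim: n {hx E h1 p2} => // n IH; rewrite iterSr iterS tauK.
  apply: aeS h1 => xi [E1 h1] hr; apply: (mulfI c0); rewrite mulr0.
  move: E1; rewrite st mulVKf ?expf_neq0 ?pnatr_eq0// => E1; apply: etrans (esym E1) (h1 _).
  by rewrite mulrC.
have hc n : {ae mu, forall xi, closed_cell (iter n tau b) (xi / 2 ^+ n) -> cell (iter n tau b) (xi / 2 ^+ n)}.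
  have p2 : 0 < (2 ^+ n)^-1 :> R by rewrite invr_gt0 exprn_gt0.
  by apply: aeS (ae_scale p2 (ae_closed_cell z1 z_inj (iter n tau b))) => xi hxi; rewrite mulrC => /hxi.
apply: aeS2 (ae_foralln h) (ae_foralln hc) => xi h1 h2 nc.
pose Q n := cell (iter n tau b) (xi / 2 ^+ n).
have [N QN] : exists N, Q N.
  have [delta d0 hd] := cell_ball; have [N hN] := pow2_gt (`|xi| / delta).
  exists N; apply: hd; rewrite normrM normfV normrX normr_nat ltr_pdivrMr ?exprn_gt0//.
  by rewrite mulrC -ltr_pdivrMr.
have [n [nQ QS]] : exists n, ~ Q n /\ Q n.+1.
  elim: N QN => [|N IH QN]; first by rewrite /Q expr0 divr1.
  by have [/IH//|nQ] := pselect (Q N); exists N.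
apply: (h1 n); split; last by move=> /h2.
by move: QS; rewrite /Q iterS exprSr invfM mulrA.
Qed.

Lemma mra_step x : V 1 x -> forall n : nat, V 0 (iter n.+1 U x).
Proof.
move=> V1 n; elim: n => [|n IH]; first exact: V1.
exact: supp_cell_U IH.
Qed.

(** Scales are mutually orthogonal because $U^{r+1}$ maps $V_1$ into $V_0$, to which the wavelets
    $T^l\psi$ are orthogonal. A vector orthogonal to the whole family has all its $U^k x$ orthogonal
    to the wavelet space, hence free of the rings; [ring_free_mra] puts every $U^k x$ in $V_0$, so
    [x] lies in all the $V_k$. *)
Lemma wavelet_basis psi :
  (forall a, freq psi a = L2_class (cutoff (ring_cell a) (fun=> 1))) ->
  orthonormal_basis d setT (fun mn : int * int => Uz mn.1 (Tz mn.2 psi)).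
Proof.
move=> hpsi; have [ob cl] := wavelet_vector_basis hpsi.
have Wpsi k : orthocomplement d (V 1) (V 0) (Tz k psi).
  rewrite wavelet_space.
  exact: (tile_supp freq_TzE (@open_ring_cell R J z tau) fring hpsi k).
have orth k l (m : int) (n : nat) : d (Uz (m + n.+1%:Z) (Tz k psi)) (Uz m (Tz l psi)) = 0.
  rewrite (iterzD UK BK) dot_Uz dotC.
  have [_ ->] := Wpsi l; first by rewrite cJ0.
  by apply: mra_step; case: (Wpsi k).
have gap_exists (m n : int) : m < n -> exists r : nat, n = m + r.+1%:Z.
  move=> mn; exists `|n - m|%N.-1; rewrite prednK; last by rewrite absz_gt0 subr_eq0 gt_eqF.
  by rewrite gez0_abs ?subr_ge0 ?(ltW mn)//; ring.
apply: complete_orthonormal_basis => //.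
- move=> [m k] [n l] /=; rewrite xpair_eqE; case: (ltgtP m n) => mn /=.
  + by have [r ->] := gap_exists _ _ mn; rewrite dotC orth cJ0.
  + by have [r ->] := gap_exists _ _ mn; rewrite orth.
  + by rewrite mn dot_Uz ob.
move=> x _ x0.
have vanish k a : vanishes_on (ring_cell a) (freq (Uz k x) a).
  apply: (ortho_supp freqP freq_surj freq_dot (@measurable_ring_cell R J z tau)).
  move=> y; rewrite -cl => hy; apply: ortho_hclosure hy => u [s [c ->]].
  rewrite dotC dot_suml big1 ?cJ0// => n _; rewrite dotZl dotC.
  (* Unitarity moves $U^k$ to the other argument as $U^{-k}$, where the hypothesis on [x]
     applies. *)
  have e : d (Uz k x) (Tz n psi) = d x (Uz (- k) (Tz n psi)).
    by rewrite -(dot_Uz k x) -(iterzD UK BK) subrr.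
  by rewrite e (x0 (- k, n)) cJ0 mulr0.
suff : (\bigcap_n V n) x by rewrite mra_inter.
move=> k _; rewrite -[V k x]/(V 0 (Uz k x)); apply: ring_free_mra => n a.
by rewrite -[iter n U _]/(Uz n (Uz k x)) -(iterzD UK BK).
Qed.

Lemma super_wavelet : exists psi, orthogonal_mra_super_wavelet V psi.
Proof.
have [psi hpsi] := freq_surj (fun a => L2_class (cutoff (ring_cell a) (fun=> 1))).
have [phi hphi] := mra_spaceP.
exists psi; split.
- by exists phi.
- rewrite wavelet_space.
  exact: (tile_supp freq_TzE (@open_ring_cell R J z tau) fring hpsi 0).
- by rewrite wavelet_space; exact: wavelet_vector_basis.
- exact: wavelet_basis.
Qed.

End Multiresolution.

(** * All the cycle points as one index set *)

Lemma iter_ordS n (a : 'I_n) k : iter k (@ordS n) a = ((a + k) %% n)%N :> nat.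
Proof.
elim: k => [|k IH]; first by rewrite addn0 modn_small.
by rewrite iterS /= IH -addn1 modnDml addn1 addnS.
Qed.

Lemma ordS_transitive n (a b : 'I_n) : exists k, iter k (@ordS n) a = b.
Proof.
exists (b + n - a)%N; apply: val_inj => /=; rewrite iter_ordS subnKC; last first.
  by rewrite ltnW// ltn_addl.
by rewrite modnDr modn_small.
Qed.

Section Cycles.
Variable R : realType.

(** A cycle is the forward orbit under squaring of any one of its points, so a shared point carries
    the whole cycle along. *)
Lemma cycle_points_sub (D D' : sqcycle R) (a : 'I_(clength D)) (b : 'I_(clength D')) :
  Defs.cpoint a = Defs.cpoint b -> cycle_points D `<=` cycle_points D'.
Proof.
move=> ab _ [c _ <-]; have [k <-] := ordS_transitive a c.
exists (iter k (@ordS _) b) => //.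
by elim: k => //= k IH; rewrite -!cpoint_sq IH.
Qed.

Variables (p : nat) (C : 'I_p -> sqcycle R).

Definition cindex : finType := {i : 'I_p & 'I_(clength (C i))}.

Definition cidx i (j : 'I_(clength (C i))) : cindex := Tagged _ j.

Definition czpoint (a : cindex) : R[i] := Defs.cpoint (tagged a).
Definition csucc (a : cindex) : cindex := cidx (ordS (tagged a)).
Definition cpred (a : cindex) : cindex := cidx (ord_pred (tagged a)).

Lemma csuccK : cancel csucc cpred.
Proof. by case=> i j; rewrite /cpred /csucc /= ordSK. Qed.

Lemma cpredK : cancel cpred csucc.
Proof. by case=> i j; rewrite /cpred /csucc /= ord_predK. Qed.

(** Two cycles with a common point coincide as sets, so distinctness as sets already makes them
    disjoint. *)
Lemma czpoint_inj : (forall i j, i <> j -> cycle_points (C i) <> cycle_points (C j)) ->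
  injective czpoint.
Proof.
move=> Cd [i a] [j b]; rewrite /czpoint /= => ab.
have [ij|/eqP ij] := eqVneq i j; last first.
  case: (Cd i j ij); apply/seteqP; split; [exact: cycle_points_sub ab|].
  by apply: cycle_points_sub (esym ab).
by subst j; congr existT; exact: cpoint_inj ab.
Qed.

Let W := direct_sum (fun i => cycle_rep (C i)).

Definition ccomp (x : wspace W) (a : cindex) : L2 R := x (tag a) (tagged a).
Definition cmk (f : cindex -> L2 R) : wspace W := fun i j => f (cidx j).

Lemma ccomp_ext x y : (forall a, ccomp x a = ccomp y a) -> x = y.
Proof.
move=> h; apply: functional_extensionality_dep => i.
by apply: functional_extensionality_dep => j; exact: (h (cidx j)).
Qed.

Lemma cdotE x y : wdot W x y = \sum_a L2_dot (ccomp x a) (ccomp y a).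
Proof.
rewrite -(@sig_big_dep _ _ _ _ _ xpredT (fun=> xpredT)
  (fun i j => L2_dot (x i j) (y i j)))//.
Qed.

Lemma ccomplete : hcomplete (wdot W).
Proof. by apply: dsum_complete => i; apply: dsum_complete => j; exact: L2_complete. Qed.

End Cycles.

Theorem mainTheorem6 (R : realType) (p : nat) (C : 'I_p -> sqcycle R)
    (p_gt0 : (0 < p)%N)
    (C_distinct : forall i j : 'I_p, i <> j -> cycle_points (C i) <> cycle_points (C j)) :
  let W := direct_sum (fun i => cycle_rep (C i)) in
  (exists phi : wspace W, orthogonal_scaling_vector phi) /\
  (exists (V : int -> set (wspace W)) (psi : wspace W),
     orthogonal_mra_super_wavelet V psi).
Proof.
move=> W.
have z1 (a : cindex C) : nsq (czpoint a) = 1 by apply: norm_nsq; exact: cpoint_circle.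
have z_sq (a : cindex C) : czpoint (csucc a) = czpoint a ^+ 2 by exact: esym (cpoint_sq _).
have z_inj := czpoint_inj C_distinct.
(* At least one cycle point is required for the arcs to cover the circle; [p_gt0] and [clength_gt0]
   provide it. *)
pose j0 : cindex C := cidx (Ordinal (clength_gt0 (C (Ordinal p_gt0)))).
have mkE (f : cindex C -> L2 R) a : ccomp (cmk f) a = f a by case: a.
have ext := @ccomp_ext R p C.
have compP (c : R[i]) (x y : wspace W) (a : cindex C) :
  ccomp (c *: x + y) a = c *: ccomp x a + ccomp y a by [].
have dE := @cdotE R p C.
have compU (x : wspace W) (a : cindex C) : ccomp (wU x) a = dilation (ccomp x (csucc a)) by [].
have compT (x : wspace W) (a : cindex C) :
  ccomp (wT x) a = multiplier (fun v => czpoint a * v) (ccomp x a) by [].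
have cH := @ccomplete R p C.
have [B [UK BK]] := U_bij (@csuccK R p C) (@cpredK R p C) mkE ext compU.
have uP := UzP (@csuccK R p C) (@cpredK R p C) mkE ext compP compU.
have dU := dot_Uz (@csuccK R p C) (@cpredK R p C) mkE ext compP dE compU.
have fP := freqP compP.
have fext := fun x y => freq_ext ext (x := x) (y := y).
have fsurj := freq_surj mkE.
have fdot := freq_dot dE.
have fT := freq_TzE z1 mkE ext compT.
have fU := freq_UnE compU.
split.
  have [phi hphi] := mra_spaceP z1 z_inj (@csuccK R p C) z_sq j0 fP fext fsurj fdot fT fU UK BK uP dU cH.
  by exists phi; eexists; exact: hphi.
have [psi hpsi] := super_wavelet z1 z_inj (@csuccK R p C) (@cpredK R p C) z_sq j0 fP fext fsurj fdot fT fU UK BK uP dU cH.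
by eexists; exists psi; exact: hpsi.
Qed.
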